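(* For every real $p>2$ there exists a constant $c(p)$ (depending only on $p$) such that for all complex-valued $u\in\ell^2(\mathbb{Z})$, with symmetric-decreasing rearrangement $u^*$, $$\sum_{n\in\mathbb{Z}}|u(n)|^p\ \le\ c(p)\sum_{n\in\mathbb{Z}}|u^*(n)|^p .$$ Moreover, for all $u\in\ell^2(\mathbb{Z})$, $$\sum_{n\in\mathbb{Z}}|u(n)-u(n-1)|^2\ \ge\ \sum_{n\in\mathbb{Z}}|u^*(n)-u^*(n-1)|^2 .$$
   Context: Decreasing rearrangement on the half-line: let $\mathbb{Z}^+=\{0,1,2,\dots\}$. For a finite set $A\subset\mathbb{Z}^+$ with $|A|=k$ put $A^*=\{0,1,\dots,k-1\}$. For $f:\mathbb{Z}^+\to\mathbb{C}$ such that $\{|f|>t\}$ is finite for all $t>0$, set $\widetilde f(n):=\int_0^\infty\chi_{\{|f|>t\}^*}(n)\,dt$, $n\in\mathbb{Z}^+$. Fourier rearrangement: for $u\in\ell^2(\mathbb{Z})$ let $F(u)(x):=(2\pi)^{-1/2}\sum_{n\in\mathbb{Z}}u(n)e^{-inx}$, $x\in(-\pi,\pi)$, with inverse $F^{-1}(g)(n)=(2\pi)^{-1/2}\int_{-\pi}^{\pi}g(x)e^{inx}\,dx$. For measurable $g$ on $(-\pi,\pi)$, extended by $0$ to $\mathbb{R}$, its symmetric decreasing rearrangement on the real line is $x\mapsto\int_0^\infty\chi_{\{|g|>t\}^*}(x)\,dt$, where for measurable $\Omega\subset\mathbb{R}$ of finite measure $\Omega^*$ is the open interval centered at $0$ with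 the same Lebesgue measure as $\Omega$. Then $u^\#:=F^{-1}(G)$, where $G$ is the symmetric decreasing rearrangement of $F(u)$. Symmetric-decreasing rearrangement on $\mathbb{Z}$: for $u\in\ell^2(\mathbb{Z})$, let $v:=\widetilde{\big(u^\#|_{\mathbb{Z}^+}\big)}$ be the decreasing rearrangement of the restriction of $u^\#$ to $\mathbb{Z}^+$, and define $u^*(n):=v(n)$ for $n\ge0$ and $u^*(n):=v(-n)$ for $n<0$. *)

(* Defs.v *)
From HB Require Import structures.
From mathcomp Require Import all_boot all_order all_algebra.
From mathcomp Require Import all_classical all_reals all_analysis.
From mathcomp Require Import finmap complex.

Set Implicit Arguments.
Unset Strict Implicit.
Unset Printing Implicit Defensive.

Import Order.TTheory GRing.Theory Num.Theory.
Import numFieldNormedType.Exports.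

Local Open Scope classical_set_scope.
Local Open Scope ring_scope.

(* [Normc.normc] is the modulus as an element of [R]; MathComp's [`|z|] on
   [R[i]] is an element of [R[i]]. *)
Notation cabs := Normc.normc.

Definition cexp {R : realType} (t : R) : R[i] := Complex (cos t) (sin t).

Definition ell2 {R : realType} (u : int -> R[i]) : Prop :=
  (\esum_(n in [set: int]) ((cabs (u n) ^+ 2)%:E) < +oo)%E.

(* Only meaningful for finite [A]: [fset_set] is empty on infinite sets. *)
Definition nat_set_rearr (A : set nat) : set nat := `I_(#|` fset_set A|%fset).

Definition decr_rearr {R : realType} (f : nat -> R[i]) (n : nat) : R :=
  \int[lebesgue_measure]_(t in `]0, +oo[)
     \1_(nat_set_rearr [set m | t < cabs (f m)]) n.

Definition line_set_rearr {R : realType} (A : set R) : set R :=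
  let r := fine (lebesgue_measure A) / 2 in [set` `]- r, r[%R].

Definition torus {R : realType} : set R := [set` `](- pi), pi[%R].

(* [g] is extended by 0 outside (-pi, pi). At [x = 0] the integral is the
   essential supremum of [|g|]; when that is infinite the real-valued integral
   returns 0, which changes the function at one point only. *)
Definition sym_rearr {R : realType} (g : R -> R[i]) (x : R) : R :=
  let g0 := patch (fun=> 0) torus g in
  \int[lebesgue_measure]_(t in `]0, +oo[)
     \1_(line_set_rearr [set y | t < cabs (g0 y)]) x.

Definition fourier_partial {R : realType} (u : int -> R[i]) (N : nat) (x : R) :
    R[i] :=
  ((Num.sqrt (2 * pi))^-1)%:C%C *
  \sum_(k < N.*2.+1)
     let n := k%:Z - N%:Z in u n * cexp (- (n%:~R * x)).

(* [g] represents the series in L^2(-pi, pi), i.e. the series converges to [g]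
   in L^2 (it need not converge pointwise). *)
Definition is_fourier {R : realType} (u : int -> R[i]) (g : R -> R[i]) : Prop :=
  [/\ measurable_fun torus (fun x => complex.Re (g x)),
      measurable_fun torus (fun x => complex.Im (g x)),
      (\int[lebesgue_measure]_(x in torus) (cabs (g x) ^+ 2)%:E < +oo)%E &
      (\int[lebesgue_measure]_(x in torus)
          (cabs (fourier_partial u N x - g x) ^+ 2)%:E)%E @[N --> \oo]
        --> 0%E].

(* A chosen representative; two representatives agree almost everywhere on
   (-pi, pi), hence have the same [sym_rearr]. *)
Definition fourier {R : realType} (u : int -> R[i]) : R -> R[i] :=
  xget (fun=> 0) [set g | is_fourier u g].

Definition inv_fourier {R : realType} (g : R -> R[i]) (n : int) : R[i] :=
  let h x := g x * cexp (n%:~R * x) in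
  ((Num.sqrt (2 * pi))^-1)%:C%C *
  Complex (\int[lebesgue_measure]_(x in torus) complex.Re (h x))
          (\int[lebesgue_measure]_(x in torus) complex.Im (h x)).

Definition fourier_rearr {R : realType} (u : int -> R[i]) : int -> R[i] :=
  inv_fourier (fun x => (sym_rearr (fourier u) x)%:C%C).

Definition sym_decr_rearr {R : realType} (u : int -> R[i]) (n : int) : R :=
  decr_rearr (fun m : nat => fourier_rearr u m%:Z) `|n|%N.

(* Main.v *)
Require Import Defs.
From mathcomp Require Import all_boot all_order all_algebra.
From mathcomp Require Import finmap complex.
From mathcomp Require Import all_classical all_reals all_analysis.
From mathcomp Require Import measurable_realfun ring lra zify.
Set Implicit Arguments.
Unset Strict Implicit.
Unset Printing Implicit Defensive.
Import Order.TTheory GRing.Theory Num.Theory.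
Import numFieldNormedType.Exports.
Local Open Scope classical_set_scope.
Local Open Scope ring_scope.

(** Both inequalities pass through the Fourier transform [g] of [u] and its
    symmetric decreasing rearrangement [G] on the circle, whose Fourier
    coefficients form the sequence that is then sorted.

    The energy of [u] is the integral of [|g| ^ 2] against [2 - 2 * cos x]
    ([is_fourier_diff], [sqnorm_le_esum]).  Since [|g|] and [G] are
    equimeasurable and the superlevel sets of [1 + cos] are centered intervals,
    on which [G ^ 2] has a larger integral than [|g| ^ 2], replacing [g] by [G]
    decreases this quantity ([sqnorm_diff_rearr]).  By Bessel's inequality
    it then dominates the energy of the coefficients of [G], and sorting their
    moduli on each half-line decreases the energy again: each drop of the
    sorted sequence is crossed by an edge of the original one, so the sorted
    drops are disjoint pieces of the original ones ([polya_szego_nat]).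

    For the norms with [p > 2], let [M m] be the integral of [G] over the
    interval of radius [1 / (m + 1)].  These masses control both sequences.
    On the one hand they bound [u], as in Paley's inequality: cutting [g] at
    the level [G (1 / (m + 1))], the upper part has coefficients of order [M m]
    and the square norm of the lower part is of order [\sum_(j <= m) M j ^ 2]
    ([sum_large_coef_le]); adding up over the levels [M m] yields a bound of
    [\sum_n |u n| ^ p] by [\sum_m M m ^ p], where [p > 2] is what allows the passage
    from squares to powers ([sum_powR_of_level_squares]).  On the other hand
    the masses are bounded by the coefficients of [G]: pairing [G] with a
    Fejer kernel shows that [M m] is at most a constant times the mean of the
    first [m + 1] moduli of coefficients ([masses_le_mean_coef]), and Hardy's
    inequality removes the means ([hardy]).  Sorting does not decrease the sum
    of [p]-th powers of the coefficients with nonnegative index, which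
    completes the chain.  The Riesz-Fischer theorem ([is_fourier_exists])
    ensures that [g] exists. *)

(** * Inequalities for finite sums *)

(** Young's inequality for the conjugate exponents [p / (p - 1)] and [p]. *)
Lemma young_powR (R : realType) (p A B : R) : 1 < p -> 0 <= A -> 0 <= B ->
  p * (A `^ (p - 1) * B) <= (p - 1) * A `^ p + B `^ p.
Proof.
move=> p1 A0 B0.
have p0 : 0 < p by lra.
have := @conjugate_powR R (A `^ (p - 1)) B (p / (p - 1)) p (powR_ge0 _ _) B0.
rewrite -powRrM mulrCA divff ?mulr1; last by lra.
move=> /(_ _ p0) H.
have {}H : A `^ (p - 1) * B <= A `^ p / (p / (p - 1)) + B `^ p / p.
  apply: H; first by rewrite divr_gt0//; lra.
  by field; apply/andP; split; apply/eqP; lra.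
rewrite -(ler_pM2l p0) in H; apply: (le_trans H).
by rewrite le_eqVlt; apply/orP; left; apply/eqP; field; apply/andP; split; apply/eqP; lra.
Qed.

(** Discrete Hardy inequality.  With [A n] the mean of the first [n] terms,
    convexity of [x `^ p] makes [n * A n `^ p] a telescoping quantity, which
    bounds the sum of [A `^ p] by that of [A `^ (p - 1) * a]; a trivial Young
    inequality then absorbs the factor [A `^ (p - 1)]. *)
Lemma hardy (R : realType) (p : R) : 1 < p ->
  exists2 C : R, 0 <= C & forall (a : nat -> R) N, (forall k, 0 <= a k) ->
    \sum_(n < N) ((\sum_(k < n.+1) a k) / n.+1%:R) `^ p
      <= C * \sum_(n < N) a n `^ p.
Proof.
move=> p1.
(* Where [a n <= e * A n.+1], the term [p * A n.+1 `^ (p - 1) * a n] is at most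
   half of the [(p - 1) * A n.+1 `^ p] gained by telescoping. *)
pose e := (p - 1) / (2 * p).
have e0 : 0 < e by rewrite divr_gt0//; lra.
exists (2 * p * e^-1 `^ (p - 1) / (p - 1)).
  by rewrite divr_ge0 ?mulr_ge0 ?powR_ge0//; lra.
move=> a N a0.
pose A n := (\sum_(k < n) a k) / n%:R.
have A0 n : 0 <= A n by rewrite divr_ge0// sumr_ge0.
have An n : n%:R * A n = \sum_(k < n) a k.
  case: n => [|n]; first by rewrite mul0r big_ord0.
  by rewrite mulrC divfK.
have step n : p * A n.+1 `^ p + n%:R * A n.+1 `^ p
    <= p * (A n.+1 `^ (p - 1) * a n) + n%:R * A n `^ p.
  have -> : a n = n.+1%:R * A n.+1 - n%:R * A n.
    by rewrite !An big_ord_recr/= addrAC subrr add0r.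
  have Y := young_powR p1 (A0 n.+1) (A0 n).
  have := ler_wpM2l (ler0n R n) Y.
  have := @mulr_powRB1 R (A n.+1) p (A0 n.+1) (lt_trans ltr01 p1).
  move: (A n.+1 `^ (p - 1)) (A n.+1 `^ p) (A n `^ p) => u v w.
  move=> uv; rewrite -uv -natr1; nra.
have sumA : \sum_(n < N) ((p - 1) * A n.+1 `^ p) + N%:R * A N `^ p
    <= \sum_(n < N) p * (A n.+1 `^ (p - 1) * a n).
  elim: N => [|N IH]; first by rewrite !big_ord0 mul0r addr0.
  rewrite !big_ord_recr/=.
  have := step N; rewrite -(natr1 N); move: IH; lra.
have absorb n : p * (A n.+1 `^ (p - 1) * a n)
    <= (p - 1) / 2 * A n.+1 `^ p + p * e^-1 `^ (p - 1) * a n `^ p.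
  have [ae|ea] := leP (a n) (e * A n.+1).
    have -> : (p - 1) / 2 * A n.+1 `^ p = p * (A n.+1 `^ (p - 1) * (e * A n.+1)).
      rewrite -(@mulr_powRB1 _ _ p) ?(lt_trans ltr01)// /e.
      by field; apply/eqP; lra.
    rewrite -[leLHS]addr0 lerD// ?mulr_ge0 ?powR_ge0//; last by lra.
    by rewrite ler_pM2l ?ler_wpM2l ?powR_ge0//; lra.
  rewrite -[leLHS]add0r lerD ?mulr_ge0 ?powR_ge0//; first by lra.
  rewrite -(@mulr_powRB1 _ (a n) p) ?(lt_trans ltr01)//.
  rewrite -!mulrA ler_pM2l ?(lt_trans ltr01)//.
  rewrite [leRHS]mulrCA [leLHS]mulrC ler_wpM2l//.
  rewrite -powRM ?invr_ge0 ?(ltW e0)// ge0_ler_powR ?nnegrE//; first by lra.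
    by rewrite mulr_ge0 ?invr_ge0 ?(ltW e0).
  by rewrite mulrC ler_pdivlMr// mulrC ltW.
have : \sum_(n < N) ((p - 1) * A n.+1 `^ p)
    <= \sum_(n < N) ((p - 1) / 2 * A n.+1 `^ p + p * e^-1 `^ (p - 1) * a n `^ p).
  apply: (@le_trans _ _ (\sum_(n < N) p * (A n.+1 `^ (p - 1) * a n))); last first.
    by apply: ler_sum => i _; exact: absorb.
  apply: le_trans sumA.
  by rewrite lerDl mulr_ge0 ?powR_ge0.
rewrite big_split/= -!mulr_sumr => H.
rewrite mulrAC ler_pdivlMr; last by lra.
rewrite /A in H; move: H.
by move: (\sum_(i < N) _ `^ p) (e^-1 `^ (p - 1)) (\sum_(n < N) _) => U V W; lra.
Qed.

(** Passage from second moments to [p]-th moments: the factor [x k ^ (p - 2)]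
    is telescoped along the levels [c * b m] that [x k] exceeds, the second
    moment above each level is bounded by hypothesis, and an Abel summation
    moves the differences of the levels back onto [b].  The doubling condition
    lets the value of [b] at an index be replaced by the next one. *)
Lemma sum_powR_of_level_squares (R : realType) (p c D : R) (b : nat -> R)
    (I : Type) (s : seq I) (x : I -> R) (M : nat) :
  2 < p -> 0 <= c -> 0 <= D ->
  (forall j, 0 <= b j) -> (forall j, b j.+1 <= b j) ->
  (forall j, b j <= 2 * b j.+1) ->
  (forall k, 0 <= x k <= c * b 0%N) ->
  (forall m, \sum_(k <- s | c * b m < x k) x k ^+ 2
               <= D * \sum_(j < m.+1) b j ^+ 2) ->
  \sum_(k <- s | c * b M < x k) x k `^ p
    <= D * (2 * c) `^ (p - 2) * \sum_(j < M.+1) b j `^ p.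
Proof.
move=> p2 c0 D0 b0 bS b2 xb Hsq.
pose q := p - 2; have q0 : 0 < q by rewrite /q; lra.
pose w m := (c * b m) `^ q.
have cb0 j : 0 <= c * b j by rewrite mulr_ge0.
have wS m : w m.+1 <= w m.
  by apply: ge0_ler_powR; rewrite ?nnegrE ?(ltW q0)//; exact: ler_wpM2l.
have levels (y : R) : 0 <= y <= c * b 0%N ->
    y `^ q <= w M + \sum_(m < M) (w m - w m.+1) * (c * b m.+1 < y)%R%:R.
  move=> /andP[y0 yb]; elim: M => [|M' IH].
    rewrite big_ord0 addr0; apply: ge0_ler_powR => //; rewrite ?nnegrE//.
    exact: ltW.
  rewrite big_ord_recr/=; case: (ltP (c * b M'.+1) y) => [h|h].
    by rewrite mulr1; move: IH; lra.
  rewrite mulr0 addr0 -[leLHS]addr0 lerD//.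
    by apply: ge0_ler_powR; rewrite ?nnegrE//; exact: ltW.
  by apply: sumr_ge0 => i _; rewrite mulr_ge0// subr_ge0.
pose T m := \sum_(j < m.+1) b j ^+ 2.
have bound1 : \sum_(k <- s | c * b M < x k) x k `^ p
    <= D * (w M * T M + \sum_(m < M) (w m - w m.+1) * T m.+1).
  apply: (@le_trans _ _ (\sum_(k <- s | c * b M < x k)
    (w M + \sum_(m < M) (w m - w m.+1) * (c * b m.+1 < x k)%R%:R) * x k ^+ 2)).
    apply: ler_sum => k kM.
    have xk0 : x k != 0 by rewrite gt_eqF// (le_lt_trans _ kM).
    have -> : x k `^ p = x k `^ q * x k ^+ 2.
      have /andP[? _] := xb k.
      by rewrite -powR_mulrn// -powRD ?xk0 ?implybT// /q subrK.
    by rewrite ler_wpM2r ?sqr_ge0// levels.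
  under eq_bigr do rewrite mulrDl mulr_suml.
  rewrite big_split/= -mulr_sumr mulrDr lerD//.
    by rewrite mulrCA ler_wpM2l ?powR_ge0.
  rewrite exchange_big/= mulr_sumr; apply: ler_sum => m _.
  under eq_bigr do rewrite -mulrA.
  rewrite -mulr_sumr mulrCA ler_wpM2l ?subr_ge0//.
  apply: le_trans (Hsq m.+1).
  rewrite [leLHS]big_mkcond [leRHS]big_mkcond/=; apply: ler_sum => k _.
  case: (ltP (c * b m.+1)) => _; rewrite ?mul1r ?mul0r; case: ifP => //.
  by rewrite sqr_ge0.
have abel M' : w M' * T M' + \sum_(m < M') (w m - w m.+1) * T m.+1
    <= (2 * c) `^ q * \sum_(j < M'.+1) b j `^ p.
  have wb j i : b i <= 2 * b j -> w i * b j ^+ 2 <= (2 * c) `^ q * b j `^ p.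
    move=> bij.
    have [bj0|bj0] := eqVneq (b j) 0.
      by rewrite bj0 expr0n/= mulr0 mulr_ge0 ?powR_ge0.
    have -> : b j `^ p = b j `^ q * b j ^+ 2.
      by rewrite -powR_mulrn// -powRD ?bj0 ?implybT// /q subrK.
    rewrite mulrA ler_wpM2r ?sqr_ge0// -powRM ?mulr_ge0//.
    apply: ge0_ler_powR; rewrite ?nnegrE ?(ltW q0) ?mulr_ge0//.
    by have := ler_wpM2l c0 bij; lra.
  elim: M' => [|M' IH].
    rewrite big_ord0 addr0 /T !big_ord1; apply: wb.
    by have := b0 0%N; lra.
  rewrite [leLHS](_ : _ = (w M' * T M' + \sum_(m < M') (w m - w m.+1) * T m.+1)
                          + w M' * b M'.+1 ^+ 2).
    by rewrite [in leRHS]big_ord_recr/= mulrDr lerD// wb.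
  rewrite big_ord_recr/= /T !(big_ord_recr M'.+1)/=.
  by ring.
by apply: (le_trans bound1); rewrite -mulrA ler_wpM2l.
Qed.

(** * Decreasing rearrangement of a sequence *)

(** The decreasing rearrangement through its level sets: this form gives direct
    access to the positions of large values, and needs no cardinality of a
    possibly infinite set. *)
Definition is_decr_rearr (R : realType) (f v : nat -> R) :=
  (forall n, 0 <= v n) /\
  forall (t : R) n, 0 < t ->
    (t < v n <-> exists s : seq nat,
       [/\ uniq s, size s = n.+1 & forall m, m \in s -> t < f m]).

Lemma decr_rearr_nonincreasing (R : realType) (f v : nat -> R) :
  is_decr_rearr f v -> forall n, v n.+1 <= v n.
Proof.
move=> [v0 H] n; rewrite leNgt; apply/negP => lt.
pose t := (v n + v n.+1) / 2.
have vn := v0 n.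
have t0 : 0 < t by rewrite /t; lra.
have /(H _ _ t0)[s0 [us0 ss0 sf0]] : t < v n.+1 by rewrite /t; lra.
case: s0 us0 ss0 sf0 => // x s /= /andP[_ us] [ss] sf.
have : t < v n.
  by apply/H => //; exists s; split => // m ms; apply: sf; rewrite inE ms orbT.
by rewrite /t; lra.
Qed.

(** Sorting the first [M] values of [f] decreasingly puts below [v n] the
    [n]-th of them. *)
Lemma sum_le_decr_rearr (R : realType) (f v : nat -> R) (F : R -> R) M :
  is_decr_rearr f v -> (forall n, 0 <= f n) ->
  (forall x y, 0 <= x -> x <= y -> F x <= F y) ->
  \sum_(m < M) F (f m) <= \sum_(n < M) F (v n).
Proof.
move=> [v0 H] f0 Fmono.
pose le := [rel i j : nat | f j <= f i].
have le_tr : transitive le by move=> y x z /= a b; exact: le_trans b a.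
have le_to : total le by move=> x y; exact: le_total.
pose s := sort le (iota 0 M).
have ps : perm_eq s (iota 0 M) by rewrite perm_sort.
have ss : size s = M by rewrite size_sort size_iota.
have us : uniq s by rewrite sort_uniq iota_uniq.
rewrite -(big_mkord xpredT (fun m => F (f m))) /index_iota subn0.
rewrite -(perm_big _ ps)/= (big_nth 0%N) ss big_mkord.
apply: ler_sum => n _; apply: Fmono => //.
rewrite leNgt; apply/negP => lt.
pose t := (v n + f (nth 0%N s n)) / 2.
have := v0 n => vn.
have t0 : 0 < t by rewrite /t; lra.
have nM := ltn_ord n.
suff : t < v n by rewrite /t; lra.
apply/H => //; exists (take n.+1 s); split.
- by rewrite take_uniq.
- by rewrite size_takel// ss.
move=> m ms; apply: (@lt_le_trans _ _ (f (nth 0%N s n))); first by rewrite /t; lra.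
have mi : (index m s < n.+1)%N by rewrite -in_take_leq // ss.
have msz : m \in s by exact: mem_take ms.
rewrite -(nth_index 0%N msz).
have := @sorted_leq_nth _ le le_tr (fun x => lexx _) 0%N s (sort_sorted le_to _).
by apply => //; rewrite inE ss//; exact: (@leq_ltn_trans n).
Qed.

(** When [v] drops at [k], the values of [f] above [v (k + 1)] are [k + 1] in
    number and all at least [v k]; hence the edge that leaves the set of their
    positions at its maximum crosses the whole gap. *)
Lemma decr_rearr_edge (R : realType) (f v : nat -> R) :
  is_decr_rearr f v -> (forall n, 0 <= f n) ->
  forall k, v k.+1 < v k -> exists m, v k <= f m /\ f m.+1 <= v k.+1.
Proof.
move=> [v0 H] f0 k lt.
have few (s : seq nat) : uniq s -> (forall m, m \in s -> v k.+1 < f m) ->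
    (size s <= k.+1)%N.
  move=> us sf; rewrite leqNgt; apply/negP => szs.
  pose s' := take k.+2 s.
  have us' : uniq s' by rewrite take_uniq.
  have ss' : size s' = k.+2 by rewrite size_takel.
  have s'f m : m \in s' -> v k.+1 < f m by move=> /mem_take; exact: sf.
  have [t tv tf] : exists2 t, v k.+1 < t & forall m, m \in s' -> t < f m.
    elim: s' s'f {us' ss' us sf szs} => [_|m s' IH sf].
      by exists (v k.+1 + 1) => //; rewrite ltrDl.
    have [|t tv tf] := IH; first by move=> n ns; apply: sf; rewrite inE ns orbT.
    have fm : v k.+1 < f m by apply: sf; rewrite inE eqxx.
    exists (Num.min t ((v k.+1 + f m) / 2)); first by rewrite lt_min tv/=; lra.
    move=> n; rewrite inE gt_min => /orP[/eqP->|/tf->//].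
    by apply/orP; right; lra.
  have t0 : 0 < t by exact: le_lt_trans (v0 _) tv.
  have : t < v k.+1 by apply/H => //; exists s'.
  by rewrite ltNge (ltW tv).
pose t := (v k.+1 + v k) / 2.
have t0 : 0 < t by rewrite /t; have := v0 k.+1; lra.
have /(H _ _ t0)[s [us ss sf]] : t < v k by rewrite /t; lra.
have sv m : m \in s -> v k.+1 < f m.
  by move=> /sf; apply: lt_trans; rewrite /t; lra.
have sE m : v k.+1 < f m -> m \in s.
  move=> fm; apply/negPn/negP => ms.
  have := few (m :: s); rewrite /= ms us ss ltnn => /(_ isT) /=.
  have h : forall n, n \in m :: s -> v k.+1 < f n.
    by move=> n; rewrite inE => /orP[/eqP->//|/sv].
  by move=> /(_ h).
have sge m : m \in s -> v k <= f m.
  move=> ms; rewrite leNgt; apply/negP => fm.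
  have fm0 : 0 < f m by exact: le_lt_trans (v0 _) (sv _ ms).
  have /(H _ _ fm0)[s' [us' ss' sf']] := fm.
  have ms' : m \notin s' by apply/negP => /sf'; rewrite ltxx.
  have := few (m :: s'); rewrite /= ms' us' ss' ltnn => /(_ isT).
  have h : forall n, n \in m :: s' -> v k.+1 < f n.
    move=> n; rewrite inE => /orP[/eqP->|/sf']; first exact: sv.
    by apply: lt_trans; exact: sv.
  by move=> /(_ h).
have s0 : s != [::] by case: (s) ss.
pose m := (\max_(i <- s) i)%N.
have ms : m \in s.
  rewrite /m; case: (s) s0 => // a l _; elim: l a => [|b l IH] a.
    by rewrite big_seq1 mem_seq1.
  rewrite big_cons; have := IH b; move: (\max_(i <- b :: l) i)%N => M0 Ml.
  rewrite /maxn; case: ifP => _; first by rewrite in_cons Ml orbT.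
  by rewrite in_cons eqxx.
exists m; split; first exact: sge.
rewrite leNgt; apply/negP => /sE Sm.
suff : (m.+1 <= m)%N by rewrite ltnn.
by rewrite {2}/m (big_rem _ Sm)/= leq_max leqnn.
Qed.

(** The Polya-Szego inequality on the half-line.  The gaps of [v] charged to
    one edge of [f] are disjoint intervals inside the range of that edge, so
    the sum of their squares is at most the square of its length. *)
Lemma polya_szego_nat (R : realType) (f v : nat -> R) :
  is_decr_rearr f v -> (forall n, 0 <= f n) -> forall M, exists M',
  \sum_(k < M) (v k - v k.+1) ^+ 2 <= \sum_(m < M') (f m - f m.+1) ^+ 2.
Proof.
move=> fv f0 M.
have vS := decr_rearr_nonincreasing fv.
have : forall k, exists m, v k.+1 < v k -> v k <= f m /\ f m.+1 <= v k.+1.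
  move=> k; have [lt|_] := ltP (v k.+1) (v k); last by exists 0%N.
  by have [m ?] := decr_rearr_edge fv f0 lt; exists m.
move=> /choice[e eP].
pose M' := (\max_(k < M) e k)%N.+1; exists M'.
have eM (k : 'I_M) : (e k < M')%N by rewrite ltnS; exact: (leq_bigmax k).
have -> : \sum_(k < M) (v k - v k.+1) ^+ 2
    = \sum_(m < M') \sum_(k < M | e k == m) (v k - v k.+1) ^+ 2.
  rewrite (partition_big (fun k => Ordinal (eM k)) xpredT)//=.
apply: ler_sum => m _.
have sqr_sum (P : pred 'I_M) (x : 'I_M -> R) : (forall k, 0 <= x k) ->
    \sum_(k | P k) x k ^+ 2 <= (\sum_(k | P k) x k) ^+ 2.
  move=> x0; rewrite expr2 mulr_suml; apply: ler_sum => k Pk.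
  rewrite expr2 ler_wpM2l// (bigD1 k)//= lerDl.
  by apply: sumr_ge0.
apply: le_trans (sqr_sum _ _ _) _; first by move=> k; rewrite subr_ge0.
pose phi x := Num.min (Num.max x (f m.+1)) (f m).
have phiS k : phi (v k.+1) <= phi (v k).
  by rewrite /phi le_min2// le_max2//.
have phiE k : e k = m -> v k - v k.+1 <= phi (v k) - phi (v k.+1).
  move=> ekm; have [lt|ge] := ltP (v k.+1) (v k); last first.
    by have := phiS k; lra.
  have [] := eP _ lt; rewrite ekm => h1 h2.
  have h3 := vS k.
  by rewrite /phi !(max_idPl _) ?(le_trans h2)// !(min_idPl _)// (le_trans h3).
rewrite -[leRHS]real_normK ?num_real// ler_pXn2r// ?nnegrE ?sumr_ge0//; last first.
  by move=> k _; rewrite subr_ge0.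
apply: (@le_trans _ _ (\sum_(k < M) (phi (v k) - phi (v k.+1)))).
  rewrite [leLHS]big_mkcond; apply: ler_sum => k _.
  by case: eqP => [/phiE//|_]; rewrite subr_ge0.
have -> : \sum_(k < M) (phi (v k) - phi (v k.+1)) = phi (v 0%N) - phi (v M).
  elim: M {e eP M' eM m phi phiS phiE sqr_sum} (phi) => [|M IH] phi.
    by rewrite big_ord0 subrr.
  by rewrite big_ord_recr/= IH; ring.
have [cd|dc] := leP (f m.+1) (f m).
  have phib x : f m.+1 <= phi x <= f m.
    by rewrite /phi le_min le_max lexx cd orbT ge_min lexx orbT.
  rewrite ger0_norm ?subr_ge0//.
  by have /andP[_ ?] := phib (v 0%N); have /andP[? _] := phib (v M); lra.
have phic x : phi x = f m.
  by rewrite /phi; apply/min_idPr; rewrite le_max (ltW dc) orbT.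
by rewrite !phic subrr.
Qed.

(** * Rearrangements through level sets *)

(** Layer-cake principle: an initial segment of the positive reals without
    maximum is [ ]0, L[ ], and its length [L] is the integral of its indicator.
    Both rearrangements are defined by such integrals. *)
Lemma Rintegral_initial_segment (R : realType) (S : set R) :
  (forall s t, 0 < s -> s <= t -> S t -> S s) ->
  (forall t, 0 < t -> S t -> exists2 t', t < t' & S t') ->
  (exists b, forall t, 0 < t -> S t -> t <= b) ->
  let L := \int[lebesgue_measure]_(t in `]0, +oo[) \1_S t in
  0 <= L /\ forall t, 0 < t -> (t < L <-> S t).
Proof.
move=> Sdown Sopen [b Sb] L.
pose S0 := [set t | t = 0 \/ (0 < t /\ S t)].
have S00 : S0 0 by left.
have hS0 : has_sup S0.
  split; first by exists 0.
  by exists (Num.max 0 b) => t [->|[t0 /(Sb _ t0) tb]]; rewrite le_max ?lexx ?tb ?orbT.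
pose l := sup S0.
have l0 : 0 <= l by apply: (ub_le_sup (proj2 hS0)).
have lS t : 0 < t -> (t < l <-> S t).
  move=> t0; split => [tl|St].
    have [|u [u0|[u0 Su]] tu] := @sup_adherent _ S0 (l - t) _ hS0.
    - by rewrite subr_gt0.
    - by move: tu; rewrite u0 subKr ltNge (ltW t0).
    - by apply: (Sdown _ u) => //; move: tu; rewrite subKr => /ltW.
  have [u tu Su] := Sopen _ t0 St.
  apply: (lt_le_trans tu); apply: (ub_le_sup (proj2 hS0)).
  by right; split => //; exact: lt_trans tu.
suff -> : L = l by [].
rewrite /L /Rintegral.
have -> : (\int[lebesgue_measure]_(t in `]0%R, +oo[) (\1_S t)%:E)%E
    = (\int[lebesgue_measure]_(t in `]0%R, +oo[) (\1_(`]0, l[%classic : set R) t)%:E)%E.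
  apply: eq_integral => t; rewrite inE/= in_itv/= andbT => t0.
  rewrite !indicE; suff -> : (t \in S) = (t \in (`]0, l[%classic : set R)) by [].
  by apply/idP/idP; rewrite !inE/= in_itv/= t0/= => /(lS _ t0).
rewrite integral_indic//= setIidl; last first.
  by move=> t /=; rewrite !in_itv/= => /andP[-> _].
rewrite lebesgue_measure_itv/= lte_fin.
by case: ltP => [_|]; rewrite /= ?subr0// => ?; apply/eqP; rewrite eq_le l0.
Qed.

Lemma card_fset_set_gtP (A : set nat) (n : nat) : finite_set A ->
  ((n < #|` fset_set A|)%N <->
   exists s : seq nat, [/\ uniq s, size s = n.+1 & forall m, m \in s -> A m]).
Proof.
move=> fA; split => [nA|[s [us ss sA]]].
  exists (take n.+1 (fset_set A)); split.
  - by rewrite take_uniq// fset_uniq.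
  - by rewrite size_takel.
  - by move=> m /mem_take; rewrite in_fset_set// inE.
rewrite -ss.
have -> : size s = #|` [fset x in s]%fset| by rewrite card_fseq undup_id.
by apply: fsubset_leq_card; apply/fsubsetP => m; rewrite !inE/= in_fset_set// => /sA; rewrite inE.
Qed.

Lemma decr_rearrP (R : realType) (f : nat -> R[i]) :
  (forall t : R, 0 < t -> finite_set [set m | t < cabs (f m)]) ->
  is_decr_rearr (fun m => cabs (f m)) (decr_rearr f).
Proof.
move=> fin.
have key n : let S := [set t : R | nat_set_rearr [set m | t < cabs (f m)] n] in
    0 <= decr_rearr f n /\ forall t, 0 < t -> (t < decr_rearr f n <-> S t).
  move=> S.
  have SP t : 0 < t -> (S t <-> exists s : seq nat,
      [/\ uniq s, size s = n.+1 & forall m, m \in s -> t < cabs (f m)]).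
    by move=> t0; exact: (card_fset_set_gtP n (fin _ t0)).
  have -> : decr_rearr f n = \int[lebesgue_measure]_(t in `]0, +oo[) \1_S t.
    by apply: eq_Rintegral => t _; rewrite !indicE /mem/= /in_mem/=.
  apply: Rintegral_initial_segment.
  - move=> s t s0 st; have t0 := lt_le_trans s0 st.
    move=> /(SP _ t0)[q [uq sq qf]]; apply/SP => //; exists q; split => // m.
    by move=> /qf; exact: le_lt_trans.
  - move=> t t0 /(SP _ t0)[q [uq sq qf]].
    suff [t' tt' t'q] : exists2 t', t < t' & forall m, m \in q -> t' < cabs (f m).
      by exists t' => //; apply/SP; [exact: lt_trans tt'|exists q].
    elim: q qf {uq sq} => [_|m q IH qf]; first by exists (t + 1) => //; rewrite ltrDl.
    have [|t' tt' t'q] := IH; first by move=> k kq; apply: qf; rewrite inE kq orbT.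
    have fm : t < cabs (f m) by apply: qf; rewrite inE eqxx.
    exists (Num.min t' ((t + cabs (f m)) / 2)); first by rewrite lt_min tt'/=; lra.
    move=> k; rewrite inE gt_min => /orP[/eqP->|/t'q->//].
    by apply/orP; right; lra.
  have [q _ fq] : exists2 q : seq nat, True & forall m, 1 < cabs (f m) -> m \in q.
    exists (fset_set [set m | 1 < cabs (f m)]) => // m fm.
    by rewrite in_fset_set ?inE//; exact: fin.
  exists (1 + \sum_(m <- q) cabs (f m)) => t t0 /(SP _ t0)[s [us ss sf]].
  case: s us ss sf => // m s _ _ /(_ m); rewrite inE eqxx => /(_ isT) /ltW tm.
  have c0 z : 0 <= cabs z :> R by case: z => a b; rewrite sqrtr_ge0.
  have s0 : 0 <= \sum_(m <- q) cabs (f m) by apply: sumr_ge0.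
  have [fm|fm] := leP (cabs (f m)) 1; first by lra.
  apply: (le_trans tm); rewrite (big_rem m) ?fq//= addrCA lerDl.
  by rewrite addr_ge0// sumr_ge0.
split=> [n|t n t0]; first by have [] := key n.
have [_ /(_ _ t0)] := key n; rewrite /= /nat_set_rearr/=.
move=> ->; exact: (card_fset_set_gtP n (fin _ t0)).
Qed.

(** * Equimeasurable functions *)

(** Rays are stable under intersection and generate the Borel sets; cutting
    both measures down to the nonnegative reals makes them finite, so that
    uniqueness on a generating system applies. *)
Lemma measure_eq_of_rays (R : realType) (m1 m2 : {measure set R -> \bar R}) :
  let E : set R := `[0, +oo[%classic in
  (m1 E < +oo)%E -> m1 E = m2 E ->
  (forall t, 0 <= t -> m1 `]t, +oo[%classic = m2 `]t, +oo[%classic) ->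
  forall A, measurable A -> A `<=` E -> m1 A = m2 A.
Proof.
move=> E mEoo m12E m12 A mA AE.
have mE : measurable E by exact: measurable_itv.
suff : mrestr m1 mE A = mrestr m2 mE A by rewrite /mrestr (setIidl AE).
apply: (@measure_unique _ R R (@RGenOInfty.G R) (fun k => `]- k.+1%:R, +oo[%classic)
  _ _ _ _ (mrestr m1 mE) (mrestr m2 mE)) => //.
- exact: RGenOInfty.measurableE.
- move=> _ _ [x ->] [y ->]; exists (Num.max x y).
  apply/seteqP; split => z /=; rewrite !in_itv/= !andbT.
    by move=> [xz yz]; rewrite gt_max xz.
  by rewrite gt_max => /andP[].
- by move=> k; exists (- k.+1%:R).
- apply/seteqP; split => // x _; exists (Num.truncn `|x|) => //=.
  rewrite in_itv/= andbT ltrNl.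
  by apply: (le_lt_trans (ler_norm _)); rewrite normrN truncnS_gt.
- move=> _ [t ->]; rewrite /= /mrestr.
  have [t0|t0] := leP 0 t.
    rewrite setIidl; first exact: m12.
    by move=> y /=; rewrite /E/= !in_itv/= !andbT => /ltW; exact: le_trans.
  rewrite setIidr//.
  by move=> y /=; rewrite /E/= !in_itv/= !andbT; exact: lt_le_trans.
- move=> k; rewrite /= /mrestr setIidr//.
  move=> y /=; rewrite /E/= !in_itv/= !andbT.
  by apply: lt_le_trans; rewrite oppr_lt0.
Qed.

(** The two push-forward measures agree on rays, hence everywhere.  The
    functions are extended by the value [-1], which marks the complement of
    [D]. *)
Lemma equimeasurable_integral d (T : measurableType d) (R : realType)
    (mu : {measure set T -> \bar R}) (D : set T) (phi psi : T -> R)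
    (F : R -> \bar R) :
  measurable D -> (mu D < +oo)%E ->
  measurable_fun D phi -> measurable_fun D psi ->
  (forall x, 0 <= phi x) -> (forall x, 0 <= psi x) ->
  (forall t, 0 <= t -> mu (D `&` [set x | t < phi x])
                        = mu (D `&` [set x | t < psi x])) ->
  measurable_fun setT F -> (forall y, 0 <= F y)%E ->
  (\int[mu]_(x in D) F (phi x) = \int[mu]_(x in D) F (psi x))%E.
Proof.
move=> mD muD mphi mpsi phi0 psi0 eqm mF F0.
pose ext (f : T -> R) x := ((fun x => f x + 1) \_ D) x - 1.
have extD f x : D x -> ext f x = f x.
  by move=> Dx; rewrite /ext patchE mem_set// addrK.
have extN f x : ~ D x -> ext f x = -1.
  by move=> Dx; rewrite /ext patchE memNset// sub0r.
have mext f : measurable_fun D f -> measurable_fun setT (ext f).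
  move=> mf; apply: measurable_funB => //.
  by apply/(measurable_restrictT _ mD); exact: measurable_funD.
pose E : set R := `[0, +oo[%classic.
have mE : measurable E by exact: measurable_itv.
have preE (f : T -> R) : (forall x, 0 <= f x) -> ext f @^-1` E = D.
  move=> f0; apply/seteqP; split => x /=; rewrite /E/= in_itv/= andbT.
    by move=> h; apply/not_notP => /(extN f) e; move: h; rewrite e oppr_ge0 ler10.
  by move=> Dx; rewrite extD.
have intE (f : T -> R) : measurable_fun D f -> (forall x, 0 <= f x) ->
    (\int[mu]_(x in D) F (f x) = \int[pushforward mu (ext f)]_(y in E) F y)%E.
  move=> mf f0; rewrite (ge0_integral_pushforward (mext _ mf))//.
    by rewrite preE//; apply: eq_integral => x; rewrite inE => Dx /=; rewrite extD.
  exact: measurable_funTS.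
rewrite (intE phi)// (intE psi)//; apply: eq_measure_integral.
- exact: mext.
- exact: mext.
move=> mphi' mpsi' A mA AE; apply: measure_eq_of_rays => //=.
- by rewrite /pushforward preE.
- by rewrite /pushforward !preE.
move=> t t0; rewrite /pushforward.
have pre (f : T -> R) : (forall x, 0 <= f x) ->
    ext f @^-1` `]t, +oo[ = D `&` [set x | t < f x].
  move=> f0; apply/seteqP; split => x /=; rewrite in_itv/= andbT.
    have [Dx|Dx] := pselect (D x); first by rewrite extD.
    by rewrite extN// => /(le_lt_trans t0); rewrite oppr_gt0 ltr10.
  by move=> [Dx]; rewrite extD.
by rewrite (pre phi)// (pre psi)//; exact: eqm.
Qed.

(** * Symmetric decreasing rearrangement on the circle *)

Section Levels.
Variable R : realType.
Local Notation mu := (@lebesgue_measure R).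
Implicit Types phi G : R -> R.

Definition superlevel phi (t : R) : set R := torus `&` [set x | t < phi x].

Definition half_width phi (t : R) : R := fine (mu (superlevel phi t)) / 2.

(** The point [0] is left aside: there the rearrangement of an unbounded
    function is infinite. *)
Definition is_sym_rearr phi G :=
  (forall x, 0 <= G x) /\
  forall t x, 0 < t -> x != 0 -> (t < G x <-> `|x| < half_width phi t).

Lemma measurable_torus : measurable (@torus R).
Proof. exact: measurable_itv. Qed.

Lemma lebesgue_measure_torus : mu torus = (2 * pi)%:E.
Proof.
have p0 := @pi_gt0 R.
rewrite /torus lebesgue_measure_itv/= lte_fin ifT; last by lra.
by rewrite -EFinD opprK; congr (_%:E); lra.
Qed.

Lemma measurable_superlevel phi t :
  measurable_fun torus phi -> measurable (superlevel phi t).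
Proof.
move=> mphi; have := mphi measurable_torus `]t, +oo[%classic (measurable_itv _).
suff -> : torus `&` phi @^-1` `]t, +oo[ = superlevel phi t by [].
by apply/seteqP; split => x [Tx] /=; rewrite /superlevel/= in_itv/= ?andbT.
Qed.

Lemma superlevel_ltoo phi t :
  measurable_fun torus phi -> (mu (superlevel phi t) < +oo)%E.
Proof.
move=> mphi; apply: (@le_lt_trans _ _ (mu torus)).
  rewrite le_measure ?inE//; [exact: measurable_superlevel|exact: measurable_torus|].
  by move=> x [].
by rewrite lebesgue_measure_torus ltry.
Qed.

Lemma superlevelE phi t : measurable_fun torus phi ->
  mu (superlevel phi t) = (2 * half_width phi t)%:E.
Proof.
move=> mphi; rewrite /half_width mulrC divfK// fineK// ge0_fin_numE//.
exact: superlevel_ltoo.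
Qed.

Lemma half_width_le phi s t : measurable_fun torus phi -> s <= t ->
  half_width phi t <= half_width phi s.
Proof.
move=> mphi st; rewrite -(ler_pM2l (ltr0n R 2)) -lee_fin -!superlevelE//.
rewrite le_measure ?inE//; [exact: measurable_superlevel|exact: measurable_superlevel|].
by move=> x [Tx] /=; exists => //=; exact: le_lt_trans st _.
Qed.

Lemma half_width_le_pi phi t : measurable_fun torus phi -> half_width phi t <= pi.
Proof.
move=> mphi; rewrite -(ler_pM2l (ltr0n R 2)) -lee_fin -superlevelE//.
rewrite -lebesgue_measure_torus.
rewrite le_measure ?inE//; [exact: measurable_superlevel|exact: measurable_torus|].
by move=> x [].
Qed.

Lemma cvg_superlevel_right phi t : measurable_fun torus phi ->
  mu (superlevel phi (t + n.+1%:R^-1)) @[n --> \oo] --> mu (superlevel phi t).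
Proof.
move=> mphi; pose F n := superlevel phi (t + n.+1%:R^-1).
have -> : superlevel phi t = \bigcup_n F n.
  apply/seteqP; split => x.
    move=> [Tx] /= tx.
    have h : 0 < phi x - t by rewrite subr_gt0.
    exists (Num.truncn (phi x - t)^-1) => //; split => //=.
    rewrite -ltrBrDl invf_plt// ?posrE ?ltr0n//; exact: truncnS_gt.
  move=> [n _] [Tx] /= h; split => //=.
  by apply: lt_trans h; rewrite ltrDl invr_gt0.
apply: nondecreasing_cvg_mu.
- by move=> n; exact: measurable_superlevel.
- by apply: bigcupT_measurable => n; exact: measurable_superlevel.
- move=> m n mn; apply/subsetPset => x [Tx] /= h; split => //=.
  by apply: le_lt_trans h; rewrite lerD2l lef_pV2 ?posrE ?ltr0n// ler_nat.
Qed.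

Lemma half_width_right phi t x : measurable_fun torus phi ->
  x < half_width phi t -> exists2 t', t < t' & x < half_width phi t'.
Proof.
move=> mphi xt.
have := @cvg_superlevel_right phi t mphi.
move=> /(_ [set y | ((2 * x)%:E < y)%E]).
have h : nbhs (mu (superlevel phi t)) [set y | ((2 * x)%:E < y)%E].
  by apply: open_nbhs_nbhs; split; [exact: open_ereal_gt_ereal|
    rewrite /= superlevelE// lte_fin ltr_pM2l].
move=> /(_ h)[N _ /(_ N (leqnn _))] /= H.
exists (t + N.+1%:R^-1); first by rewrite ltrDl invr_gt0.
by move: H; rewrite superlevelE// lte_fin ltr_pM2l.
Qed.

Lemma half_width_vanishes phi x : measurable_fun torus phi -> 0 < x ->
  exists t, half_width phi t < x.
Proof.
move=> mphi x0; pose F n := superlevel phi n%:R.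
have F0 : \bigcap_n F n = set0.
  apply/seteqP; split => // y /(_ (Num.truncn (phi y)).+1 I)[_] /=.
  by rewrite ltNge => /negP; apply; apply: ltW; exact: truncnS_gt.
have := @nonincreasing_cvg_mu _ _ _ mu F.
rewrite F0 measure0 => /(_ (superlevel_ltoo _ mphi)).
move=> /(_ (fun n => measurable_superlevel _ mphi) measurable0).
have nF : nonincreasing_seq F.
  move=> m n mn; apply/subsetPset => y [Ty] /= h; split => //=.
  by apply: le_lt_trans h; rewrite ler_nat.
move=> /(_ nF) /(_ [set y | (y < (2 * x)%:E)%E]).
have h : nbhs (0%E : \bar R) [set y | (y < (2 * x)%:E)%E].
  apply: open_nbhs_nbhs; split; first exact: open_ereal_lt_ereal.
  by rewrite /= lte_fin mulr_gt0.
move=> /(_ h)[N _ /(_ N (leqnn _))] /= H.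
by exists N%:R; move: H; rewrite /F superlevelE// lte_fin ltr_pM2l.
Qed.

(** The measure of the superlevel sets is continuous from the right in the level
    and tends to [0], which is what the layer-cake principle requires. *)
Lemma sym_rearrP (g : R -> R[i]) : measurable_fun torus (fun x => cabs (g x)) ->
  is_sym_rearr (fun x => cabs (g x)) (sym_rearr g).
Proof.
set phi := fun x => cabs (g x) => mphi.
have levE t : 0 < t ->
    [set y | t < cabs (patch (fun=> 0) torus g y)] = superlevel phi t.
  move=> t0; apply/seteqP; split => y /=; rewrite /superlevel/patch/=.
    case: ifPn => [|_]; first by rewrite inE.
    by rewrite Normc.normc0 ltNge (ltW t0).
  by move=> [Ty ty]; rewrite mem_set.
split.
  by move=> x; apply: Rintegral_ge0 => t _; rewrite indicE.
move=> t x t0 x0.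
pose S := [set s : R | line_set_rearr
  [set y | s < cabs (patch (fun=> 0) torus g y)] x].
have SE s : 0 < s -> (S s <-> `|x| < half_width phi s).
  by move=> s0; rewrite /S/= levE// /line_set_rearr/= in_itv/= ltr_norml.
have -> : sym_rearr g x = \int[mu]_(s in `]0, +oo[) \1_S s.
  by apply: eq_Rintegral => s _; rewrite !indicE /mem/= /in_mem/=.
rewrite -SE//.
apply: (proj2 (Rintegral_initial_segment _ _ _)) => //.
- move=> r s r0 rs; rewrite !SE ?(lt_le_trans r0)// => h.
  by apply: lt_le_trans h _; exact: half_width_le.
- move=> s s0; rewrite SE// => /(half_width_right mphi)[s' ss' h].
  by exists s' => //; rewrite SE// (lt_trans s0).
have x1 : 0 < `|x| by rewrite normr_gt0.
have [b hb] := half_width_vanishes mphi x1.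
exists b => s s0; rewrite SE// leNgt => h; apply/negP => bs.
have := half_width_le mphi (ltW bs); rewrite leNgt => /negP; apply.
exact: lt_trans hb h.
Qed.

End Levels.

Section Rearranged.
Variables (R : realType) (phi G : R -> R).
Local Notation mu := (@lebesgue_measure R).
Hypothesis mphi : measurable_fun torus phi.
Hypothesis phiG : is_sym_rearr phi G.

Lemma sym_rearr_ge0 x : 0 <= G x.
Proof. by have [] := phiG. Qed.

Lemma sym_rearr_nonincreasing x y : x != 0 -> `|x| <= `|y| -> G y <= G x.
Proof.
move=> x0 xy; rewrite leNgt; apply/negP => lt.
have y0 : y != 0 by rewrite -normr_gt0 (lt_le_trans _ xy)// normr_gt0.
pose t := (G x + G y) / 2.
have Gx := sym_rearr_ge0 x.
have t0 : 0 < t by rewrite /t; lra.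
have /(proj2 phiG t y t0 y0) h : t < G y by rewrite /t; lra.
have : t < G x by apply/(proj2 phiG) => //; exact: le_lt_trans xy h.
by rewrite /t; lra.
Qed.

Lemma sym_rearr_superlevel t : 0 < t ->
  [set x | t < G x] = (`]- half_width phi t, half_width phi t[ `\ 0)
                      `|` (if t < G 0 then [set 0] else set0).
Proof.
move=> t0; apply/seteqP; split => x /=.
  have [->|x0] := eqVneq x 0; first by move=> ->; right.
  move=> /(proj2 phiG t x t0 x0); left; split; last exact/eqP.
  by rewrite /= in_itv/= -ltr_norml.
move=> [[]|].
  by rewrite /= in_itv/= -ltr_norml => h /eqP x0; apply/(proj2 phiG).
by case: ifP => // h ->.
Qed.

Lemma measurable_sym_rearr : measurable_fun setT G.
Proof.
apply: (measurability _ (RGenOInfty.measurableE R)).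
move=> _ [_ [t ->] <-]; rewrite setTI.
have -> : G @^-1` `]t, +oo[ = [set x | t < G x].
  by apply/seteqP; split => x /=; rewrite in_itv/= andbT.
have mpos s : 0 < s -> measurable [set x | s < G x].
  move=> s0; rewrite sym_rearr_superlevel//; apply: measurableU.
    by apply: measurableD => //; exact: measurable_itv.
  by case: ifP => // _; exact: measurable0.
have [t0|t0|<-] := ltgtP 0 t; first exact: mpos.
  rewrite (_ : [set _ | _] = setT)//; apply/seteqP; split => // x _ /=.
  exact: lt_le_trans (sym_rearr_ge0 _).
rewrite (_ : [set x | 0 < G x] = \bigcup_n [set x | n.+1%:R^-1 < G x]).
  by apply: bigcupT_measurable => n; apply: mpos; rewrite invr_gt0.
apply/seteqP; split => x /=.
  move=> G0; exists (Num.truncn (G x)^-1) => //=.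
  by rewrite invf_plt ?posrE ?ltr0n//; exact: truncnS_gt.
by move=> [n _] /=; apply: lt_trans; rewrite invr_gt0.
Qed.

Lemma sym_rearr_equimeasurable t : 0 <= t ->
  mu (superlevel phi t) = mu (superlevel G t).
Proof.
have mG := measurable_funTS measurable_sym_rearr : measurable_fun torus G.
have pos s : 0 < s -> mu (superlevel phi s) = mu (superlevel G s).
  move=> s0; rewrite superlevelE//; set r := half_width phi s.
  have r0 : 0 <= r by rewrite /r /half_width divr_ge0// fine_ge0.
  have rpi : r <= pi by exact: half_width_le_pi.
  have D0 (A : set R) : measurable A -> mu (A `\ 0) = mu A.
    move=> mA; have := @integral_setD1 R (cst 1%E) 0 A.
    rewrite !integral_cst//= ?mul1e; last exact: measurableD.
    by apply; [exact: measurableD|exact: measurable_cst].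
  rewrite -(D0 (superlevel G s)); last exact: measurable_superlevel.
  have -> : superlevel G s `\ 0 = `]- r, r[%classic `\ 0.
    rewrite /superlevel sym_rearr_superlevel// -/r.
    apply/seteqP; split => x.
      by move=> [[_ [//|]]] /=; case: ifP => // _ ->.
    move=> [xr x0]; split => //; split; last by left.
    move: xr; rewrite /torus/= !in_itv/= => /andP[h1 h2].
    by rewrite (lt_le_trans h2 rpi) andbT (le_lt_trans _ h1)// lerN2.
  rewrite D0; last exact: measurable_itv.
  rewrite lebesgue_measure_itv/= lte_fin; case: ltP => h.
    by rewrite -EFinD opprK; congr (_%:E); lra.
  by congr (_%:E); lra.
rewrite le_eqVlt => /orP[/eqP<-|]; last exact: pos.
have h1 := @cvg_superlevel_right R phi 0 mphi.
have h2 := @cvg_superlevel_right R G 0 mG.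
have e : (fun n => mu (superlevel phi (0 + n.+1%:R^-1)))
       = (fun n => mu (superlevel G (0 + n.+1%:R^-1))).
  by apply/funext => n; apply: pos; rewrite add0r invr_gt0.
rewrite e in h1; exact: (cvg_unique _ h1 h2).
Qed.

Lemma sym_rearr_integral (F : R -> \bar R) :
  (forall x, 0 <= phi x) -> measurable_fun setT F -> (forall y, 0 <= F y)%E ->
  (\int[mu]_(x in torus) F (phi x) = \int[mu]_(x in torus) F (G x))%E.
Proof.
move=> phi0 mF F0.
have mG := measurable_funTS measurable_sym_rearr : measurable_fun torus G.
have too : (mu torus < +oo)%E by rewrite lebesgue_measure_torus ltry.
have h := @equimeasurable_integral _ _ R mu torus phi G F (@measurable_torus R) too mphi mG
  phi0 sym_rearr_ge0 sym_rearr_equimeasurable mF F0.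
exact: h.
Qed.

End Rearranged.

(** * Concentration near the origin *)

(** Integrals weighted by [W] are superpositions of integrals over the
    superlevel sets of [W]. *)
Lemma le_integral_weighted (R : realType) (h1 h2 W : R -> R) :
  measurable_fun setT h1 -> measurable_fun setT h2 -> measurable_fun setT W ->
  (forall x, 0 <= h1 x) -> (forall x, 0 <= h2 x) -> (forall x, 0 <= W x) ->
  (forall s : R, 0 < s ->
     (\int[lebesgue_measure]_(x in [set x | (s < W x)%R]) (h1 x)%:E
     <= \int[lebesgue_measure]_(x in [set x | (s < W x)%R]) (h2 x)%:E)%E) ->
  (\int[lebesgue_measure]_x (h1 x * W x)%:E <= \int[lebesgue_measure]_x (h2 x * W x)%:E)%E.
Proof.
move=> mh1 mh2 mW h10 h20 W0 h12.
pose A := [set z : R * R | 0 < z.2 < W z.1].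
have mA : measurable A.
  have mb : measurable_fun setT (fun z : R * R => (0 < z.2) && (z.2 < W z.1)).
    apply: measurable_and; apply: measurable_fun_ltr => //.
    exact: measurableT_comp.
  have := mb measurableT [set true] I; rewrite setTI.
  by congr (measurable _); apply/seteqP; split => z.
pose f (h : R -> R) (z : R * R) := (h z.1 * \1_A z)%:E.
have f0 (h : R -> R) : (forall x, 0 <= h x) -> forall z, (0 <= f h z)%E.
  by move=> h0 z; rewrite lee_fin mulr_ge0// indicE.
have mf (h : R -> R) : measurable_fun setT h -> measurable_fun setT (f h).
  move=> mh; apply/measurable_EFinP; apply: measurable_funM.
    exact: measurableT_comp.
  exact: measurable_indic.
have layer (h : R -> R) : measurable_fun setT h -> (forall x, 0 <= h x) ->
    (\int[lebesgue_measure]_x (h x * W x)%:E = \int[lebesgue_measure]_s \int[lebesgue_measure]_x f h (x, s))%E.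
  move=> mh h0; rewrite -(@fubini_tonelli _ _ _ _ R lebesgue_measure lebesgue_measure (f h))//; last 2 first.
  - exact: mf.
  - exact: f0.
  apply: eq_integral => x _.
  rewrite /f/=.
  have -> : (fun s => (h x * \1_A (x, s))%:E)
          = (fun s => ((h x)%:E * (\1_(`]0, W x[%classic : set R) s)%:E)%E).
    by apply/funext => s; rewrite -EFinM !indicE; congr (_ * _%:R)%:E;
      congr nat_of_bool; apply/idP/idP; rewrite !inE/= in_itv.
  have hx0 : (0 <= (h x)%:E)%E by rewrite lee_fin.
  have ind0 s : setT s -> (0 <= (\1_(`]0, W x[%classic : set R) s)%:E)%E.
    by rewrite lee_fin indicE.
  rewrite ge0_integralZl//; last first.
    by apply/measurable_EFinP; exact: measurable_indic.
  rewrite integral_indic//= setIT lebesgue_measure_itv/= lte_fin.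
  case: ltP => [_|]; first by rewrite -EFinD subr0 EFinM.
  by move=> Wx; rewrite mule0 (_ : W x = 0) ?mulr0//; apply/eqP; rewrite eq_le Wx W0.
rewrite (layer h1)// (layer h2)//; apply: ge0_le_integral => //.
- by move=> s _; apply: integral_ge0 => x _; exact: f0.
- exact: (@measurable_fun_fubini_tonelli_G _ _ _ _ R lebesgue_measure (f h1) (mf _ mh1) (f0 _ h10)).
- exact: (@measurable_fun_fubini_tonelli_G _ _ _ _ R lebesgue_measure (f h2) (mf _ mh2) (f0 _ h20)).
move=> s _.
have [s0|s0] := ltP 0 s; last first.
  by rewrite !integral0_eq//= => x _; rewrite /f indicE memNset ?mulr0// /A/= ltNge s0.
have fE (h : R -> R) : (\int[lebesgue_measure]_x f h (x, s)
           = \int[lebesgue_measure]_(x in [set x | (s < W x)%R]) (h x)%:E)%E.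
  rewrite [RHS]integral_mkcond; apply: eq_integral => x _.
  rewrite /f/= indicE patchE; case: ifPn; rewrite ?inE ?notin_setE/= => sx.
    by rewrite mem_set ?mulr1// /A/= s0.
  by rewrite memNset ?mulr0// /A/= s0/=.
by rewrite !fE; exact: h12.
Qed.

Section Bathtub.
Variables (R : realType) (phi G : R -> R).
Local Notation mu := (@lebesgue_measure R).
Hypothesis mphi : measurable_fun torus phi.
Hypothesis phi0 : forall x, 0 <= phi x.
Hypothesis phiG : is_sym_rearr phi G.

(** Both squares are split at the level [G r].  On the interval, the part below
    this level is largest when constant, as it is for [G]; the parts above it
    have the same integral over the circle, which for [G] is carried by the
    interval. *)
Lemma integral_ball_le_sym_rearr (r : R) : 0 < r -> r <= pi ->
  (\int[mu]_(x in [set` `]- r, r[%R]) (phi x ^+ 2)%:E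
   <= \int[mu]_(x in [set` `]- r, r[%R]) (G x ^+ 2)%:E)%E.
Proof.
move=> r0 rpi; pose B : set R := `]- r, r[%classic; rewrite -/B.
have BT : B `<=` torus.
  move=> x; rewrite /B /torus/= !in_itv/= => /andP[h1 h2].
  by rewrite (lt_le_trans h2 rpi) andbT (le_lt_trans _ h1)// lerN2.
have mB : measurable B by exact: measurable_itv.
have mT := @measurable_torus R.
have mG := measurable_sym_rearr phiG.
have G0 := sym_rearr_ge0 phiG.
pose P (y : R) := Num.max (y ^+ 2 - G r ^+ 2) 0.
have P0 y : 0 <= P y by rewrite le_max lexx orbT.
have mP : measurable_fun setT P.
  by apply: measurable_maxr => //; apply: measurable_funB.
have mPphi : measurable_fun torus (P \o phi) by exact: measurableT_comp.
have mPG : measurable_fun setT (P \o G) by exact: measurableT_comp.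
apply: (@le_trans _ _ (\int[mu]_(x in B) ((G r ^+ 2)%:E + (P (phi x))%:E))%E).
  apply: ge0_le_integral => //.
  - by move=> x _; rewrite lee_fin sqr_ge0.
  - apply/measurable_EFinP; apply: measurable_funX.
    exact: measurable_funS mphi.
  - apply/measurable_EFinP; apply: measurable_funD => //.
    exact: measurable_funS mPphi.
  - by move=> x _; rewrite -EFinD lee_fin -lerBlDl le_max lexx.
have cst0 (x : R) : B x -> (0 <= (G r ^+ 2)%:E)%E by rewrite lee_fin sqr_ge0.
have EP0 (h : R -> R) x : B x -> (0 <= (P (h x))%:E)%E by rewrite lee_fin.
have mEphi : measurable_fun B (fun x => (P (phi x))%:E).
  by apply/measurable_EFinP; exact: measurable_funS mPphi.
have mEG : measurable_fun B (fun x => (P (G x))%:E).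
  by apply/measurable_EFinP; exact: measurable_funTS.
rewrite (ge0_integralD mu mB cst0 (measurable_cst _) (EP0 phi) mEphi).
apply: (@le_trans _ _ (\int[mu]_(x in B) (G r ^+ 2)%:E
                     + \int[mu]_(x in B) (P (G x))%:E)%E).
  apply: leeD => //.
  apply: (@le_trans _ _ (\int[mu]_(x in torus) (P (phi x))%:E)%E).
    apply: ge0_subset_integral => //; first exact/measurable_EFinP.
    by move=> x _; rewrite lee_fin.
  have mEP : measurable_fun setT (EFin \o P) by exact/measurable_EFinP.
  have EP y : (0 <= (EFin \o P) y)%E by rewrite lee_fin.
  rewrite (sym_rearr_integral mphi phiG phi0 mEP EP).
  rewrite [leLHS]integral_mkcond [leRHS]integral_mkcond le_eqVlt; apply/orP; left.
  apply/eqP; apply: eq_integral => x _; rewrite !patchE.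
  case: ifPn => [xT|xT]; case: ifPn => xB //.
    have rx : r <= `|x|.
      by move: xB; rewrite notin_setE /B/= in_itv/= -ltr_norml => /negP; rewrite -leNgt.
    have Gx : G x <= G r.
      by apply: (sym_rearr_nonincreasing phiG); rewrite ?gt_eqF ?(gtr0_norm r0).
    congr (_%:E); rewrite /P; apply/max_idPr; rewrite subr_le0.
    by rewrite ler_sqr ?nnegrE.
  by move: xT; rewrite mem_set//; apply: BT; move: xB; rewrite inE.
rewrite -(ge0_integralD mu mB cst0 (measurable_cst _) (EP0 G) mEG).
have mB0 : measurable (B `\ 0) by exact: measurableD.
rewrite -[leLHS](@integral_setD1 _ _ 0)//; last first.
  apply: measurable_funTS; apply/measurable_EFinP; exact: measurable_funD.
rewrite -[leRHS](@integral_setD1 _ _ 0)//; last first.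
  by apply: measurable_funTS; apply/measurable_EFinP; exact: measurable_funX.
rewrite le_eqVlt; apply/orP; left; apply/eqP; apply: eq_integral => x.
rewrite inE => -[]; rewrite /B/= in_itv/= -ltr_norml => xr /eqP x0.
have Gx : G r <= G x.
  by apply: (sym_rearr_nonincreasing phiG) => //; rewrite (gtr0_norm r0) ltW.
rewrite -EFinD; congr (_%:E); rewrite /P (max_idPl _) ?subrKC//.
by rewrite subr_ge0 ler_sqr ?nnegrE.
Qed.

(** The superlevel sets of the weight [1 + cos] are centered intervals. *)
Lemma integral_cos_le_sym_rearr :
  (\int[mu]_(x in torus) (phi x ^+ 2 * (1 + cos x))%:E
   <= \int[mu]_(x in torus) (G x ^+ 2 * (1 + cos x))%:E)%E.
Proof.
have mT := @measurable_torus R.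
have mG := measurable_sym_rearr phiG.
pose res (h : R -> R) := (fun x => h x ^+ 2) \_ torus.
have resE (h : R -> R) : (\int[mu]_(x in torus) (h x ^+ 2 * (1 + cos x))%:E
    = \int[mu]_x (res h x * (1 + cos x))%:E)%E.
  rewrite integral_mkcond; apply: eq_integral => x _; rewrite /res !patchE.
  by case: ifPn => //; rewrite mul0r.
have res0 (h : R -> R) x : 0 <= res h x.
  by rewrite /res patchE; case: ifPn => //; rewrite sqr_ge0.
have mres (h : R -> R) : measurable_fun torus h -> measurable_fun setT (res h).
  by move=> mh; apply/(measurable_restrictT _ mT); exact: measurable_funX.
have cos0 x : 0 <= 1 + cos x :> R by have := cos_geN1 x; lra.
rewrite !resE; apply: le_integral_weighted => //.
- exact: mres.
- by apply: mres; exact: measurable_funTS.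
- by apply: measurable_funD => //; apply: continuous_measurable_fun; exact: continuous_cos.
move=> s s0.
have intE (h : R -> R) : (\int[mu]_(x in [set x | (s < 1 + cos x)%R]) (res h x)%:E
     = \int[mu]_(x in torus `&` [set x | (s < 1 + cos x)%R]) (h x ^+ 2)%:E)%E.
  rewrite setIC integral_mkcondr; apply: eq_integral => x _.
  by rewrite /res !patchE; case: ifPn.
rewrite !intE.
have [s2|s2] := leP 2 s.
  rewrite (_ : _ `&` _ = set0) ?integral_set0//.
  by apply/seteqP; split => // x [_] /=; have := cos_le1 x; lra.
have s1 : -1 <= s - 1 <= 1 by apply/andP; split; lra.
pose r := acos (s - 1).
have cosr : cos r = s - 1 by rewrite /r acosK// in_itv.
have r0 : 0 < r by rewrite acos_gt0//; lra.
have rpi : r <= pi by rewrite acos_lepi.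
have -> : torus `&` [set x | s < 1 + cos x] = `]- r, r[%classic.
  have cosE x : `|x| <= pi -> (s < 1 + cos x) = (`|x| < r).
    move=> xpi; rewrite -ltrBlDl -cosr.
    have -> : cos x = cos `|x|.
      by have [x0|x0] := leP 0 x; rewrite ?(ger0_norm x0)// (ltr0_norm x0) cosN.
    by rewrite ltr_cos// in_itv/= ?normr_ge0 ?xpi// rpi (ltW r0).
  apply/seteqP; split => x; rewrite /torus/= !in_itv/= -!ltr_norml.
    by move=> [/ltW xpi]; rewrite cosE.
  by move=> xr; split; [exact: lt_le_trans xr rpi|rewrite cosE// (le_trans (ltW xr))].
exact: integral_ball_le_sym_rearr.
Qed.

End Bathtub.

(** * Square-integrable complex functions on the circle *)

Section ComplexFunctions.
Variable R : realType.
Local Notation mu := (@lebesgue_measure R).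
Local Notation Re := complex.Re.
Local Notation Im := complex.Im.
Implicit Types (z w c : R[i]) (f g h : R -> R[i]).

Lemma ReD z w : Re (z + w) = Re z + Re w. Proof. by case: z w => [? ?] []. Qed.
Lemma ImD z w : Im (z + w) = Im z + Im w. Proof. by case: z w => [? ?] []. Qed.
Lemma ReN z : Re (- z) = - Re z. Proof. by case: z. Qed.
Lemma ImN z : Im (- z) = - Im z. Proof. by case: z. Qed.
Lemma ReM z w : Re (z * w) = Re z * Re w - Im z * Im w.
Proof. by case: z w => [? ?] []. Qed.
Lemma ImM z w : Im (z * w) = Re z * Im w + Im z * Re w.
Proof. by case: z w => [? ?] []. Qed.
Lemma Re_conj z : Re (conjc z) = Re z. Proof. by case: z. Qed.
Lemma Im_conj z : Im (conjc z) = - Im z. Proof. by case: z. Qed.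
Lemma conjD z w : conjc (z + w) = conjc z + conjc w. Proof. exact: rmorphD. Qed.
Lemma conjM z w : conjc (z * w) = conjc z * conjc w. Proof. exact: rmorphM. Qed.
Lemma complex_eq z w : Re z = Re w -> Im z = Im w -> z = w.
Proof. by case: z w => [? ?] [? ?] /= -> ->. Qed.

Lemma cabs_ge0 z : 0 <= cabs z.
Proof. by case: z => a b; rewrite sqrtr_ge0. Qed.

Lemma cabs_sqr z : cabs z ^+ 2 = Re z ^+ 2 + Im z ^+ 2.
Proof. by case: z => a b; rewrite sqr_sqrtr// addr_ge0 ?sqr_ge0. Qed.

Lemma cabsM z w : cabs (z * w) = cabs z * cabs w.
Proof. exact: Normc.normcM. Qed.

Lemma cabsD z w : cabs (z + w) <= cabs z + cabs w.
Proof. exact: le_normcD. Qed.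

Lemma cabsN z : cabs (- z) = cabs z.
Proof. exact: normcN. Qed.

Lemma cabs_real (a : R) : cabs (a%:C%C) = `|a|.
Proof. by rewrite /= expr0n/= addr0 sqrtr_sqr. Qed.

Lemma normr_Re_le z : `|Re z| <= cabs z.
Proof.
rewrite -ler_sqr ?nnegrE ?cabs_ge0// cabs_sqr real_normK ?num_real//.
by rewrite lerDl sqr_ge0.
Qed.

Lemma normr_Im_le z : `|Im z| <= cabs z.
Proof.
rewrite -ler_sqr ?nnegrE ?cabs_ge0// cabs_sqr real_normK ?num_real//.
by rewrite lerDr sqr_ge0.
Qed.

Lemma cabs_le z : cabs z <= `|Re z| + `|Im z|.
Proof.
rewrite -ler_sqr ?nnegrE ?cabs_ge0 ?addr_ge0// cabs_sqr sqrrD !real_normK ?num_real//.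
by rewrite addrAC lerDl mulrn_wge0// mulr_ge0.
Qed.

Lemma mul_conj_cabs z : z * conjc z = ((cabs z ^+ 2)%:C)%C.
Proof. by apply: complex_eq; rewrite ?ReM ?ImM Re_conj Im_conj ?cabs_sqr/=; ring. Qed.

Lemma cexpD (s t : R) : cexp (s + t) = cexp s * cexp t.
Proof.
by apply: complex_eq; rewrite ?ReM ?ImM/= ?cosD ?sinD//; ring.
Qed.

Lemma cexp_conj (t : R) : conjc (cexp t) = cexp (- t).
Proof. by rewrite /cexp/= cosN sinN. Qed.

Lemma cexp0 : cexp 0 = 1 :> R[i].
Proof. by rewrite /cexp cos0 sin0. Qed.

Lemma cabs_cexp (t : R) : cabs (cexp t) = 1.
Proof. by rewrite /= cos2Dsin2 sqrtr1. Qed.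

Definition cmeasurable f :=
  measurable_fun torus (fun x => Re (f x)) /\ measurable_fun torus (fun x => Im (f x)).

Lemma cmeasurableD f g : cmeasurable f -> cmeasurable g ->
  cmeasurable (fun x => f x + g x).
Proof.
move=> [f1 f2] [g1 g2]; split.
  by under eq_fun do rewrite ReD; exact: measurable_funD.
by under eq_fun do rewrite ImD; exact: measurable_funD.
Qed.

Lemma cmeasurableN f : cmeasurable f -> cmeasurable (fun x => - f x).
Proof.
move=> [f1 f2]; split.
  by under eq_fun do rewrite ReN; exact: measurable_funN.
by under eq_fun do rewrite ImN; exact: measurable_funN.
Qed.

Lemma cmeasurableB f g : cmeasurable f -> cmeasurable g ->
  cmeasurable (fun x => f x - g x).
Proof. by move=> mf mg; apply: cmeasurableD => //; exact: cmeasurableN. Qed.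

Lemma cmeasurableM f g : cmeasurable f -> cmeasurable g ->
  cmeasurable (fun x => f x * g x).
Proof.
move=> [f1 f2] [g1 g2]; split.
  by under eq_fun do rewrite ReM; apply: measurable_funB; exact: measurable_funM.
by under eq_fun do rewrite ImM; apply: measurable_funD; exact: measurable_funM.
Qed.

Lemma cmeasurable_cst c : cmeasurable (fun=> c).
Proof. by split; exact: measurable_cst. Qed.

Lemma cmeasurable_sum I (s : seq I) (F : I -> R -> R[i]) :
  (forall i, cmeasurable (F i)) -> cmeasurable (fun x => \sum_(i <- s) F i x).
Proof.
move=> mF; elim: s => [|i s IH].
  by under eq_fun do rewrite big_nil; exact: cmeasurable_cst.
by under eq_fun do rewrite big_cons; exact: cmeasurableD.
Qed.

Lemma cmeasurable_cexp (a : R) : cmeasurable (fun x => cexp (a * x)).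
Proof.
split; apply: measurable_funTS; apply: continuous_measurable_fun => x.
  apply: (@continuous_comp _ _ _ ( *%R a) cos); last exact: continuous_cos.
  exact: mulrl_continuous.
apply: (@continuous_comp _ _ _ ( *%R a) sin); last exact: continuous_sin.
exact: mulrl_continuous.
Qed.

Lemma measurable_cabs_sqr f : cmeasurable f ->
  measurable_fun torus (fun x => cabs (f x) ^+ 2).
Proof.
move=> [f1 f2]; under eq_fun do rewrite cabs_sqr.
by apply: measurable_funD; exact: measurable_funX.
Qed.

Lemma measurable_cabs f : cmeasurable f ->
  measurable_fun torus (fun x => cabs (f x)).
Proof.
move=> mf; have -> : (fun x => cabs (f x)) = Num.sqrt \o (fun x => cabs (f x) ^+ 2).
  by apply/funext => x /=; rewrite sqrtr_sqr ger0_norm// cabs_ge0.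
apply: measurableT_comp; last exact: measurable_cabs_sqr.
by apply: continuous_measurable_fun; exact: sqrt_continuous.
Qed.

Definition cintegrable f :=
  mu.-integrable torus (fun x => (Re (f x))%:E) /\
  mu.-integrable torus (fun x => (Im (f x))%:E).

Definition cint f : R[i] :=
  Complex (\int[mu]_(x in torus) Re (f x)) (\int[mu]_(x in torus) Im (f x)).

Let mT : measurable (@torus R) := @measurable_torus R.

Lemma cintegrable_dominated f (k : R -> R) : cmeasurable f ->
  mu.-integrable torus (EFin \o k) -> (forall x, cabs (f x) <= k x) ->
  cintegrable f.
Proof.
move=> [f1 f2] ik fk.
have part (h : R -> R) : measurable_fun torus h -> (forall x, `|h x| <= cabs (f x)) ->
    mu.-integrable torus (fun x => (h x)%:E).
  move=> mh hf; apply: (@le_integrable _ _ R mu torus mT _ (EFin \o k)) => //.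
    exact/measurable_EFinP.
  by move=> x _ /=; rewrite lee_fin (le_trans (hf x))// (le_trans (fk x))// ler_norm.
by split; apply: part => // x; [exact: normr_Re_le|exact: normr_Im_le].
Qed.

Lemma cintegrableD f g : cintegrable f -> cintegrable g ->
  cintegrable (fun x => f x + g x).
Proof.
move=> [f1 f2] [g1 g2]; split.
  under eq_fun do rewrite ReD EFinD; exact: integrableD.
under eq_fun do rewrite ImD EFinD; exact: integrableD.
Qed.

Lemma cintD f g : cintegrable f -> cintegrable g ->
  cint (fun x => f x + g x) = cint f + cint g.
Proof.
move=> [f1 f2] [g1 g2]; apply: complex_eq; rewrite ?ReD ?ImD/=.
  by under eq_Rintegral do rewrite ReD; exact: RintegralD.
by under eq_Rintegral do rewrite ImD; exact: RintegralD.
Qed.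

Lemma cintegrableZ c f : cintegrable f -> cintegrable (fun x => c * f x).
Proof.
move=> [f1 f2]; split.
  under eq_fun do rewrite ReM EFinB !EFinM.
  by apply: integrableB => //; exact: integrableZl.
under eq_fun do rewrite ImM EFinD !EFinM.
by apply: integrableD => //; exact: integrableZl.
Qed.

Lemma cintZ c f : cintegrable f -> cint (fun x => c * f x) = c * cint f.
Proof.
move=> [f1 f2].
have iZ (a : R) (k : R -> R) : mu.-integrable torus (fun x => (k x)%:E) ->
    mu.-integrable torus (EFin \o (fun x => a * k x)).
  by move=> ik; rewrite (_ : _ \o _ = (fun x => a%:E * (k x)%:E)%E)//; exact: integrableZl.
apply: complex_eq; rewrite ?ReM ?ImM/=.
  under eq_Rintegral do rewrite ReM.
  by rewrite RintegralB ?RintegralZl//; exact: iZ.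
under eq_Rintegral do rewrite ImM.
by rewrite RintegralD ?RintegralZl//; exact: iZ.
Qed.

Lemma cintegrable0 : cintegrable (fun=> 0).
Proof. by split; exact: integrable0. Qed.

Lemma cint0 : cint (fun=> 0) = 0.
Proof.
by apply: complex_eq; rewrite /=/Rintegral integral0_eq.
Qed.

Lemma cintegrable_sum I (s : seq I) (F : I -> R -> R[i]) :
  (forall i, cintegrable (F i)) -> cintegrable (fun x => \sum_(i <- s) F i x).
Proof.
move=> iF; elim: s => [|i s IH].
  by under eq_fun do rewrite big_nil; exact: cintegrable0.
by under eq_fun do rewrite big_cons; exact: cintegrableD.
Qed.

Lemma cint_sum I (s : seq I) (F : I -> R -> R[i]) :
  (forall i, cintegrable (F i)) ->
  cint (fun x => \sum_(i <- s) F i x) = \sum_(i <- s) cint (F i).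
Proof.
move=> iF; elim: s => [|i s IH].
  by under eq_fun do rewrite big_nil; rewrite big_nil cint0.
under eq_fun do rewrite big_cons.
by rewrite big_cons cintD ?IH//; exact: cintegrable_sum.
Qed.

Lemma cabs_cint_le f (k : R -> R) : cmeasurable f ->
  mu.-integrable torus (EFin \o k) -> (forall x, cabs (f x) <= k x) ->
  cabs (cint f) <= 2 * \int[mu]_(x in torus) k x.
Proof.
move=> mf ik fk; have [f1 f2] := cintegrable_dominated mf ik fk.
have part (h : R -> R) : mu.-integrable torus (EFin \o h) ->
    (forall x, `|h x| <= cabs (f x)) ->
    `|\int[mu]_(x in torus) h x| <= \int[mu]_(x in torus) k x.
  move=> ih hf; apply: (le_trans (@le_normr_Rintegral _ _ _ mu _ h mT ih)).
  apply: le_Rintegral => //; first exact: (integrable_norm ih).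
  by move=> x _; exact: le_trans (hf x) (fk x).
apply: (le_trans (cabs_le _)); rewrite mulr_natl mulr2n; apply: lerD => /=.
  by apply: part => // x; exact: normr_Re_le.
by apply: part => // x; exact: normr_Im_le.
Qed.

Lemma integrable_torus_cst (a : R) : mu.-integrable torus (fun=> a%:E).
Proof.
apply/integrableP; split; first exact: measurable_cst.
by rewrite integral_cst//= lebesgue_measure_torus -EFinM ltry.
Qed.

Lemma cintegrable_cexp (a : R) : cintegrable (fun x => cexp (a * x)).
Proof.
apply: (cintegrable_dominated (cmeasurable_cexp a) (integrable_torus_cst 1)) => x.
by rewrite cabs_cexp.
Qed.

Lemma Rintegral_torus_FTC (f F : R -> R) : continuous f ->
  (forall x : R, is_derive x 1 F (f x)) ->
  \int[mu]_(x in torus) f x = F pi - F (- pi).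
Proof.
move=> cf dF.
have cF : continuous F.
  by move=> x; apply: differentiable_continuous; apply/derivable1_diffP; case: (dF x).
have p0 := pi_gt0 R.
rewrite /Rintegral /torus.
rewrite -(@integral_itv_bndoo _ _ _ _ true false); last first.
  by apply: measurable_funTS; apply/measurable_EFinP; exact: continuous_measurable_fun.
rewrite (@continuous_FTC2 _ f F)//.
- by lra.
- by apply: continuous_subspaceT.
- split=> [x _||]; first by case: (dF x).
    exact: cvg_at_right_filter (cF _).
  exact: cvg_at_left_filter (cF _).
- by move=> x _; rewrite derive1E; case: (dF x).
Qed.

Lemma cint_cexp (n : int) :
  cint (fun x => cexp (n%:~R * x)) = if n == 0 then ((2 * pi)%:C)%C else 0.
Proof.
case: eqP => [->|/eqP n0].
  have -> : (fun x : R => cexp (0%:~R * x)) = fun=> 1.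
    by apply/funext => x; rewrite mul0r cexp0.
  apply: complex_eq; rewrite /= Rintegral_cst//= ?mul0r//.
  by rewrite lebesgue_measure_torus/= mul1r.
have nR : n%:~R != 0 :> R by rewrite intr_eq0.
have sinn (m : nat) : sin (m%:R * pi) = 0 :> R.
  elim: m => [|m IH]; first by rewrite mul0r sin0.
  by rewrite -natr1 mulrDl mul1r sinDpi IH oppr0.
have sinz : sin (n%:~R * pi) = 0 :> R.
  case: n {n0 nR} => m; first exact: sinn.
  by rewrite NegzE mulrNz mulNr sinN sinn oppr0.
have cont (F : R -> R) : continuous F -> continuous (fun x : R => F (n%:~R * x)).
  move=> cF x.
  have cn : {for x, continuous ( *%R (n%:~R : R))} by exact: mulrl_continuous.
  exact: (@continuous_comp R R R ( *%R (n%:~R : R)) F x cn (cF _)).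
have dcomp (c : R) (F dF : R -> R) : (forall x : R, is_derive x 1 F (dF x)) ->
    forall x : R, is_derive x 1 (fun x => c * F (n%:~R * x)) (c * (dF (n%:~R * x) * n%:~R)).
  move=> dF' x.
  have dmul : is_derive x 1 ( *%R (n%:~R : R)) n%:~R.
    apply: (is_derive_eq (is_deriveZ (f := id) (n%:~R : R) (is_derive_id x 1))).
    exact: mulr1.
  exact: (is_deriveZ c (is_derive1_comp (dF' _) dmul)).
have dS (x : R) : is_derive x 1 (fun x => (n%:~R)^-1 * sin (n%:~R * x)) (cos (n%:~R * x)).
  apply: (is_derive_eq (dcomp _ _ _ (@is_derive_sin R) x)).
  by rewrite mulrCA mulVf// mulr1.
have dC (x : R) : is_derive x 1 (fun x => - (n%:~R)^-1 * cos (n%:~R * x)) (sin (n%:~R * x)).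
  apply: (is_derive_eq (dcomp _ _ _ (@is_derive_cos R) x)).
  by rewrite mulNr mulNr mulrN opprK mulrCA mulVf// mulr1.
apply: complex_eq => /=.
  rewrite (Rintegral_torus_FTC (cont _ (@continuous_cos R)) dS).
  by rewrite mulrN sinN sinz oppr0 mulr0 subr0.
rewrite (Rintegral_torus_FTC (cont _ (@continuous_sin R)) dC).
by rewrite mulrN cosN subrr.
Qed.

End ComplexFunctions.

(** * Fourier coefficients and Bessel's inequality *)

Section SumsOverSeq.
Variables (R : realType) (T : choiceType).

Lemma sum_seq_le_esum (a : T -> \bar R) (r : seq T) :
  uniq r -> (\sum_(n <- r) a n <= \esum_(n in [set: T]) a n)%E.
Proof.
move=> ur; apply: esum_ge; exists [set` r]; last by rewrite fsbig_seq.
by split => //; exact: finite_seq.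
Qed.

Lemma esum_le_sum_seq (a : T -> \bar R) (B : \bar R) :
  (forall r, uniq r -> (\sum_(n <- r) a n <= B)%E) ->
  (\esum_(n in [set: T]) a n <= B)%E.
Proof.
move=> rB; apply: ge_ereal_sup => _ [X [finX _]] <-.
by rewrite fsbig_finite//; apply: rB; exact: fset_uniq.
Qed.

End SumsOverSeq.

Section FourierCoefficients.
Variable R : realType.
Local Notation mu := (@lebesgue_measure R).
Local Notation Re := complex.Re.
Local Notation Im := complex.Im.
Implicit Types (f g h : R -> R[i]) (c u : int -> R[i]) (r : seq int).
Let mT : measurable (@torus R) := @measurable_torus R.

Definition sqnorm f : \bar R := \int[mu]_(x in torus) (cabs (f x) ^+ 2)%:E.

Definition square_integrable f := cmeasurable f /\ (sqnorm f < +oo)%E.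

Lemma sqnorm_ge0 f : (0 <= sqnorm f)%E.
Proof. by apply: integral_ge0 => x _; rewrite lee_fin sqr_ge0. Qed.

Lemma square_integrable_integrable f : square_integrable f ->
  mu.-integrable torus (EFin \o (fun x => cabs (f x) ^+ 2)).
Proof.
move=> [mf f2]; apply/integrableP; split.
  by apply/measurable_EFinP; exact: measurable_cabs_sqr.
apply: le_lt_trans f2; apply: ge0_le_integral => //.
- apply: measurableT_comp => //; apply/measurable_EFinP.
  exact: measurable_cabs_sqr.
- by apply/measurable_EFinP; exact: measurable_cabs_sqr.
- by move=> x _; rewrite /= ger0_norm ?sqr_ge0.
Qed.

Lemma sqnormE f : square_integrable f ->
  sqnorm f = (\int[mu]_(x in torus) (cabs (f x) ^+ 2))%:E.
Proof.
by move=> [mf f2]; rewrite /Rintegral fineK// ge0_fin_numE// sqnorm_ge0.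
Qed.

Lemma sqnormZ (t : R) f : 0 <= t -> cmeasurable f ->
  (\int[mu]_(x in torus) (t%:E * (cabs (f x) ^+ 2)%:E) = t%:E * sqnorm f)%E.
Proof.
move=> t0 mf; apply: ge0_integralZl => //.
- by apply/measurable_EFinP; exact: measurable_cabs_sqr.
- by move=> x _; rewrite lee_fin sqr_ge0.
Qed.

Lemma sqnorm_le_add f g (a b : R) : 0 <= a -> 0 <= b ->
  cmeasurable f -> cmeasurable g -> forall h, cmeasurable h ->
  (forall x, torus x ->
     cabs (h x) ^+ 2 <= a * cabs (f x) ^+ 2 + b * cabs (g x) ^+ 2) ->
  (sqnorm h <= a%:E * sqnorm f + b%:E * sqnorm g)%E.
Proof.
move=> a0 b0 mf mg h mh hfg.
have mE (k : R -> R[i]) : cmeasurable k -> measurable_fun torus (fun x => (cabs (k x) ^+ 2)%:E).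
  by move=> mk; apply/measurable_EFinP; exact: measurable_cabs_sqr.
have E0 (k : R -> R[i]) x : torus x -> (0 <= (cabs (k x) ^+ 2)%:E :> \bar R)%E.
  by rewrite lee_fin sqr_ge0.
have aE0 (t : R) (k : R -> R[i]) : 0 <= t ->
    forall x, torus x -> (0 <= t%:E * (cabs (k x) ^+ 2)%:E)%E.
  by move=> t0 x _; rewrite -EFinM lee_fin mulr_ge0// sqr_ge0.
have amE (t : R) (k : R -> R[i]) : cmeasurable k ->
    measurable_fun torus (fun x => t%:E * (cabs (k x) ^+ 2)%:E)%E.
  by move=> mk; apply: emeasurable_funM => //; exact: mE.
rewrite -!sqnormZ//.
rewrite -(ge0_integralD mu mT (aE0 a f a0) (amE a f mf) (aE0 b g b0) (amE b g mg)).
apply: ge0_le_integral => //.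
- by move=> x Tx; exact: E0.
- exact: mE.
- by apply: emeasurable_funD; exact: amE.
Qed.

Lemma cabs_sqr_add_le (z w : R[i]) : cabs (z + w) ^+ 2 <= 2 * cabs z ^+ 2 + 2 * cabs w ^+ 2.
Proof.
apply: (@le_trans _ _ ((cabs z + cabs w) ^+ 2)).
  by rewrite ler_sqr ?nnegrE ?addr_ge0 ?cabs_ge0// cabsD.
by have := sqr_ge0 (cabs z - cabs w); rewrite sqrrB sqrrD; lra.
Qed.

Lemma square_integrableD f g : square_integrable f -> square_integrable g ->
  square_integrable (fun x => f x + g x).
Proof.
move=> [mf f2] [mg g2]; have mfg := cmeasurableD mf mg; split=> //.
apply: (le_lt_trans (@sqnorm_le_add f g 2 2 _ _ mf mg _ mfg _)) => //.
  by move=> x _; exact: cabs_sqr_add_le.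
by rewrite lte_add_pinfty// lte_mul_pinfty.
Qed.

Lemma sqnormN f : sqnorm (fun x => - f x) = sqnorm f.
Proof. by apply: eq_integral => x _; rewrite cabsN. Qed.

Lemma square_integrableB f g : square_integrable f -> square_integrable g ->
  square_integrable (fun x => f x - g x).
Proof.
move=> sf [mg g2]; apply: square_integrableD => //; split.
  exact: cmeasurableN.
by rewrite sqnormN.
Qed.

Lemma square_integrableM_bounded f g (M : R) : square_integrable f ->
  cmeasurable g -> (forall x, cabs (g x) <= M) ->
  square_integrable (fun x => f x * g x).
Proof.
move=> [mf f2] mg gM; have mfg := cmeasurableM mf mg; split=> //.
have M0 : 0 <= M by exact: le_trans (cabs_ge0 _) (gM 0).
apply: (le_lt_trans (@sqnorm_le_add f f (M ^+ 2) 0 _ _ mf mf _ mfg _)) => //.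
- exact: sqr_ge0.
- move=> x _; rewrite mul0r addr0 cabsM exprMn mulrC ler_wpM2r ?sqr_ge0//.
  by rewrite ler_sqr ?nnegrE ?cabs_ge0.
- by rewrite mul0e adde0 lte_mul_pinfty// lee_fin sqr_ge0.
Qed.

Lemma square_integrable_bounded f (M : R) : cmeasurable f ->
  (forall x, cabs (f x) <= M) -> square_integrable f.
Proof.
move=> mf fM; split => //.
apply: (@le_lt_trans _ _ (\int[mu]_(x in torus) (M ^+ 2)%:E)%E).
  apply: ge0_le_integral => //.
  - by move=> x _; rewrite lee_fin sqr_ge0.
  - by apply/measurable_EFinP; exact: measurable_cabs_sqr.
  - move=> x _; rewrite lee_fin ler_sqr ?nnegrE ?cabs_ge0//.
    exact: le_trans (cabs_ge0 _) (fM x).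
by rewrite integral_cst//= lebesgue_measure_torus -EFinM ltry.
Qed.

Lemma cintegrableM f g : square_integrable f -> square_integrable g ->
  cintegrable (fun x => f x * g x).
Proof.
move=> sf sg.
apply: (@cintegrable_dominated _ _ (fun x => cabs (f x) ^+ 2 + cabs (g x) ^+ 2)).
- by apply: cmeasurableM; [case: sf|case: sg].
- rewrite (_ : _ \o _ = ((fun x => (cabs (f x) ^+ 2)%:E)
                         \+ (fun x => (cabs (g x) ^+ 2)%:E))%E)//.
  by apply: integrableD => //; exact: square_integrable_integrable.
move=> x; rewrite cabsM; have := cabs_ge0 (f x); have := cabs_ge0 (g x).
by move: (cabs _) (cabs _) => a b; nra.
Qed.

Lemma square_integrable_cexp (a : R) : square_integrable (fun x => cexp (a * x)).
Proof.
apply: (@square_integrable_bounded _ 1); first exact: cmeasurable_cexp.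
by move=> x; rewrite cabs_cexp.
Qed.

Lemma square_integrable_cst (z : R[i]) : square_integrable (fun=> z).
Proof. exact: (square_integrable_bounded (cmeasurable_cst z) (fun=> lexx _)). Qed.

Definition fnorm : R := (Num.sqrt (2 * pi))^-1.

Lemma fnorm_gt0 : 0 < fnorm.
Proof. by rewrite invr_gt0 sqrtr_gt0 mulr_gt0// pi_gt0. Qed.

Lemma fnorm_sqr : fnorm ^+ 2 * (2 * pi) = 1.
Proof.
rewrite exprVn sqr_sqrtr ?mulVf//; last by rewrite mulr_ge0// pi_ge0.
by rewrite mulf_neq0// gt_eqF// pi_gt0.
Qed.

Lemma inv_fourierE f n :
  inv_fourier f n = fnorm%:C%C * cint (fun x => f x * cexp (n%:~R * x)).
Proof. by []. Qed.

Lemma inv_fourierB f g n : square_integrable f -> square_integrable g ->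
  inv_fourier (fun x => f x - g x) n = inv_fourier f n - inv_fourier g n.
Proof.
move=> sf sg; rewrite !inv_fourierE -mulrBr.
have ie h : square_integrable h -> cintegrable (fun x => h x * cexp (n%:~R * x)).
  by move=> sh; apply: cintegrableM => //; exact: square_integrable_cexp.
under [in LHS]eq_fun do rewrite mulrBl -mulN1r.
by rewrite cintD ?cintZ ?mulN1r//; [exact: ie|exact: ie|apply: cintegrableZ; exact: ie].
Qed.

Definition trigpoly r c (x : R) : R[i] :=
  fnorm%:C%C * \sum_(n <- r) c n * cexp (- (n%:~R * x)).

Lemma cmeasurable_trigpoly r c : cmeasurable (trigpoly r c).
Proof.
apply: cmeasurableM; first exact: cmeasurable_cst.
apply: cmeasurable_sum => n; apply: cmeasurableM; first exact: cmeasurable_cst.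
by under eq_fun do rewrite -mulNr; exact: cmeasurable_cexp.
Qed.

Lemma Re_sum I (s : seq I) (F : I -> R[i]) :
  Re (\sum_(i <- s) F i) = \sum_(i <- s) Re (F i).
Proof.
elim: s => [|i s IH]; first by rewrite !big_nil.
by rewrite !big_cons ReD IH.
Qed.

Lemma cabs_sum I (s : seq I) (F : I -> R[i]) :
  cabs (\sum_(i <- s) F i) <= \sum_(i <- s) cabs (F i).
Proof.
elim: s => [|i s IH]; first by rewrite !big_nil Normc.normc0.
by rewrite !big_cons; apply: le_trans (cabsD _ _) _; rewrite lerD2l.
Qed.

Lemma square_integrable_trigpoly r c : square_integrable (trigpoly r c).
Proof.
apply: (@square_integrable_bounded _ (fnorm * \sum_(n <- r) cabs (c n))).
  exact: cmeasurable_trigpoly.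
move=> x; rewrite /trigpoly cabsM cabs_real gtr0_norm ?fnorm_gt0//.
rewrite ler_pM2l ?fnorm_gt0//; apply: le_trans (cabs_sum _ _) _.
by apply: ler_sum => n _; rewrite cabsM cabs_cexp mulr1.
Qed.

Lemma cint_mul_conj_trigpoly h r c : square_integrable h ->
  cint (fun x => h x * conjc (trigpoly r c x))
    = \sum_(n <- r) conjc (c n) * inv_fourier h n.
Proof.
move=> sh.
have ie n : cintegrable (fun x => h x * cexp (n%:~R * x)).
  by apply: cintegrableM => //; exact: square_integrable_cexp.
have -> : (fun x => h x * conjc (trigpoly r c x)) = (fun x => \sum_(n <- r)
    (fnorm%:C%C * conjc (c n)) * (h x * cexp (n%:~R * x))).
  apply/funext => x; rewrite /trigpoly conjM (big_morph _ (@conjD R) (@conjc0 R)) conjc_real.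
  rewrite mulrA mulr_sumr; apply: eq_bigr => n _.
  by rewrite conjM cexp_conj opprK; ring.
rewrite cint_sum; last by move=> n; exact: cintegrableZ.
apply: eq_bigr => n _; rewrite cintZ// inv_fourierE; ring.
Qed.

Lemma inv_fourier_trigpoly r c n : uniq r ->
  inv_fourier (trigpoly r c) n = if n \in r then c n else 0.
Proof.
move=> ur; rewrite inv_fourierE.
have -> : (fun x => trigpoly r c x * cexp (n%:~R * x)) = (fun x => \sum_(m <- r)
    (fnorm%:C%C * c m) * cexp ((n - m)%:~R * x)).
  apply/funext => x; rewrite /trigpoly -mulrA mulr_suml mulr_sumr.
  apply: eq_bigr => m _; rewrite -!mulrA -cexpD; congr (_ * (_ * cexp _)).
  by rewrite rmorphB/=; ring.
rewrite cint_sum; last by move=> m; apply: cintegrableZ; exact: cintegrable_cexp.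
under eq_bigr do (rewrite cintZ ?cint_cexp; last exact: cintegrable_cexp).
have val (m : int) : m = n ->
    fnorm%:C%C * ((fnorm%:C%C * c m) * if n - m == 0 then ((2 * pi)%:C)%C else 0) = c n.
  move=> ->; rewrite subrr eqxx.
  have -> : fnorm%:C%C * (fnorm%:C%C * c n * ((2 * pi)%:C)%C)
          = ((fnorm ^+ 2 * (2 * pi))%:C)%C * c n.
    by apply: complex_eq; rewrite !(ReM, ImM)/=; ring.
  by rewrite fnorm_sqr mul1r.
case: ifPn => nr.
  rewrite (bigD1_seq n)//= big1 ?addr0; first exact: val.
  by move=> m mn; rewrite subr_eq0 eq_sym (negbTE mn) mulr0.
rewrite big_seq big1 ?mulr0// => m mr; rewrite subr_eq0.
by case: eqP => [nm|]; rewrite ?mulr0//; move: nr; rewrite nm mr.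
Qed.

Lemma Re_cint_conj h : square_integrable h ->
  ((Re (cint (fun x => h x * conjc (h x))))%:E = sqnorm h)%E.
Proof.
move=> sh; rewrite sqnormE//=; congr (_%:E).
by apply: eq_Rintegral => x _; rewrite mul_conj_cabs.
Qed.

Lemma sqnorm_trigpoly r c : uniq r ->
  sqnorm (trigpoly r c) = (\sum_(n <- r) cabs (c n) ^+ 2)%:E.
Proof.
move=> ur; have sP := square_integrable_trigpoly r c.
rewrite -Re_cint_conj// cint_mul_conj_trigpoly//; congr (_%:E).
rewrite Re_sum big_seq [RHS]big_seq.
apply: eq_bigr => n nr; rewrite inv_fourier_trigpoly// nr mulrC mul_conj_cabs//.
Qed.

(** Bessel's inequality, from [0 <= |h - P| ^ 2] for the partial sum [P] of the
    Fourier series of [h]. *)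
Lemma bessel h r : square_integrable h -> uniq r ->
  ((\sum_(n <- r) cabs (inv_fourier h n) ^+ 2)%:E <= sqnorm h)%E.
Proof.
move=> sh ur; pose c := inv_fourier h; pose P := trigpoly r c.
have sP : square_integrable P by exact: square_integrable_trigpoly.
have sPc : square_integrable (fun x => conjc (P x)).
  have cc z : cabs (conjc z) = cabs z :> R.
    by case: z => a b; rewrite /= sqrrN.
  case: sP => -[m1 m2] P2; split; last by rewrite /sqnorm; under eq_integral do rewrite cc.
  split; first by under eq_fun do rewrite Re_conj.
  by under eq_fun do rewrite Im_conj; exact: measurable_funN.
rewrite (sqnormE sh) lee_fin.
have -> : \sum_(n <- r) cabs (inv_fourier h n) ^+ 2
    = \int[mu]_(x in torus) (2 * Re (h x * conjc (P x)) - cabs (P x) ^+ 2).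
  have i1 : mu.-integrable torus (EFin \o (fun x => Re (h x * conjc (P x)))).
    by have [] := cintegrableM sh sPc.
  have i2 : mu.-integrable torus (EFin \o (fun x => 2 * Re (h x * conjc (P x)))).
    rewrite (_ : _ \o _ = fun x => (2%:E * (Re (h x * conjc (P x)))%:E)%E)//.
    exact: integrableZl.
  rewrite RintegralB ?RintegralZl//; last exact: square_integrable_integrable.
  have := sqnormE sP; rewrite /P sqnorm_trigpoly// => -[] <-.
  have -> : \int[mu]_(x in torus) Re (h x * conjc (P x))
      = Re (cint (fun x => h x * conjc (P x))) by [].
  rewrite cint_mul_conj_trigpoly// Re_sum mulr_sumr -sumrB.
  by apply: eq_bigr => n _; rewrite -/(c n) [conjc _ * _]mulrC mul_conj_cabs/=; ring.
apply: le_Rintegral => //.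
- rewrite (_ : _ \o _ = ((fun x => 2%:E * (Re (h x * conjc (P x)))%:E)
                         \- (fun x => (cabs (P x) ^+ 2)%:E))%E)//.
  apply: integrableB => //; last exact: (square_integrable_integrable sP).
  by apply: integrableZl => //; have [] := cintegrableM sh sPc.
- exact: square_integrable_integrable.
move=> x _; rewrite !cabs_sqr ReM Re_conj Im_conj.
have := sqr_ge0 (Re (h x) - Re (P x)); have := sqr_ge0 (Im (h x) - Im (P x)).
by rewrite !sqrrB; lra.
Qed.

End FourierCoefficients.

(** * Riesz-Fischer *)

Section RieszFischer.
Variable R : realType.
Local Notation mu := (@lebesgue_measure R).
Local Notation Re := complex.Re.
Local Notation Im := complex.Im.
Let mT : measurable (@torus R) := @measurable_torus R.

Lemma cvg_bounded_increments (a : nat -> R) (B : R) :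
  (forall n, \sum_(j < n) `|a j.+1 - a j| <= B) -> cvgn a.
Proof.
move=> aB.
have -> : a = (fun n => a 0%N + series (telescope a) n).
  by apply/funext => n; exact: eq_sum_telescope.
apply: is_cvgD; first exact: is_cvg_cst.
apply: normed_cvg; apply: nondecreasing_is_cvgn.
  by apply/nondecreasing_seqP => n; rewrite /normed_series_of /series/= big_nat_recr//= lerDl.
exists B => _ [n _ <-]; rewrite /normed_series_of /series/= big_mkord.
by apply: le_trans (aB n); apply: ler_sum => j _; rewrite /telescope.
Qed.

(** The series [\sum_j 2 ^ j * |s j.+1 - s j| ^ 2] has a finite integral, hence
    is finite almost everywhere; where it is, it bounds the sum of the
    increments themselves, since [t <= 2 ^ (- j) + 2 ^ j * t ^ 2]. *)
Lemma ae_limit_of_fast_cauchy (s : nat -> R -> R[i]) :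
  (forall j, cmeasurable (s j)) ->
  (forall j, (sqnorm (fun x => s j.+1 x - s j x)%R <= (4^-1 ^+ j)%:E)%E) ->
  exists2 g, cmeasurable g &
    {ae mu, forall x, torus x -> cabs (s j x - g x) @[j --> \oo] --> 0}.
Proof.
move=> ms s4.
have geo n : \sum_(j < n) 2^-1 ^+ j <= 2 :> R.
  have -> : \sum_(j < n) 2^-1 ^+ j = 2 - 2 * 2^-1 ^+ n :> R.
    elim: n => [|m IHm]; first by rewrite big_ord0 expr0; lra.
    by rewrite big_ord_recr/= IHm exprS; lra.
  by rewrite gerBl mulr_ge0// exprn_ge0// invr_ge0.
pose d j x := 2 ^+ j * cabs (s j.+1 x - s j x) ^+ 2.
have d0 j x : 0 <= d j x by rewrite mulr_ge0 ?sqr_ge0// exprn_ge0.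
have mcd j : cmeasurable (fun x => s j.+1 x - s j x) by exact: cmeasurableB.
have md j : measurable_fun torus (fun x => (d j x)%:E).
  apply/measurable_EFinP; apply: measurable_funM => //.
  exact: (measurable_cabs_sqr (mcd j)).
pose F x := (\sum_(j <oo) (d j x)%:E)%E.
have F0 x : (0 <= F x)%E by apply: nneseries_ge0 => j _ _; rewrite lee_fin.
have mF : measurable_fun torus F.
  by apply: ge0_emeasurable_sum => // j x _ _; rewrite lee_fin.
have sumF x n : F x \is a fin_num -> \sum_(j < n) d j x <= fine (F x).
  move=> Fx; rewrite -lee_fin fineK// -sumEFin.
  rewrite -(big_mkord xpredT (fun j => (d j x)%:E)).
  by apply: nneseries_lim_ge => j _; rewrite lee_fin.
have intF : mu.-integrable torus F.
  apply/integrableP; split => //.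
  under eq_integral do rewrite gee0_abs//.
  rewrite integral_nneseries//; last by move=> j x _; rewrite lee_fin.
  apply: (@le_lt_trans _ _ 2%:E); last by rewrite ltry.
  apply: lime_le; first by apply: is_cvg_nneseries => j _ _; apply: integral_ge0 => x _; rewrite lee_fin.
  apply: nearW => n; rewrite big_mkord.
  apply: (@le_trans _ _ (\sum_(j < n) (2^-1 ^+ j)%:E)%E).
    apply: lee_sum => j _; rewrite /d.
    under eq_integral do rewrite EFinM.
    rewrite sqnormZ ?exprn_ge0//.
    apply: (@le_trans _ _ ((2 ^+ j)%:E * (4^-1 ^+ j)%:E)%E).
      by rewrite lee_wpmul2l// lee_fin exprn_ge0.
    rewrite -EFinM lee_fin -exprMn lerXn2r// ?nnegrE; lra.
  by rewrite sumEFin lee_fin.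
pose A := torus `&` [set x | (F x < +oo)%E].
have mA : measurable A by exact: emeasurable_fun_infty_o.
have AF x : A x -> F x \is a fin_num.
  by move=> [_ /= Fx]; rewrite ge0_fin_numE.
have cvgA (P : R[i] -> R) : (forall z w, P (z - w) = P z - P w) ->
    (forall z, `|P z| <= cabs z) -> forall x, cvgn (fun j => P (s j x) * \1_A x).
  move=> PB Ple x; rewrite indicE; have [Ax|Ax] := pselect (A x); last first.
    rewrite memNset//; under eq_fun do rewrite mulr0; exact: is_cvg_cst.
  rewrite mem_set//; under eq_fun do rewrite mulr1.
  apply: (@cvg_bounded_increments _ (2 + fine (F x))) => n.
  apply: (@le_trans _ _ (\sum_(j < n) (2^-1 ^+ j + d j x))).
    apply: ler_sum => j _; rewrite -PB; apply: (le_trans (Ple _)).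
    rewrite /d; have := cabs_ge0 (s j.+1 x - s j x).
    have : 2^-1 ^+ j * 2 ^+ j = 1 :> R by rewrite -exprMn mulVf// expr1n.
    have : 0 < 2 ^+ j :> R by rewrite exprn_gt0.
    have : 0 < 2^-1 ^+ j :> R by rewrite exprn_gt0// invr_gt0.
    move: (2^-1 ^+ j) (2 ^+ j) (cabs _) => b a c b0 a0 ab c0.
    have : 0 <= b * (a * c - 1) ^+ 2 by rewrite mulr_ge0 ?sqr_ge0// ltW.
    have -> : b * (a * c - 1) ^+ 2 = (b * a) * a * c ^+ 2 - 2 * (b * a) * c + b by ring.
    rewrite ab !mul1r mulr1 => h.
    by lra.
  by rewrite big_split/= lerD ?geo ?sumF//; exact: AF.
have ReB (z w : R[i]) : Re (z - w) = Re z - Re w by rewrite ReD ReN.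
have ImB (z w : R[i]) : Im (z - w) = Im z - Im w by rewrite ImD ImN.
have cvR := cvgA (@complex.Re R) ReB (@normr_Re_le R).
have cvI := cvgA (@complex.Im R) ImB (@normr_Im_le R).
pose g x := Complex (limn (fun j => Re (s j x) * \1_A x))
                    (limn (fun j => Im (s j x) * \1_A x)).
have mcut (P : R[i] -> R) j : measurable_fun torus (fun x => P (s j x)) ->
    measurable_fun torus (fun x => P (s j x) * \1_A x).
  by move=> mP; apply: measurable_funM => //; apply: measurable_funTS; exact: measurable_indic.
exists g.
  split => /=.
    apply: (@measurable_fun_cvg _ _ R torus (fun j x => Re (s j x) * \1_A x)).
      by move=> j; apply: mcut; case: (ms j).
    by move=> x _; exact: cvR.
  apply: (@measurable_fun_cvg _ _ R torus (fun j x => Im (s j x) * \1_A x)).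
    by move=> j; apply: mcut; case: (ms j).
  by move=> x _; exact: cvI.
have := @integrable_ae _ _ R mu torus mT F intF; apply: filterS => x Fx Tx.
have Ax : A x by split => //=; rewrite -ge0_fin_numE// Fx.
have one : \1_A x = 1 :> R by rewrite indicE mem_set.
have part (P : R[i] -> R) : (forall z w, P (z - w) = P z - P w) ->
    cvgn (fun j => P (s j x) * \1_A x) ->
    P (g x) = limn (fun j => P (s j x) * \1_A x) ->
    `|P (s j x - g x)| @[j --> \oo] --> 0.
  have -> : (fun j => P (s j x) * \1_A x) = (fun j => P (s j x)).
    by apply/funext => j; rewrite one mulr1.
  move=> PB cP Pg.
  have -> : 0 = `|P (g x) - P (g x)| :> R by rewrite subrr normr0.
  under eq_fun do rewrite PB.
  apply: cvg_norm; apply: cvgB; last exact: cvg_cst.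
  by rewrite Pg.
apply: (@squeeze_cvgr _ _ _ _ (fun=> 0)
  (fun j => `|Re (s j x - g x)| + `|Im (s j x - g x)|)).
- by apply: nearW => j; rewrite cabs_ge0 cabs_le.
- exact: cvg_cst.
rewrite -[X in _ --> X]addr0; apply: cvgD.
  exact: (part (@complex.Re R) ReB (cvR x) erefl).
exact: (part (@complex.Im R) ImB (cvI x) erefl).
Qed.

End RieszFischer.

Section FourierSeries.
Variable R : realType.
Local Notation mu := (@lebesgue_measure R).
Local Notation Re := complex.Re.
Local Notation Im := complex.Im.
Implicit Types (f g h : R -> R[i]) (c u : int -> R[i]) (r : seq int).
Let mT : measurable (@torus R) := @measurable_torus R.

Lemma ae_sub (P Q : R -> Prop) : (forall x, P x -> Q x) ->
  {ae mu, forall x, P x} -> {ae mu, forall x, Q x}.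
Proof.
move=> PQ [N [mN N0 PN]]; exists N; split => // x nQ.
by apply: PN => Px; exact/nQ/PQ.
Qed.

(** Fatou's lemma along an almost everywhere convergent sequence. *)
Lemma sqnorm_fatou (s : nat -> R -> R[i]) f g (B : \bar R) :
  (forall j, cmeasurable (s j)) -> cmeasurable f -> cmeasurable g ->
  {ae mu, forall x, torus x -> cabs (s j x - g x) @[j --> \oo] --> 0} ->
  (forall j, (sqnorm (fun x => f x - s j x)%R <= B)%E) ->
  (sqnorm (fun x => f x - g x)%R <= B)%E.
Proof.
move=> ms mf mg ae sB.
pose k j x := (cabs (f x - s j x) ^+ 2)%:E : \bar R.
have mk j : measurable_fun torus (k j).
  by apply/measurable_EFinP; apply: measurable_cabs_sqr; exact: cmeasurableB.
have k0 j x : torus x -> (0 <= k j x)%E by rewrite lee_fin sqr_ge0.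
apply: (@le_trans _ _ (\int[mu]_(x in torus) limn_einf (k^~ x))%E).
  apply: ae_ge0_le_integral => //.
  - by move=> x _; rewrite lee_fin sqr_ge0.
  - by apply/measurable_EFinP; apply: measurable_cabs_sqr; exact: cmeasurableB.
  - move=> x Tx; rewrite limn_einf_lim; apply: lime_ge; first exact: is_cvg_einfs.
    apply: nearW => n; apply: le_ereal_inf_tmp => _ [j /= _ <-]; exact: k0.
  - rewrite /limn_einf; apply: measurableT_comp => //.
    apply: (@measurable_fun_limn_esup _ _ _ torus (fun j x => - k j x)%E) => j.
    exact: measurableT_comp.
  apply: ae_sub ae => x sg Tx.
  have kx : k^~ x @ \oo --> (cabs (f x - g x) ^+ 2)%:E.
    have dist j : `|cabs (f x - s j x) - cabs (f x - g x)| <= cabs (s j x - g x).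
      have h1 := cabsD (f x - s j x) (s j x - g x).
      have h2 := cabsD (f x - g x) (g x - s j x).
      rewrite addrA subrK in h1; rewrite addrA subrK -(cabsN (g x - s j x)) opprB in h2.
      by rewrite ler_norml; apply/andP; split; [move: h1|move: h2]; lra.
    have cvgk : cabs (f x - s j x) @[j --> \oo] --> cabs (f x - g x).
      apply: (@squeeze_cvgr _ _ _ _
        (fun j => cabs (f x - g x) - cabs (s j x - g x))
        (fun j => cabs (f x - g x) + cabs (s j x - g x))).
      - apply: nearW => j; have := dist j; rewrite ler_norml => /andP[].
        by move=> *; apply/andP; split; lra.
      - rewrite -[X in _ --> X]subr0; apply: cvgB; [exact: cvg_cst|exact: sg].
      - rewrite -[X in _ --> X]addr0; apply: cvgD; [exact: cvg_cst|exact: sg].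
    apply: cvg_EFin; first by apply: nearW.
    rewrite expr2; under eq_fun do rewrite /k/= expr2.
    exact: cvgM.
  by rewrite (cvg_limn_einf_sup kx).1.
apply: (le_trans (fatou mu mT mk k0)).
rewrite limn_einf_lim; apply: lime_le; first exact: is_cvg_einfs.
apply: nearW => n; apply: le_trans (sB n).
by apply: ereal_inf_lbound; exists n => /=.
Qed.

Definition window (N : nat) : seq int :=
  [seq k%:Z - N%:Z | k <- iota 0 N.*2.+1].

Lemma window_uniq N : uniq (window N).
Proof. by rewrite map_inj_uniq ?iota_uniq// => a b /addIr []. Qed.

Lemma mem_window N (n : int) : (n \in window N) = (`|n| <= N)%N.
Proof.
apply/mapP/idP => [[k]|nN].
  by rewrite mem_iota => kN ->; lia.
exists `|(n + N%:Z)%R|%N; last by lia.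
by rewrite mem_iota; lia.
Qed.

Lemma fourier_partialE u N : fourier_partial u N = trigpoly (window N) u.
Proof.
apply/funext => x; rewrite /fourier_partial /trigpoly big_map; congr (_ * _).
by rewrite -(big_mkord xpredT (fun k => u (k%:Z - N%:Z) * cexp (- ((k%:Z - N%:Z)%:~R * x)))).
Qed.

Definition annulus (N M : nat) : seq int := [seq n <- window M | n \notin window N].

Lemma fourier_partialB u N M x : (N <= M)%N ->
  fourier_partial u M x - fourier_partial u N x = trigpoly (annulus N M) u x.
Proof.
move=> NM; rewrite !fourier_partialE.
have p : perm_eq (window M) (annulus N M ++ window N).
  apply: uniq_perm; first exact: window_uniq.
    rewrite cat_uniq filter_uniq ?window_uniq// andTb andbT.
    by apply/hasPn => n nN; rewrite mem_filter nN.
  move=> n; rewrite mem_cat mem_filter !mem_window.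
  have [nN|nN] := leqP `|n|%N N; last by rewrite orbF.
  by rewrite orbT (leq_trans nN NM).
by rewrite {1}/trigpoly (perm_big _ p) big_cat mulrDr addrK.
Qed.

Lemma ell2_tail u : ell2 u -> forall e : R, 0 < e -> exists N, forall r, uniq r ->
  (forall n, n \in r -> n \notin window N) -> \sum_(n <- r) cabs (u n) ^+ 2 <= e.
Proof.
move=> u2 e e0; pose a n : \bar R := (cabs (u n) ^+ 2)%:E.
have a0 n : (0 <= a n)%E by rewrite lee_fin sqr_ge0.
have E0 : (0 <= \esum_(n in [set: int]) a n)%E by apply: esum_ge0.
have Efin : \esum_(n in [set: int]) a n \is a fin_num by rewrite ge0_fin_numE.
have [y [X [finX _] <-]] := ub_ereal_sup_adherent e0 Efin.
rewrite fsbig_finite//= => Xe.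
pose q : seq int := fset_set X.
exists (\max_(n <- q) `|n|%N)%N => r ur rN.
have uqr : uniq (q ++ r).
  rewrite cat_uniq fset_uniq ur andbT/=; apply/hasPn => n /rN.
  rewrite mem_window -ltnNge => h; apply/negP => nq; move: h.
  by rewrite (big_rem n nq)/= ltnNge leq_maxl.
have := sum_seq_le_esum a uqr; rewrite big_cat/=.
have -> : (\sum_(n <- r) a n)%E = (\sum_(n <- r) cabs (u n) ^+ 2)%:E by rewrite sumEFin.
have Xfin : (\sum_(n <- q) a n)%E = (\sum_(n <- q) cabs (u n) ^+ 2)%:E by rewrite sumEFin.
have [E EE] : exists E, \esum_(n in [set: int]) a n = E%:E.
  by exists (fine (\esum_(n in [set: int]) a n)); rewrite fineK.
have {}Xe : (\esum_(n in [set: int]) a n - e%:E < \sum_(n <- q) a n)%E := Xe.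
move: Xe; rewrite Xfin EE -EFinB lte_fin -EFinD => h1 h2.
by rewrite lee_fin in h2; move: h1 h2; lra.
Qed.

Lemma square_integrable_fourier_partial u N : square_integrable (fourier_partial u N).
Proof. by rewrite fourier_partialE; exact: square_integrable_trigpoly. Qed.

Lemma is_fourierI u g : square_integrable g ->
  (forall e : R, 0 < e -> exists N, forall n, (N <= n)%N ->
     (sqnorm (fun x => fourier_partial u n x - g x)%R <= e%:E)%E) ->
  is_fourier u g.
Proof.
move=> sg close.
have fin n : sqnorm (fun x => fourier_partial u n x - g x) \is a fin_num.
  rewrite ge0_fin_numE; last exact: sqnorm_ge0.
  by case: (square_integrableB (square_integrable_fourier_partial u n) sg).
case: (sg) => -[mg1 mg2] g2; split => //.
apply/fine_cvgP; split; first by apply: nearW => n; exact: fin.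
apply/cvgr0Pnorm_le => e e0; have [N NP] := close e e0.
exists N => // n /= Nn.
rewrite ger0_norm; last by rewrite fine_ge0// sqnorm_ge0.
by rewrite -lee_fin fineK; [exact: NP|exact: fin].
Qed.

(** The Riesz-Fischer theorem: a subsequence of the partial sums has fast
    decreasing increments, hence a limit almost everywhere, which is the limit
    of all partial sums in square mean by Fatou's lemma. *)
Lemma is_fourier_exists u : ell2 u -> exists g, is_fourier u g.
Proof.
move=> u2.
have e4 j : 0 < 4^-1 ^+ j :> R by rewrite exprn_gt0// invr_gt0.
have [T TP] := choice (fun j => ell2_tail u2 (e4 j)).
(* An increasing sequence of indices above the [T j]. *)
pose N j := (\sum_(i < j.+1) (T i).+1)%N.
have NS j : (N j <= N j.+1)%N by rewrite /N [leqRHS]big_ord_recr/= leq_addr.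
have NT j : (T j <= N j)%N.
  by rewrite /N big_ord_recr/= (leq_trans (leqnSn _))// leq_addl.
have Nj j : (j <= N j)%N.
  by elim: j => // j IH; rewrite /N big_ord_recr/= -/(N j) -addn1 leq_add.
have Nmono i j : (i <= j)%N -> (N i <= N j)%N.
  by move=> ij; apply: (@homo_leq _ N leq) => //; exact: leq_trans.
have close j m n : (T j <= m)%N -> (m <= n)%N ->
    (sqnorm (fun x => fourier_partial u n x - fourier_partial u m x)%R
     <= (4^-1 ^+ j)%:E)%E.
  move=> Tm mn; have -> : (fun x => fourier_partial u n x - fourier_partial u m x)
      = trigpoly (annulus m n) u.
    by apply/funext => x; exact: fourier_partialB.
  rewrite sqnorm_trigpoly ?filter_uniq ?window_uniq// lee_fin; apply: TP.
    by rewrite filter_uniq ?window_uniq.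
  move=> k; rewrite mem_filter => /andP[+ _]; apply: contra.
  by rewrite !mem_window => /leq_trans; exact.
pose s j := fourier_partial u (N j).
have ms n : cmeasurable (fourier_partial u n).
  by rewrite fourier_partialE; exact: cmeasurable_trigpoly.
have [|g mg sg] := @ae_limit_of_fast_cauchy R s (fun j => ms (N j)).
  by move=> j; apply: close.
have dist j m : (T j <= m)%N ->
    (sqnorm (fun x => fourier_partial u m x - g x)%R <= (4^-1 ^+ j)%:E)%E.
  move=> Tm; apply: (@sqnorm_fatou (fun i => s (i + m)%N)) => //.
  - by move=> i; exact: ms.
  - apply: ae_sub sg => x sx Tx.
    by have := sx Tx; rewrite -(cvg_shiftn m).
  move=> i; rewrite -sqnormN; under eq_fun do rewrite opprB.
  apply: close => //; apply: (leq_trans _ (Nj _)).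
  by rewrite leq_addl.
have sS n := square_integrable_fourier_partial u n.
have sg2 : square_integrable g.
  have -> : g = (fun x => fourier_partial u (T 0%N) x - (fourier_partial u (T 0%N) x - g x)).
    by apply/funext => x; rewrite subKr.
  apply: square_integrableB => //; split; first exact: cmeasurableB.
  by apply: (le_lt_trans (dist 0%N _ (leqnn _))); rewrite ltry.
exists g; apply: is_fourierI => // e e0.
have [j je] : exists j, 4^-1 ^+ j <= e.
  exists (Num.truncn e^-1).
  have lt4 k : k.+1%:R <= 4 ^+ k :> R.
    elim: k => [|k IH]; first by rewrite expr0.
    rewrite exprS -natr1; have : 1 <= k.+1%:R :> R by rewrite ler1n.
    by move: IH; lra.
  rewrite exprVn -[leRHS]invrK lef_pV2 ?posrE ?invr_gt0 ?exprn_gt0//.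
  by apply: le_trans (lt4 _); apply: ltW; exact: truncnS_gt.
by exists (T j) => n Tn; apply: (le_trans (dist j n Tn)); rewrite lee_fin.
Qed.

Lemma is_fourier_square_integrable u g : is_fourier u g -> square_integrable g.
Proof. by case. Qed.

Lemma is_fourier_close u g (e : R) : is_fourier u g -> 0 < e ->
  exists N, forall n, (N <= n)%N ->
    (sqnorm (fun x => fourier_partial u n x - g x)%R <= e%:E)%E.
Proof.
move=> [_ _ _ h] e0.
have : nbhs (0%E : \bar R) [set y | (y < e%:E)%E].
  by apply: open_nbhs_nbhs; split; [exact: open_ereal_lt_ereal|rewrite /= lte_fin].
move=> /h[N _ NP]; exists N => n Nn; apply: ltW; exact: (NP n Nn).
Qed.

Lemma fourierP u : ell2 u -> is_fourier u (fourier u).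
Proof. by move=> u2; apply: (xgetPex (fun=> 0)); exact: is_fourier_exists. Qed.

(** The partial sums have the right coefficients, and Bessel's inequality bounds
    the error by their distance to [g]. *)
Lemma inv_fourier_is_fourier u g n : is_fourier u g -> inv_fourier g n = u n.
Proof.
move=> ug; have sg := is_fourier_square_integrable ug.
apply/eqP; rewrite -subr_eq0; apply/eqP; apply: Normc.eq0_normc.
apply/eqP; rewrite eq_le cabs_ge0 andbT leNgt; apply/negP => pos.
pose e := cabs (inv_fourier g n - u n) ^+ 2 / 2.
have e0 : 0 < e by rewrite divr_gt0// exprn_gt0.
have [N NP] := is_fourier_close ug e0.
pose m := maxn N `|n|%N.
have sS := square_integrable_fourier_partial u m.
have := @bessel R _ [:: n] (square_integrableB sS sg) isT.
rewrite big_seq1 inv_fourierB// fourier_partialE inv_fourier_trigpoly ?window_uniq//.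
rewrite mem_window leq_maxr => /le_trans.
rewrite -fourier_partialE => /(_ _ (NP m (leq_maxl _ _))).
rewrite lee_fin -cabsN opprB /e => h.
have : 0 < cabs (inv_fourier g n - u n) ^+ 2 by rewrite exprn_gt0.
by move: h; move: (_ ^+ 2) => y; lra.
Qed.

(** One half of Parseval's identity, in the limit along the partial sums: the
    norm of each is a finite part of the right-hand side. *)
Lemma sqnorm_le_esum u g : is_fourier u g ->
  (sqnorm g <= \esum_(n in [set: int]) (cabs (u n) ^+ 2)%:E)%E.
Proof.
move=> ug; have sg := is_fourier_square_integrable ug.
set E := (\esum_(n in _) _)%E.
have E0 : (0 <= E)%E by apply: esum_ge0 => n _; rewrite lee_fin sqr_ge0.
have [->|Efin] := eqVneq E +oo%E; first by rewrite leey.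
have {}Efin : E \is a fin_num by rewrite ge0_fin_numE// ltey.
rewrite -(fineK Efin) (sqnormE sg) lee_fin.
set a := Rintegral _ _ _; set b := fine E.
have b0 : 0 <= b by rewrite fine_ge0.
apply/ler_addgt0Pr => e e0.
(* [|g| ^ 2 <= (1 + t) * |S| ^ 2 + (1 + 1 / t) * |S - g| ^ 2] for the partial sum
   [S]; [t] and then the distance [d] from [S] to [g] cost at most [e / 2] each. *)
pose t := e / (2 * (b + 1)).
have t0 : 0 < t by rewrite divr_gt0// mulr_gt0//; lra.
pose d := e / 2 / (1 + t^-1).
have i0 : 0 < t^-1 by rewrite invr_gt0.
have d0 : 0 < d by rewrite !divr_gt0//; lra.
have [N NP] := is_fourier_close ug d0.
have sS := square_integrable_fourier_partial u N.
have [mg _] := sg; have [mS _] := sS.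
have mD := cmeasurableB mS mg.
have t1 : 0 <= 1 + t by lra.
have t2 : 0 <= 1 + t^-1 by lra.
have h x : torus x -> cabs (g x) ^+ 2 <= (1 + t) * cabs (fourier_partial u N x) ^+ 2
    + (1 + t^-1) * cabs (fourier_partial u N x - g x) ^+ 2.
  move=> _.
  have := cabsD (fourier_partial u N x) (- (fourier_partial u N x - g x)).
  rewrite subKr cabsN.
  have := cabs_ge0 (fourier_partial u N x); have := cabs_ge0 (g x).
  have := cabs_ge0 (fourier_partial u N x - g x).
  move: (cabs (fourier_partial u N x - g x)) (cabs (g x)) (cabs (fourier_partial u N x)).
  move=> w y z w0 y0 z0 yzw.
  apply: (@le_trans _ _ ((z + w) ^+ 2)); first by rewrite ler_sqr ?nnegrE ?addr_ge0.
  have : 0 <= t^-1 * (t * z - w) ^+ 2 by rewrite mulr_ge0 ?sqr_ge0// ltW.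
  have -> : t^-1 * (t * z - w) ^+ 2 = (t^-1 * t) * t * z ^+ 2 - 2 * (t^-1 * t) * z * w
                                      + t^-1 * w ^+ 2 by ring.
  by rewrite mulVf ?gt_eqF// sqrrD; lra.
have K := sqnorm_le_add t1 t2 mS mD mg h.
have S1 : ((1 + t)%:E * sqnorm (fourier_partial u N) <= (1 + t)%:E * b%:E)%E.
  apply: lee_wpmul2l; first by rewrite lee_fin.
  rewrite fourier_partialE sqnorm_trigpoly ?window_uniq// /b fineK//.
  by rewrite -sumEFin; apply: sum_seq_le_esum; exact: window_uniq.
have S2 := lee_wpmul2l (_ : (0 <= (1 + t^-1)%:E)%E) (NP N (leqnn _)).
have {}S2 := S2 t2.
have := le_trans K (leeD S1 S2); rewrite (sqnormE sg) -!EFinM -EFinD lee_fin -/a => H.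
apply: (le_trans H).
have -> : (1 + t^-1) * d = e / 2 by rewrite /d mulrC divfK// gt_eqF//; lra.
have tb : t * (b + 1) = e / 2.
  by rewrite /t invfM mulrA -mulrA mulVf ?mulr1// gt_eqF//; lra.
by move: tb; rewrite mulrDr mulrDl; lra.
Qed.

End FourierSeries.

(** * The energy inequality *)

Section Energy.
Variable R : realType.
Local Notation mu := (@lebesgue_measure R).
Local Notation Re := complex.Re.
Local Notation Im := complex.Im.
Implicit Types (f g h : R -> R[i]) (c u : int -> R[i]) (r : seq int).
Let mT : measurable (@torus R) := @measurable_torus R.

(** Multiplier of the backward difference on the Fourier side. *)
Definition diff_symbol (x : R) : R[i] := 1 - cexp (- x).

Lemma cabs_diff_symbol x : cabs (diff_symbol x) ^+ 2 = 2 * (1 - cos x).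
Proof.
rewrite cabs_sqr /diff_symbol ReD ImD ReN ImN /= cosN sinN.
have := cos2Dsin2 x; lra.
Qed.

Lemma cabs_diff_symbol_le x : cabs (diff_symbol x) <= 2.
Proof.
rewrite -ler_sqr ?nnegrE ?cabs_ge0// cabs_diff_symbol.
by have := cos_geN1 x; lra.
Qed.

Lemma cmeasurable_diff_symbol : cmeasurable diff_symbol.
Proof.
apply: cmeasurableB; first exact: cmeasurable_cst.
by have := cmeasurable_cexp (-1 : R); under eq_fun do rewrite mulN1r.
Qed.

Lemma square_integrable_diff g : square_integrable g ->
  square_integrable (fun x => g x * diff_symbol x).
Proof.
move=> sg; apply: (square_integrableM_bounded sg cmeasurable_diff_symbol).
exact: cabs_diff_symbol_le.
Qed.

Lemma sum_windowS (V : nmodType) (F : int -> V) N :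
  \sum_(n <- window N.+1) F n
    = F N.+1%:Z + F (- N.+1%:Z) + \sum_(n <- window N) F n.
Proof.
have p : perm_eq (window N.+1) [:: N.+1%:Z, - N.+1%:Z & window N].
  apply: uniq_perm; first exact: window_uniq.
    by rewrite 2!cons_uniq in_cons !mem_window window_uniq; lia.
  by move=> n; rewrite mem_window 2!in_cons mem_window; lia.
by rewrite (perm_big _ p) 2!big_cons /= addrA.
Qed.

Lemma sum_window0 (V : nmodType) (F : int -> V) : \sum_(n <- window 0) F n = F 0.
Proof. by rewrite /window/= big_seq1. Qed.

(** Summation by parts for the partial sums, with its two boundary terms. *)
Lemma fourier_partial_diff u N x :
  fourier_partial (fun n => u n - u (n - 1)) N x
    = fourier_partial u N x * diff_symbol x
      + (fnorm R)%:C%C * (u N%:Z * cexp (- ((N%:Z + 1)%:~R * x))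
                        - u (- N%:Z - 1) * cexp (N%:~R * x)).
Proof.
rewrite !fourier_partialE /trigpoly -mulrA -mulrDr; congr (_ * _).
have e1 (n : int) : cexp (- (n%:~R * x)) * cexp (- x) = cexp (- ((n + 1)%:~R * x)) :> R[i].
  by rewrite -cexpD rmorphD/= mulrDl mul1r opprD.
elim: N => [|N IH].
  rewrite !sum_window0 /diff_symbol mulrBr mulr1 -mulrA e1 !mul0r !oppr0 cexp0.
  by ring.
rewrite !sum_windowS IH /diff_symbol !mulrDl.
rewrite !(mulrBr _ 1) !mulr1 -!mulrA !e1.
have -> : N.+1%:Z = N%:Z + 1 by lia.
have -> : N%:Z + 1 - 1 = N%:Z by lia.
have -> : - (N%:Z + 1) - 1 = - N%:Z - 2 by lia.
have -> : - (N%:Z + 1) + 1 = - N%:Z by lia.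
have -> : - (N%:Z + 1) = - N%:Z - 1 by lia.
have cN : cexp (N%:~R * x) = cexp (- ((- N%:Z)%:~R * x)) :> R[i].
  by rewrite rmorphN/= mulNr opprK.
have cN1 : cexp ((N%:Z + 1)%:~R * x) = cexp (- ((- N%:Z - 1)%:~R * x)) :> R[i].
  by rewrite -opprD rmorphN/= mulNr opprK.
rewrite cN cN1; ring.
Qed.

(** The boundary terms of the summation by parts vanish in the limit because [u]
    tends to [0]. *)
Lemma is_fourier_diff u g : ell2 u -> is_fourier u g ->
  is_fourier (fun n => u n - u (n - 1)) (fun x => g x * diff_symbol x).
Proof.
move=> u2 ug; have sg := is_fourier_square_integrable ug.
apply: is_fourierI; first exact: square_integrable_diff.
move=> e e0.
pose e1 := e / 16; have e10 : 0 < e1 by rewrite divr_gt0.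
pose K := 4 * fnorm R ^+ 2 * (2 * pi).
pose e2 := e / (2 * K).
have K0 : 0 < K by rewrite /K !mulr_gt0 ?exprn_gt0 ?fnorm_gt0 ?pi_gt0.
have e20 : 0 < e2 by rewrite divr_gt0// mulr_gt0.
have [N1 N1P] := is_fourier_close ug e10.
have [N2 N2P] := ell2_tail u2 e20.
exists (maxn N1 N2.+1) => N; rewrite geq_max => /andP[NN1 NN2].
have sS := square_integrable_fourier_partial u N.
have sD := square_integrableB sS sg.
pose b x : R[i] := (fnorm R)%:C%C * (u N%:Z * cexp (- ((N%:Z + 1)%:~R * x))
                        - u (- N%:Z - 1) * cexp (N%:~R * x)).
have bE x : cabs (b x) ^+ 2 <= fnorm R ^+ 2 * (2 * e2).
  rewrite /b cabsM exprMn cabs_real ger0_norm ?(ltW (fnorm_gt0 R))//.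
  rewrite ler_wpM2l ?sqr_ge0//.
  apply: (le_trans (cabs_sqr_add_le _ _)); rewrite cabsN !cabsM !cabs_cexp !mulr1.
  have := N2P [:: N%:Z; - N%:Z - 1]; rewrite big_cons big_seq1 => h.
  rewrite -mulrDr ler_pM2l//; apply: h; first by rewrite /= inE; lia.
  move=> n nr; rewrite mem_window; move: nr.
  by rewrite !inE => /orP[/eqP->|/eqP->]; lia.
have mb : cmeasurable b.
  apply: cmeasurableM; first exact: cmeasurable_cst.
  apply: cmeasurableB; apply: cmeasurableM; try exact: cmeasurable_cst.
    by under eq_fun do rewrite -mulNr; exact: cmeasurable_cexp.
  exact: cmeasurable_cexp.
have c1 : 0 <= 8 :> R by [].
have c2 : 0 <= 2 :> R by [].
have [mD _] := sD.
have mL : cmeasurable (fun x => fourier_partial (fun n => u n - u (n - 1)) N x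
                                - g x * diff_symbol x).
  apply: cmeasurableB; last by case: (square_integrable_diff sg).
  by rewrite fourier_partialE; exact: cmeasurable_trigpoly.
apply: (le_trans (sqnorm_le_add c1 c2 mD mb mL _)).
  move=> x _; rewrite fourier_partial_diff -/(b x).
  have -> : fourier_partial u N x * diff_symbol x + b x - g x * diff_symbol x
          = (fourier_partial u N x - g x) * diff_symbol x + b x by ring.
  apply: (le_trans (cabs_sqr_add_le _ _)); rewrite lerD2r cabsM exprMn.
  have : cabs (diff_symbol x) ^+ 2 <= 4.
    by rewrite cabs_diff_symbol; have := cos_geN1 x; lra.
  have := sqr_ge0 (cabs (fourier_partial u N x - g x)).
  by move: (_ ^+ 2) (_ ^+ 2) => s t; nra.
have sb : (sqnorm b <= (fnorm R ^+ 2 * (2 * e2) * (2 * pi))%:E)%E.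
  apply: (@le_trans _ _ (\int[mu]_(x in torus) (fnorm R ^+ 2 * (2 * e2))%:E)%E).
    apply: ge0_le_integral => //.
    - by move=> x _; rewrite lee_fin sqr_ge0.
    - by apply/measurable_EFinP; exact: measurable_cabs_sqr.
    - by move=> x _; rewrite lee_fin.
  by rewrite integral_cst//= lebesgue_measure_torus -EFinM.
have l1 : (8%:E * sqnorm (fun x => fourier_partial u N x - g x)%R <= 8%:E * e1%:E)%E.
  by apply: lee_wpmul2l; [rewrite lee_fin|exact: N1P].
have l2 : (2%:E * sqnorm b <= 2%:E * (fnorm R ^+ 2 * (2 * e2) * (2 * pi))%:E)%E.
  by apply: lee_wpmul2l; rewrite ?lee_fin.
apply: (le_trans (leeD l1 l2)); rewrite -!EFinM -EFinD lee_fin.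
have -> : 2 * (fnorm R ^+ 2 * (2 * e2) * (2 * pi)) = K * e2 by rewrite /K; ring.
have -> : K * e2 = e / 2 by rewrite /e2; field; rewrite gt_eqF.
by rewrite /e1; lra.
Qed.

End Energy.

Section EnergyRearrangement.
Variable R : realType.
Local Notation mu := (@lebesgue_measure R).
Local Notation Re := complex.Re.
Local Notation Im := complex.Im.
Implicit Types (f g h : R -> R[i]) (c u : int -> R[i]) (r : seq int).
Let mT : measurable (@torus R) := @measurable_torus R.

Lemma cmeasurable_real (k : R -> R) : measurable_fun torus k ->
  cmeasurable (fun x => (k x)%:C%C).
Proof. by move=> mk; split => //=; exact: measurable_cst. Qed.

Section OneFunction.
Variable g : R -> R[i].
Hypothesis sg : square_integrable g.

Let phi x := cabs (g x).
Let G := sym_rearr g.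
Let rg x : R[i] := (G x)%:C%C.

Lemma is_sym_rearr_cabs : is_sym_rearr phi G.
Proof. by apply: sym_rearrP; apply: measurable_cabs; case: sg. Qed.

Let mphi : measurable_fun torus phi.
Proof. by apply: measurable_cabs; case: sg. Qed.

Lemma sqnorm_rearr : sqnorm rg = sqnorm g.
Proof.
have mF : measurable_fun setT (fun y : R => (y ^+ 2)%:E).
  by apply/measurable_EFinP; exact: exprn_measurable.
have F0 (y : R) : (0 <= (y ^+ 2)%:E)%E by rewrite lee_fin sqr_ge0.
have := sym_rearr_integral mphi is_sym_rearr_cabs (fun x => cabs_ge0 (g x)) mF F0.
rewrite /sqnorm => ->; apply: eq_integral => x _.
by rewrite /rg cabs_real real_normK ?num_real.
Qed.

Lemma square_integrable_rearr : square_integrable rg.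
Proof.
split; last by rewrite sqnorm_rearr; case: sg.
apply: cmeasurable_real; apply: measurable_funTS.
exact: (measurable_sym_rearr is_sym_rearr_cabs).
Qed.

(** The multiplier has squared modulus [2 - 2 * cos x = 4 - 2 * (1 + cos x)].  The
    norms of both functions are equal, so the claim is that rearranging increases
    the integral against the weight [1 + cos], which decreases with [`|x|]. *)
Lemma sqnorm_diff_rearr :
  (sqnorm (fun x => rg x * diff_symbol x)%R <= sqnorm (fun x => g x * diff_symbol x)%R)%E.
Proof.
have lin (a b w w' q : R) : a + 2 * w = 4 * q -> b + 2 * w' = 4 * q -> w <= w' -> b <= a.
  by lra.
pose W (h : R -> R[i]) := (\int[mu]_(x in torus) (cabs (h x) ^+ 2 * (1 + cos x))%:E)%E.
have cos0 x : 0 <= 1 + cos x :> R by have := cos_geN1 x; lra.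
have WE h : square_integrable h ->
    (sqnorm (fun x => h x * diff_symbol x)%R + 2%:E * W h = 4%:E * sqnorm h)%E.
  move=> [mh _].
  have mcos : measurable_fun torus (fun x : R => 1 + cos x).
    apply: measurable_funD => //; apply: measurable_funTS.
    by apply: continuous_measurable_fun; exact: continuous_cos.
  have m1 : measurable_fun torus (fun x => (cabs (h x * diff_symbol x) ^+ 2)%:E).
    apply/measurable_EFinP; apply: measurable_cabs_sqr.
    exact: (cmeasurableM mh (cmeasurable_diff_symbol R)).
  have mW : measurable_fun torus (fun x => (cabs (h x) ^+ 2 * (1 + cos x))%:E).
    by apply/measurable_EFinP; apply: measurable_funM => //; exact: measurable_cabs_sqr.
  have W0 x : torus x -> (0 <= (cabs (h x) ^+ 2 * (1 + cos x))%:E)%E.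
    by rewrite lee_fin mulr_ge0 ?sqr_ge0.
  have m2W : measurable_fun torus (fun x => 2%:E * (cabs (h x) ^+ 2 * (1 + cos x))%:E)%E.
    exact: emeasurable_funM.
  have W20 x : torus x -> (0 <= 2%:E * (cabs (h x) ^+ 2 * (1 + cos x))%:E)%E.
    by move=> Tx; rewrite mule_ge0// W0.
  have h0 x : torus x -> (0 <= (cabs (h x * diff_symbol x) ^+ 2)%:E)%E.
    by rewrite lee_fin sqr_ge0.
  rewrite -sqnormZ// /W -ge0_integralZl//.
  rewrite /sqnorm -(ge0_integralD mu mT h0 m1 W20 m2W); apply: eq_integral => x _.
  rewrite -!EFinM -EFinD cabsM exprMn cabs_diff_symbol; congr (_%:E); ring.
have fin h : square_integrable h -> sqnorm h \is a fin_num.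
  by move=> [_ h2]; rewrite ge0_fin_numE// sqnorm_ge0.
have Wle : (W g <= W rg)%E.
  have := integral_cos_le_sym_rearr mphi (fun x => cabs_ge0 (g x)) is_sym_rearr_cabs.
  rewrite /W; congr (_ <= _)%E; apply: eq_integral => x _.
  by rewrite /rg cabs_real real_normK ?num_real.
have finD h : square_integrable h ->
    sqnorm (fun x => h x * diff_symbol x)%R \is a fin_num.
  by move=> sh; apply: fin; exact: square_integrable_diff.
have W0 h : (0 <= W h)%E.
  by apply: integral_ge0 => x _; rewrite lee_fin mulr_ge0 ?sqr_ge0.
have finW h : square_integrable h -> W h \is a fin_num.
  move=> sh; have E := WE h sh; rewrite ge0_fin_numE// ltey; apply/eqP => WT.
  move: E; rewrite WT mulry/= gtr0_sg// mul1e addey; last first.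
    by move: (finD h sh); case: (sqnorm _).
  by move=> E; have := fin h sh; rewrite -(fineK (fin h sh)) in E *.
have Eg := WE g sg; have Er := WE rg square_integrable_rearr.
rewrite sqnorm_rearr in Er.
have real (y : \bar R) : y \is a fin_num -> exists t, y = t%:E.
  by move=> yf; exists (fine y); rewrite fineK.
have [q qE] := real _ (fin _ sg).
have [a aE] := real _ (finD _ sg).
have [b bE] := real _ (finD _ square_integrable_rearr).
have [w wE] := real _ (finW _ sg).
have [w' w'E] := real _ (finW _ square_integrable_rearr).
move: Eg Er Wle; rewrite qE aE bE wE w'E -!EFinM -!EFinD => -[e1] -[e2].
by rewrite !lee_fin; exact: lin e1 e2.
Qed.

Lemma inv_fourier_diff h n : square_integrable h ->
  inv_fourier (fun x => h x * diff_symbol x) n = inv_fourier h n - inv_fourier h (n - 1).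
Proof.
move=> sh; rewrite !inv_fourierE -mulrBr.
have ie m : cintegrable (fun x => h x * cexp (m%:~R * x)).
  by apply: cintegrableM => //; exact: square_integrable_cexp.
have -> : (fun x => h x * diff_symbol x * cexp (n%:~R * x))
    = (fun x => h x * cexp (n%:~R * x) + (-1) * (h x * cexp ((n - 1)%:~R * x))).
  apply/funext => x.
  have -> : (n - 1)%:~R * x = n%:~R * x + (- x) by rewrite rmorphB/=; ring.
  by rewrite cexpD /diff_symbol; ring.
by rewrite cintD ?cintZ ?mulN1r//; apply: cintegrableZ.
Qed.

Lemma inv_fourier_real_conj n :
  cabs (inv_fourier rg (- n)) = cabs (inv_fourier rg n).
Proof.
rewrite !inv_fourierE !cabsM; congr (_ * _).
have cc (z : R[i]) : cabs (conjc z) = cabs z by case: z => a b; rewrite /= sqrrN.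
rewrite -[RHS]cc; congr cabs; apply: complex_eq => /=.
  apply: eq_Rintegral => x _; rewrite !mul0r !subr0.
  by rewrite rmorphN/= mulNr cosN.
rewrite -mulN1r -RintegralZl//.
  apply: eq_Rintegral => x _; rewrite !mul0r !addr0.
  by rewrite rmorphN/= mulNr sinN; ring.
by have [] := cintegrableM square_integrable_rearr (square_integrable_cexp n%:~R).
Qed.

End OneFunction.

End EnergyRearrangement.

Section SequenceRearrangement.
Variables (R : realType) (u : int -> R[i]).
Hypothesis u2 : ell2 u.

Let g := fourier u.
Let sg : square_integrable g := is_fourier_square_integrable (fourierP u2).
Let ush := fourier_rearr u.
Let f (k : nat) := ush k%:Z.
Let v := decr_rearr f.

(** The restriction to [nat] vanishes at infinity, by Bessel's inequality. *)
Lemma decr_rearr_fourier_rearr : is_decr_rearr (fun k => cabs (f k)) v.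
Proof.
apply: decr_rearrP => t t0; apply: contrapT => infA.
pose q := fine (sqnorm g).
have qE : sqnorm g = q%:E.
  by rewrite /q fineK// ge0_fin_numE ?sqnorm_ge0//; case: sg.
have [B BA nB] := infinite_set_fset (Num.truncn (q / t ^+ 2)).+1 infA.
have uB : uniq [seq k%:Z | k <- B : seq nat] by rewrite map_inj_uniq ?fset_uniq// => a b [].
have := bessel (square_integrable_rearr sg) uB.
rewrite (sqnorm_rearr sg) qE lee_fin big_map.
apply/negP; rewrite -ltNge.
apply: (@lt_le_trans _ _ (\sum_(k <- B) t ^+ 2)).
  rewrite big_const_seq count_predT iter_addr addr0 -mulr_natl.
  rewrite -ltr_pdivrMr ?exprn_gt0//; apply: (lt_le_trans (truncnS_gt _)).
  by rewrite ler_nat.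
rewrite big_seq [leRHS]big_seq; apply: ler_sum => k kB.
rewrite ler_sqr ?nnegrE ?cabs_ge0 ?(ltW t0)//; apply: ltW.
by have := BA k kB.
Qed.

(** The differences of an even sequence at [k + 1] and at [- k] are taken across
    mirror edges, so that a sum over these indices is twice a sum over [k]. *)
Let edges M : seq int :=
  [seq k.+1%:Z | k <- iota 0 M] ++ [seq - k%:Z | k <- iota 0 M].

Let edges_uniq M : uniq (edges M).
Proof.
rewrite cat_uniq !map_inj_uniq ?iota_uniq//=; [|by move=> a b /oppr_inj []|by move=> a b []].
rewrite andbT; apply/hasPn => n /mapP[k _ ->]; apply/negP => /mapP[k' _ /eqP]; lia.
Qed.

Let mem_edges M (n : int) : (`|n| < M)%N -> n \in edges M.
Proof.
move=> nM; rewrite mem_cat; apply/orP.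
have [n0|n0] := leP n 0; [right|left]; apply/mapP.
  by exists `|n|%N; [rewrite mem_iota; lia|lia].
by exists `|n|.-1%N; [rewrite mem_iota; lia|lia].
Qed.

Let sum_edges M (F : int -> R) :
  \sum_(n <- edges M) F n = \sum_(k < M) (F k.+1%:Z + F (- k%:Z)).
Proof.
rewrite big_cat !big_map/= big_split/=; congr (_ + _).
  by rewrite -(big_mkord xpredT (fun k => F k.+1%:Z)) /index_iota subn0.
by rewrite -(big_mkord xpredT (fun k => F (- k%:Z))) /index_iota subn0.
Qed.

(** The energy decreases twice.  On the Fourier side it is a weighted norm, which
    decreases from [u] to the Fourier rearrangement.  The moduli of the latter
    are even, and each half-line contributes less after sorting, by the
    Polya-Szego inequality; the edges on both sides add up to the energy. *)
Lemma energy_sym_decr_rearr :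
  (\esum_(n in [set: int])
      ((`|sym_decr_rearr u n - sym_decr_rearr u (n - 1)| ^+ 2)%R)%:E
   <= \esum_(n in [set: int]) ((cabs (u n - u (n - 1)) ^+ 2)%R)%:E)%E.
Proof.
pose F n : R := `|sym_decr_rearr u n - sym_decr_rearr u (n - 1)| ^+ 2.
apply: esum_le_sum_seq => r ur; rewrite sumEFin.
pose M := (\max_(n <- r) `|n|%N)%N.+1.
have rM : {subset r <= edges M}.
  by move=> n nr; apply: mem_edges; rewrite /M ltnS (big_rem n nr)/= leq_maxl.
have rle : \sum_(n <- r) F n <= \sum_(n <- edges M) F n.
  have p : perm_eq r [seq n <- edges M | n \in r].
    apply: uniq_perm => //; first by rewrite filter_uniq ?edges_uniq.
    by move=> n; rewrite mem_filter; case: (boolP (n \in r)) => //= /rM ->.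
  rewrite (perm_big _ p) big_filter big_mkcond; apply: ler_sum => n _.
  by case: ifP => // _; rewrite sqr_ge0.
have FE k : F k.+1%:Z + F (- k%:Z) = 2 * (v k - v k.+1) ^+ 2.
  rewrite /F /sym_decr_rearr -/f -/v.
  have -> : `|k.+1%:Z|%N = k.+1 by [].
  have -> : `|(k.+1%:Z - 1)%R|%N = k by lia.
  have -> : `|(- k%:Z)%R|%N = k by lia.
  have -> : `|(- k%:Z - 1)%R|%N = k.+1 by lia.
  by rewrite !real_normK ?num_real//; ring.
have [M' HM'] := polya_szego_nat decr_rearr_fourier_rearr (fun k => cabs_ge0 _) M.
have sD := square_integrable_diff (square_integrable_rearr sg).
have := bessel sD (edges_uniq M') => H.
apply: (@le_trans _ _ (\sum_(n <- edges M') cabs (ush n - ush (n - 1)) ^+ 2)%:E).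
  rewrite lee_fin; apply: (le_trans rle); rewrite !sum_edges.
  under eq_bigr do rewrite FE.
  rewrite -mulr_sumr; apply: (@le_trans _ _
    (2 * \sum_(m < M') (cabs (f m) - cabs (f m.+1)) ^+ 2)); first by rewrite ler_pM2l.
  rewrite mulr_sumr; apply: ler_sum => k _.
  have sym n : cabs (ush (- n)) = cabs (ush n) by exact: inv_fourier_real_conj.
  have dist z w : (cabs z - cabs w) ^+ 2 <= cabs (z - w) ^+ 2 :> R.
    rewrite -[leLHS]real_normK ?num_real// ler_sqr ?nnegrE ?cabs_ge0//.
    rewrite ler_norml; apply/andP; split.
      by have := cabsD (w - z) z; rewrite subrK -(cabsN (w - z)) opprB; lra.
    by have := cabsD (z - w) w; rewrite subrK; lra.
  have e1 : k.+1%:Z - 1 = k%:Z by lia.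
  have e2 : - k%:Z - 1 = - k.+1%:Z by lia.
  have d1 : (cabs (f k.+1) - cabs (f k)) ^+ 2
      <= cabs (ush k.+1%:Z - ush (k.+1%:Z - 1)) ^+ 2 by rewrite e1; exact: dist.
  have d2 : (cabs (f k) - cabs (f k.+1)) ^+ 2
      <= cabs (ush (- k%:Z) - ush (- k%:Z - 1)) ^+ 2.
    by rewrite e2 /f -sym -(sym k.+1%:Z); exact: dist.
  rewrite mulr_natl mulr2n; apply: lerD d2; apply: le_trans d1.
  by rewrite -[leLHS]sqrrN opprB.
apply: le_trans (sqnorm_le_esum (is_fourier_diff u2 (fourierP u2))).
apply: le_trans (sqnorm_diff_rearr sg).
apply: le_trans H; rewrite lee_fin le_eqVlt; apply/orP; left; apply/eqP.
apply: eq_bigr => n _; congr (cabs _ ^+ 2).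
by rewrite inv_fourier_diff//; exact: square_integrable_rearr.
Qed.

End SequenceRearrangement.

(** * Masses of a decreasing function near the origin *)

Section IntegralsOfReals.
Variable R : realType.
Local Notation mu := (@lebesgue_measure R).
Implicit Types (A B : set R) (F : R -> R).

Lemma ge0_le_integral_EFin A F1 F2 : measurable A ->
  measurable_fun setT F1 -> measurable_fun setT F2 ->
  (forall x, 0 <= F1 x) -> (forall x, A x -> F1 x <= F2 x) ->
  (\int[mu]_(x in A) (F1 x)%:E <= \int[mu]_(x in A) (F2 x)%:E)%E.
Proof.
move=> mA m1 m2 F0 F12; apply: ge0_le_integral => //.
- by move=> x _; rewrite lee_fin.
- by apply: measurable_funTS; apply/measurable_EFinP.
- by apply: measurable_funTS; apply/measurable_EFinP.
Qed.

Lemma ge0_subset_integral_EFin A B F : measurable A -> measurable B ->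
  measurable_fun setT F -> (forall x, 0 <= F x) -> A `<=` B ->
  (\int[mu]_(x in A) (F x)%:E <= \int[mu]_(x in B) (F x)%:E)%E.
Proof.
move=> mA mB mF F0 AB; apply: ge0_subset_integral => //.
- by apply: measurable_funTS; apply/measurable_EFinP.
- by move=> x _; rewrite lee_fin.
Qed.

Lemma integral_setD1_EFin A F (a : R) : measurable A -> measurable_fun setT F ->
  (\int[mu]_(x in A `\ a) (F x)%:E = \int[mu]_(x in A) (F x)%:E)%E.
Proof.
move=> mA mF; apply: integral_setD1; first exact: measurableD.
by apply: measurable_funTS; apply/measurable_EFinP.
Qed.

Lemma ge0_integral_setU_EFin A B F : measurable A -> measurable B ->
  measurable_fun setT F -> (forall x, 0 <= F x) -> (forall x, A x -> ~ B x) ->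
  (\int[mu]_(x in A `|` B) (F x)%:E
   = \int[mu]_(x in A) (F x)%:E + \int[mu]_(x in B) (F x)%:E)%E.
Proof.
move=> mA mB mF F0 AB.
have mE : measurable_fun (A `|` B) (fun x => (F x)%:E).
  by apply: measurable_funTS; apply/measurable_EFinP.
have E0 x : (A `|` B) x -> (0 <= (F x)%:E)%E by rewrite lee_fin.
have dAB : [disjoint A & B] by apply/disj_setPS => x [Ax Bx]; exact: (AB x Ax Bx).
by rewrite ge0_integral_setU.
Qed.

Lemma measurable_indic_le F (L : R) : measurable_fun setT F ->
  measurable_fun setT (fun x => (F x <= L)%R%:R : R).
Proof.
move=> mF; have -> : (fun x => (F x <= L)%R%:R) = \1_[set x | F x <= L] :> (R -> R).
  apply/funext => x; rewrite indicE.
  suff -> : (x \in [set x | F x <= L]) = (F x <= L) by [].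
  by apply/idP/idP; rewrite inE.
apply: measurable_indic.
have := measurable_fun_ler mF (measurable_cst L) measurableT (I : measurable [set true]).
by rewrite setTI; congr measurable; apply/seteqP; split => x.
Qed.

Lemma measurable_indic_lt F (L : R) : measurable_fun setT F ->
  measurable_fun setT (fun x => (L < F x)%R%:R : R).
Proof.
move=> mF; have -> : (fun x => (L < F x)%R%:R) = \1_[set x | L < F x] :> (R -> R).
  apply/funext => x; rewrite indicE.
  suff -> : (x \in [set x | L < F x]) = (L < F x) by [].
  by apply/idP/idP; rewrite inE.
apply: measurable_indic.
have := measurable_fun_ltr (measurable_cst L) mF measurableT (I : measurable [set true]).
by rewrite setTI; congr measurable; apply/seteqP; split => x.
Qed.

End IntegralsOfReals.

Section CenteredMass.
Variables (R : realType) (G : R -> R).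
Local Notation mu := (@lebesgue_measure R).
Hypothesis mG : measurable_fun setT G.
Hypothesis G0 : forall x, 0 <= G x.
Hypothesis Gdecr : forall x y, x != 0 -> `|x| <= `|y| -> G y <= G x.
Hypothesis iG : mu.-integrable torus (EFin \o G).
Let mT : measurable (@torus R) := @measurable_torus R.

Definition centered (r : R) : set R := `]- r, r[%classic.

Lemma measurable_centered r : measurable (centered r).
Proof. exact: measurable_itv. Qed.

Lemma in_centered r x : centered r x <-> `|x| < r.
Proof. by rewrite /centered/= in_itv/= ltr_norml. Qed.

Lemma centered_torus r : r <= pi -> centered r `<=` torus.
Proof.
move=> rpi x /in_centered xr; rewrite /torus/= in_itv/= -ltr_norml.
exact: lt_le_trans rpi.
Qed.

Lemma lebesgue_measure_centered r : 0 <= r -> mu (centered r) = (2 * r)%:E.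
Proof.
move=> r0; rewrite lebesgue_measure_itv/= lte_fin; case: ltP => h.
  by rewrite -EFinD opprK; congr (_%:E); lra.
by congr (_%:E); lra.
Qed.

Definition mass (r : R) : R := \int[mu]_(x in centered r) G x.

Lemma massE r : r <= pi -> (\int[mu]_(x in centered r) (G x)%:E = (mass r)%:E)%E.
Proof.
move=> rpi; rewrite /mass /Rintegral fineK//.
have mc := measurable_centered r.
rewrite ge0_fin_numE; last by apply: integral_ge0 => x _; rewrite lee_fin.
have := ge0_subset_integral_EFin mc mT mG G0 (centered_torus rpi).
move=> /le_lt_trans; apply; move/integrableP : iG => [_]; apply: le_lt_trans.
rewrite le_eqVlt; apply/orP; left; apply/eqP; apply: eq_integral => x _.
by rewrite /= ger0_norm.
Qed.

Lemma mass_ge0 r : 0 <= mass r.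
Proof. exact: Rintegral_ge0. Qed.

Lemma mass_le r s : r <= s -> s <= pi -> mass r <= mass s.
Proof.
move=> rs spi; rewrite -lee_fin -!massE//; last exact: le_trans rs spi.
have mc := measurable_centered.
apply: ge0_subset_integral_EFin => // x /in_centered xr; apply/in_centered.
exact: lt_le_trans xr rs.
Qed.

Lemma le_mass r : 0 < r -> r <= pi -> 2 * r * G r <= mass r.
Proof.
move=> r0 rpi; rewrite -lee_fin -massE//.
have mc := measurable_centered r.
have mc0 : measurable (centered r `\ 0) by exact: measurableD.
have -> : (2 * r * G r)%:E = (\int[mu]_(x in centered r) (G r)%:E)%E.
  by rewrite integral_cst//= lebesgue_measure_centered ?(ltW r0)// -EFinM mulrC.
rewrite -(@integral_setD1_EFin _ _ (cst (G r)) 0)// -[leRHS](@integral_setD1_EFin _ _ G 0)//.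
apply: ge0_le_integral_EFin => //; first by move=> x; exact: G0.
move=> x [/in_centered xr /= x0].
by apply: Gdecr; [exact/eqP|rewrite (gtr0_norm r0) ltW].
Qed.

Lemma lebesgue_measure_ring r s : 0 <= r -> r <= s ->
  mu (centered s `\` centered r) = (2 * (s - r))%:E.
Proof.
move=> r0 rs; have s0 := le_trans r0 rs.
rewrite measureD; try exact: measurable_centered; last first.
  by rewrite /= lebesgue_measure_centered// ltry.
rewrite setIidr; last first.
  by move=> x /in_centered xr; apply/in_centered; exact: lt_le_trans xr rs.
rewrite /= !lebesgue_measure_centered// -EFinB; congr (_%:E); lra.
Qed.

Lemma integral_far_le (F : R -> R) (A : set R) r :
  0 < r -> measurable A -> measurable_fun setT F ->
  (forall x, 0 <= x -> 0 <= F x) -> (forall x y, 0 <= x -> x <= y -> F x <= F y) ->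
  (forall x, A x -> r <= `|x|) ->
  (\int[mu]_(x in A) (F (G x))%:E <= (F (G r))%:E * mu A)%E.
Proof.
move=> r0 mA mF F0 Fmono Ar; rewrite -integral_cst//.
apply: (@ge0_le_integral_EFin _ _ (F \o G) (cst (F (G r)))) => //.
- exact: measurableT_comp.
- by move=> x /=; apply: F0.
move=> x Ax /=; apply: Fmono => //.
by apply: Gdecr; rewrite ?gt_eqF// (gtr0_norm r0) Ar.
Qed.

Let ring_far r s x : (centered s `\` centered r) x -> r <= `|x|.
Proof. by move=> [_ /in_centered/negP]; rewrite -leNgt. Qed.

Lemma measurable_ring r s : measurable (centered s `\` centered r).
Proof. by apply: measurableD; exact: measurable_centered. Qed.

Lemma centered_split (F : R -> R) r s : r <= s -> measurable_fun setT F ->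
  (forall x, 0 <= F x) ->
  (\int[mu]_(x in centered s) (F x)%:E
   = \int[mu]_(x in centered r) (F x)%:E
     + \int[mu]_(x in centered s `\` centered r) (F x)%:E)%E.
Proof.
move=> rs mF F0; have mc := measurable_centered; have mr := measurable_ring.
rewrite -ge0_integral_setU_EFin//; last by move=> x xr [].
rewrite setDUK// => x /in_centered xr; apply/in_centered.
exact: lt_le_trans xr rs.
Qed.

(** On the ring added to the interval [G] is at most [G r], hence at most the mean
    on the smaller interval. *)
Lemma mass_le_ratio r s : 0 < r -> r <= s -> s <= pi -> r * mass s <= s * mass r.
Proof.
move=> r0 rs spi; have rpi := le_trans rs spi.
have H : mass s <= mass r + G r * (2 * (s - r)).
  rewrite -lee_fin EFinD -!massE// (centered_split rs mG G0) leeD2l//.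
  rewrite EFinM -(lebesgue_measure_ring (ltW r0) rs).
  apply: (@integral_far_le id) => //; first exact: measurable_ring.
  exact: ring_far.
have := le_mass r0 rpi; move: H.
have : 0 <= s - r by rewrite subr_ge0.
by move: (mass s) (mass r) (G r) => a b c; nra.
Qed.

Let rad (m : nat) : R := m.+1%:R^-1.
Let rad0 m : 0 < rad m. Proof. by rewrite invr_gt0. Qed.
Let rad_le m n : (m <= n)%N -> rad n <= rad m.
Proof. by move=> mn; rewrite lef_pV2 ?posrE ?ltr0n// ler_nat. Qed.
Let rad1 m : rad m <= 1. Proof. by rewrite invf_le1 ?ltr0n// ler1n. Qed.
Let pi1 : 1 <= pi :> R. Proof. by have := pi_ge2 R; lra. Qed.
Let pi4 : pi <= 4 :> R. Proof. by have /andP[_] := @pihalf_02 R; lra. Qed.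
Let rad_pi m : rad m <= pi. Proof. exact: le_trans (rad1 m) pi1. Qed.

(** The radius [1 / (m + 1)] is the scale at which [m + 1] Fourier coefficients see
    a function. *)
Definition masses (m : nat) : R := mass m.+1%:R^-1.

Lemma masses_ge0 m : 0 <= masses m. Proof. exact: mass_ge0. Qed.

Lemma masses_le m n : (m <= n)%N -> masses n <= masses m.
Proof. by move=> mn; apply: mass_le; [exact: rad_le|exact: rad_pi]. Qed.

Lemma masses_doubling m : masses m <= 2 * masses m.+1.
Proof.
have := mass_le_ratio (rad0 m.+1) (rad_le (leqnSn m)) (rad_pi m).
rewrite /rad -/(masses _) -/(masses _) => h.
have m0 : 0 < m.+1%:R :> R by rewrite ltr0n.
have : m.+2%:R <= 2 * m.+1%:R :> R by rewrite -natrM ler_nat; lia.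
move=> b2a; move: h; rewrite ler_pdivrMl ?ltr0n// mulrA => /le_trans; apply.
by rewrite ler_wpM2r ?masses_ge0// ler_pdivrMr.
Qed.

Lemma integral_torus_le_masses : (\int[mu]_(x in torus) (G x)%:E <= (4 * masses 0)%:E)%E.
Proof.
rewrite -/(centered pi) massE// lee_fin /masses invr1.
have := mass_le_ratio ltr01 pi1 (lexx _); rewrite mul1r => /le_trans; apply.
by rewrite ler_wpM2r ?mass_ge0.
Qed.

Lemma level_le_masses m : G (rad m) <= m.+1%:R / 2 * masses m.
Proof.
have h : 2 * rad m * G (rad m) <= masses m := le_mass (rad0 m) (rad_pi m).
have m0 : 0 < m.+1%:R :> R by rewrite ltr0n.
have E : G (rad m) = m.+1%:R / 2 * (2 * rad m * G (rad m)).
  by rewrite /rad; field; rewrite nat1r gt_eqF.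
by rewrite E ler_pM2l ?divr_gt0.
Qed.

Let sqrF : measurable_fun setT (fun y : R => y ^+ 2).
Proof. exact: exprn_measurable. Qed.

Let sqr_mono (x y : R) : 0 <= x -> x <= y -> x ^+ 2 <= y ^+ 2.
Proof. by move=> x0 xy; rewrite ler_sqr ?nnegrE// (le_trans x0). Qed.

(** On the ring between the radii [1 / (m + 2)] and [1 / (m + 1)], [G] is at most
    its value at the inner radius, hence at most a multiple of [masses (m + 1)]. *)
Lemma integral_outside_le m :
  (\int[mu]_(x in torus `\` centered (rad m)) (G x ^+ 2)%:E
   <= (2 * \sum_(j < m.+1) masses j ^+ 2)%:E)%E.
Proof.
have lev n : G (rad n) ^+ 2 <= (n.+1%:R / 2 * masses n) ^+ 2.
  by apply: sqr_mono => //; exact: level_le_masses.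
rewrite -/(centered pi); elim: m => [|m IH].
  have -> : rad 0 = 1 by rewrite /rad invr1.
  apply: (le_trans (@integral_far_le (fun y => y ^+ 2) _ 1 ltr01 (measurable_ring _ _)
    sqrF (fun _ _ => sqr_ge0 _) sqr_mono (@ring_far _ _))).
  rewrite lebesgue_measure_ring// -EFinM lee_fin big_ord1.
  have := lev 0%N; rewrite /rad invr1 => h.
  have p4 := pi4; have s0 := sqr_ge0 (masses 0).
  have h' : G 1 ^+ 2 <= masses 0 ^+ 2 / 4 by apply: (le_trans h); lra.
  apply: (@le_trans _ _ (masses 0 ^+ 2 / 4 * (2 * (pi - 1)))).
    by rewrite ler_wpM2r// mulr_ge0// subr_ge0.
  by nra.
have rS : rad m.+1 <= rad m by exact: rad_le.
have mr := measurable_ring.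
have -> : centered pi `\` centered (rad m.+1)
    = (centered pi `\` centered (rad m)) `|` (centered (rad m) `\` centered (rad m.+1)).
  apply/seteqP; split => x.
    move=> [xpi xn]; have [xm|xm] := pselect (centered (rad m) x); by [right|left].
  move=> [[xpi xn]|[xm xn]]; split => //.
    by move/in_centered => xs; apply: xn; apply/in_centered; exact: lt_le_trans xs rS.
  apply/in_centered; move/in_centered : xm => /lt_le_trans; apply; exact: rad_pi.
have mG2 : measurable_fun setT (fun x => G x ^+ 2) by exact: measurableT_comp sqrF mG.
rewrite (@ge0_integral_setU_EFin _ _ _ (fun x => G x ^+ 2))//; last 2 first.
- by move=> x; exact: sqr_ge0.
- by move=> x [_ xn] [xm _].
rewrite big_ord_recr mulrDr EFinD; apply: leeD; first exact: IH.
apply: (le_trans (@integral_far_le (fun y => y ^+ 2) _ _ (rad0 m.+1) (measurable_ring _ _)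
    sqrF (fun _ _ => sqr_ge0 _) sqr_mono (@ring_far _ _))).
rewrite lebesgue_measure_ring ?(ltW (rad0 _))// -EFinM lee_fin.
apply: (@le_trans _ _ ((m.+2%:R / 2 * masses m.+1) ^+ 2 * (2 * (rad m - rad m.+1)))).
  by rewrite ler_wpM2r// mulr_ge0// subr_ge0.
have -> : (m.+2%:R / 2 * masses m.+1) ^+ 2 * (2 * (rad m - rad m.+1))
    = m.+2%:R / (2 * m.+1%:R) * masses m.+1 ^+ 2.
  by rewrite /rad; field; rewrite ?nat1r ?natrS -?natrD ?pnatr_eq0.
rewrite ler_wpM2r ?sqr_ge0// ler_pdivrMr ?mulr_gt0 ?ltr0n//.
by rewrite -!natrM ler_nat; lia.
Qed.

(** On the interval of radius [1 / (m + 1)] the cut-off bounds [G] by its value at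
    the end point, hence by a multiple of the last mass; the rest is cut into
    rings between successive radii. *)
Lemma integral_low_le m :
  (\int[mu]_(x in torus) (G x ^+ 2 * (G x <= G (rad m))%R%:R)%:E
   <= (3 * \sum_(j < m.+1) masses j ^+ 2)%:E)%E.
Proof.
set L := G (rad m).
have mlow : measurable_fun setT (fun x => G x ^+ 2 * (G x <= L)%R%:R).
  apply: measurable_funM; first exact: measurableT_comp sqrF mG.
  exact: (@measurable_indic_le R G L mG).
have low0 x : 0 <= G x ^+ 2 * (G x <= L)%R%:R by rewrite mulr_ge0 ?sqr_ge0.
rewrite -/(centered pi) (centered_split (rad_pi m) mlow low0).
have mc := measurable_centered; have mr := measurable_ring.
have -> : 3 * \sum_(j < m.+1) masses j ^+ 2
    = \sum_(j < m.+1) masses j ^+ 2 + 2 * \sum_(j < m.+1) masses j ^+ 2 by lra.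
rewrite EFinD; apply: leeD; last first.
  apply: le_trans (integral_outside_le m); apply: ge0_le_integral_EFin => //.
  - exact: measurableT_comp sqrF mG.
  - by move=> x _; case: (G x <= L); rewrite ?mulr1// mulr0 sqr_ge0.
apply: (@le_trans _ _ (\int[mu]_(x in centered (rad m)) (L ^+ 2)%:E)%E).
  apply: (@ge0_le_integral_EFin _ _ _ (cst (L ^+ 2))) => //.
  move=> x _ /=; case: (leP (G x) L) => h; rewrite ?mulr1 ?mulr0 ?sqr_ge0//.
  exact: sqr_mono.
rewrite integral_cst//=; last exact: mc.
rewrite lebesgue_measure_centered ?(ltW (rad0 _))// -EFinM lee_fin.
apply: (@le_trans _ _ ((m.+1%:R / 2 * masses m) ^+ 2 * (2 * rad m))).
  rewrite ler_wpM2r ?mulr_ge0 ?(ltW (rad0 _))//.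
  by apply: sqr_mono; [exact: G0|exact: level_le_masses].
have -> : (m.+1%:R / 2 * masses m) ^+ 2 * (2 * rad m) = m.+1%:R * masses m ^+ 2 / 2.
  by rewrite /rad; field; rewrite nat1r pnatr_eq0.
apply: (@le_trans _ _ (m.+1%:R * masses m ^+ 2)).
  have half : 2^-1 <= 1 :> R by rewrite invf_le1// ler1n.
  exact: (ler_piMr (mulr_ge0 (ler0n _ _) (sqr_ge0 _)) half).
rewrite mulr_natl -[X in _ *+ X]card_ord -sumr_const; apply: ler_sum => j _.
by apply: sqr_mono; rewrite ?masses_ge0// masses_le// -ltnS.
Qed.

(** Where [G] exceeds its value at [1 / (m + 1)], the point lies in the interval of
    that radius. *)
Lemma integral_high_le m :
  (\int[mu]_(x in torus) (G x * (G (rad m) < G x)%R%:R)%:E <= (masses m)%:E)%E.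
Proof.
set L := G (rad m); rewrite -/(centered pi).
have mhigh : measurable_fun setT (fun x => G x * (L < G x)%R%:R).
  by apply: measurable_funM => //; exact: (@measurable_indic_lt R G L mG).
have high0 x : 0 <= G x * (L < G x)%R%:R by rewrite mulr_ge0.
have mr := measurable_ring; have mc := measurable_centered.
rewrite (centered_split (rad_pi m) mhigh high0) [X in (_ + X)%E]integral0_eq.
  rewrite adde0 -(massE (rad_pi m)); apply: ge0_le_integral_EFin => // x _.
  by case: (L < G x); rewrite ?mulr1 ?mulr0.
move=> x /ring_far xr; rewrite ltNge Gdecr ?mulr0// ?gt_eqF//.
by rewrite (gtr0_norm (rad0 m)).
Qed.

End CenteredMass.

(** * Paley's inequality *)

Section Paley.
Variables (R : realType) (u : int -> R[i]).
Local Notation mu := (@lebesgue_measure R).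
Hypothesis u2 : ell2 u.
Let mT : measurable (@torus R) := @measurable_torus R.

Let g := fourier u.
Let sg : square_integrable g := is_fourier_square_integrable (fourierP u2).
Let phi x := cabs (g x).
Let G := sym_rearr g.
Let phiG : is_sym_rearr phi G := is_sym_rearr_cabs sg.
Let mphi : measurable_fun torus phi := measurable_cabs sg.1.
Let phi0 x : 0 <= phi x := cabs_ge0 (g x).
Let mG := measurable_sym_rearr phiG.
Let G0 := sym_rearr_ge0 phiG.
Let Gdecr := sym_rearr_nonincreasing phiG.

Lemma integrable_sym_rearr : mu.-integrable torus (EFin \o G).
Proof.
have [h _] := cintegrableM (square_integrable_rearr sg) (square_integrable_cst 1).
apply: eq_integrable h => // x _ /=.
by rewrite mulr1 mul0r subr0.
Qed.

Let iG := integrable_sym_rearr.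

Lemma cabs_inv_fourier_le (f : R -> R[i]) (r : R) n : cmeasurable f ->
  (\int[mu]_(x in torus) (cabs (f x))%:E <= r%:E)%E ->
  cabs (inv_fourier f n) <= 2 * fnorm R * r.
Proof.
move=> mf fr; have mk := measurable_cabs mf.
have intf : mu.-integrable torus (EFin \o (fun x => cabs (f x))).
  apply/integrableP; split; first exact/measurable_EFinP.
  apply: (@le_lt_trans _ _ r%:E); last exact: ltry.
  apply: le_trans fr; rewrite le_eqVlt; apply/orP; left; apply/eqP.
  by apply: eq_integral => x _; rewrite /= ger0_norm// cabs_ge0.
rewrite inv_fourierE cabsM cabs_real gtr0_norm ?fnorm_gt0//.
have me : cmeasurable (fun x => f x * cexp (n%:~R * x)).
  by apply: cmeasurableM => //; exact: cmeasurable_cexp.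
rewrite [2 * _]mulrC -mulrA ler_pM2l ?fnorm_gt0//.
have fk x : cabs (f x * cexp (n%:~R * x)) <= cabs (f x).
  by rewrite cabsM cabs_cexp mulr1.
apply: (le_trans (cabs_cint_le me intf fk)); rewrite ler_pM2l//.
rewrite -lee_fin; apply: le_trans fr.
rewrite /Rintegral fineK//; case/integrableP: intf => _ h.
rewrite ge0_fin_numE; last by apply: integral_ge0 => x _; rewrite lee_fin cabs_ge0.
apply: le_lt_trans h; rewrite le_eqVlt; apply/orP; left; apply/eqP.
by apply: eq_integral => x _; rewrite /= ger0_norm// cabs_ge0.
Qed.

Let mcut (b : R -> bool) : measurable_fun setT (fun y => (b y)%:R : R) ->
  square_integrable (fun x => g x * ((b (phi x))%:R%:C)%C).
Proof.
move=> mb; apply: (@square_integrableM_bounded _ _ _ 1 sg).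
  by apply: cmeasurable_real; exact: measurableT_comp mb mphi.
by move=> x; rewrite cabs_real; case: (b _); rewrite ?normr1 ?normr0.
Qed.

Lemma cabs_fourier_coef_le n : cabs (u n) <= 2 * fnorm R * (4 * masses G 0).
Proof.
rewrite -(inv_fourier_is_fourier n (fourierP u2)).
apply: cabs_inv_fourier_le; first by case: sg.
apply: le_trans (integral_torus_le_masses mG G0 Gdecr iG).
pose F (y : R) : \bar R := (Num.max y 0)%:E.
have mF : measurable_fun setT F.
  by apply/measurable_EFinP; exact: measurable_maxr.
have F0 y : (0 <= F y)%E by rewrite lee_fin le_max lexx orbT.
have := sym_rearr_integral mphi phiG phi0 mF F0.
have FE y : 0 <= y -> F y = y%:E by move=> y0; rewrite /F (max_idPl _).
under eq_integral do rewrite FE//.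
under [in X in _ = X]eq_integral do rewrite FE//.
by move=> ->.
Qed.

(** The Fourier transform is cut at the level [G (1 / (m + 1))].  The part above
    has coefficients of the order of the [m]-th mass at most, so a larger value
    of [u] is mostly due to the part below, whose coefficients are square
    summable by Bessel's inequality. *)
Lemma sum_large_coef_le (s : seq int) (m : nat) : uniq s ->
  \sum_(n <- s | 8 * fnorm R * masses G m < cabs (u n)) cabs (u n) ^+ 2
    <= 12 * \sum_(j < m.+1) masses G j ^+ 2.
Proof.
move=> us; set c := 8 * fnorm R; set L := G m.+1%:R^-1.
have L0 : 0 <= L by exact: G0.
have mle : measurable_fun setT (fun y : R => (y <= L)%R%:R : R).
  exact: (@measurable_indic_le R id L).
have mlt : measurable_fun setT (fun y : R => (L < y)%R%:R : R).
  exact: (@measurable_indic_lt R id L).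
pose low x := g x * (((phi x <= L)%R%:R)%:C)%C.
pose high x := g x * (((L < phi x)%R%:R)%:C)%C.
have slow : square_integrable low by exact: (mcut (b := fun y => y <= L)).
have shigh : square_integrable high by exact: (mcut (b := fun y => L < y)).
have glow : low = (fun x => g x - high x).
  apply/funext => x; rewrite /low /high leNgt.
  by case: (L < phi x); rewrite /= ?mulr1 ?mulr0 ?subr0 ?subrr.
have highle n : cabs (inv_fourier high n) <= 2 * fnorm R * masses G m.
  apply: cabs_inv_fourier_le; first by case: shigh.
  apply: le_trans (integral_high_le mG G0 Gdecr iG m).
  pose F (y : R) : \bar R := (y * (L < y)%R%:R)%:E.
  have mF : measurable_fun setT F by apply/measurable_EFinP; exact: measurable_funM.
  have F0 y : (0 <= F y)%E.
    rewrite lee_fin; case: (ltP L y) => h; rewrite ?mulr0// mulr1.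
    by apply: le_trans L0 (ltW h).
  have := sym_rearr_integral mphi phiG phi0 mF F0; rewrite /F => <-.
  rewrite le_eqVlt; apply/orP; left; apply/eqP; apply: eq_integral => x _.
  by rewrite /high cabsM cabs_real ger0_norm.
have lowle : (sqnorm low <= (3 * \sum_(j < m.+1) masses G j ^+ 2)%:E)%E.
  apply: le_trans (integral_low_le mG G0 Gdecr iG m).
  pose F (y : R) : \bar R := (y ^+ 2 * (y <= L)%R%:R)%:E.
  have mF : measurable_fun setT F.
    by apply/measurable_EFinP; apply: measurable_funM => //; exact: exprn_measurable.
  have F0 y : (0 <= F y)%E by rewrite lee_fin mulr_ge0 ?sqr_ge0.
  have := sym_rearr_integral mphi phiG phi0 mF F0; rewrite /F => <-.
  rewrite le_eqVlt; apply/orP; left; apply/eqP; apply: eq_integral => x _.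
  rewrite /low cabsM cabs_real exprMn; congr (_ * _)%:E.
  by case: (phi x <= L); rewrite ?normr1 ?normr0 ?expr1n ?expr0n.
have uE n : u n = inv_fourier low n + inv_fourier high n.
  by rewrite glow inv_fourierB// subrK (inv_fourier_is_fourier n (fourierP u2)).
have large n : c * masses G m < cabs (u n) ->
    cabs (u n) ^+ 2 <= 4 * cabs (inv_fourier low n) ^+ 2.
  move=> cu; have h1 := cabsD (inv_fourier low n) (inv_fourier high n).
  rewrite -uE in h1; have h2 := highle n.
  have l0 := cabs_ge0 (inv_fourier low n).
  have h3 : cabs (u n) <= 2 * cabs (inv_fourier low n) by move: cu; rewrite /c; lra.
  have -> : 4 * cabs (inv_fourier low n) ^+ 2 = (2 * cabs (inv_fourier low n)) ^+ 2.
    by rewrite exprMn; lra.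
  by rewrite ler_sqr ?nnegrE ?mulr_ge0 ?cabs_ge0.
apply: (@le_trans _ _ (\sum_(n <- s) 4 * cabs (inv_fourier low n) ^+ 2)).
  rewrite big_mkcond; apply: ler_sum => n _; case: ifP => [/large//|_].
  by rewrite mulr_ge0 ?sqr_ge0.
rewrite -mulr_sumr.
have : \sum_(n <- s) cabs (inv_fourier low n) ^+ 2 <= 3 * \sum_(j < m.+1) masses G j ^+ 2.
  by rewrite -lee_fin; exact: le_trans (bessel slow us) lowle.
by move=> h; apply: (le_trans (ler_wpM2l (ler0n R 4) h)); rewrite mulrA -natrM.
Qed.

End Paley.

(** * Coefficients of the rearranged function *)

(** Each index occurs at most [2 * m] times as a difference. *)
Lemma sum_toeplitz_le (R : realType) (a : nat -> R) (m : nat) :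
  (forall k, 0 <= a k) ->
  \sum_(j < m) \sum_(l < m) a `|j%:Z - l%:Z|%N <= 2 * m%:R * \sum_(k < m) a k.
Proof.
move=> a0; elim: m => [|m IH]; first by rewrite !big_ord0 mulr0.
have shift : \sum_(j < m) a (m - j)%N = \sum_(k < m) a k.+1.
  rewrite (reindex_inj rev_ord_inj)/=; apply: eq_bigr => j _; congr a.
  by have := ltn_ord j; lia.
have sumS : \sum_(k < m.+1) a k = a 0%N + \sum_(k < m) a k.+1.
  by rewrite big_ord_recl.
have -> : \sum_(j < m.+1) \sum_(l < m.+1) a `|j%:Z - l%:Z|%N
    = \sum_(j < m) \sum_(l < m) a `|j%:Z - l%:Z|%N
      + \sum_(k < m) a k.+1 + (\sum_(k < m) a k.+1 + a 0%N).
  rewrite big_ord_recr/=; congr (_ + _).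
    under eq_bigr do rewrite big_ord_recr/=.
    rewrite big_split/=; congr (_ + _); rewrite -shift; apply: eq_bigr => j _.
    by congr a; have := ltn_ord j; lia.
  rewrite big_ord_recr/= subrr; congr (_ + _); rewrite -shift; apply: eq_bigr => j _.
  by congr a; have := ltn_ord j; lia.
have mono : \sum_(k < m) a k <= \sum_(k < m.+1) a k by rewrite big_ord_recr/= lerDl.
have h := ler_wpM2l (ler0n R m) mono.
have := a0 0%N; rewrite -natr1; move: IH h sumS.
move: (\sum_(j < m) _) (\sum_(k < m) a k) (\sum_(k < m.+1) a k) (\sum_(k < m) a k.+1).
by move=> w x y z; nra.
Qed.

Section Fejer.
Variables (R : realType) (u : int -> R[i]).
Local Notation mu := (@lebesgue_measure R).
Local Notation Re := complex.Re.
Hypothesis u2 : ell2 u.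
Let mT : measurable (@torus R) := @measurable_torus R.

Let g := fourier u.
Let sg : square_integrable g := is_fourier_square_integrable (fourierP u2).
Let phi x := cabs (g x).
Let G := sym_rearr g.
Let phiG : is_sym_rearr phi G := is_sym_rearr_cabs sg.
Let mG := measurable_sym_rearr phiG.
Let G0 := sym_rearr_ge0 phiG.
Let Gdecr := sym_rearr_nonincreasing phiG.
Let iG := integrable_sym_rearr u2.
Let rg (x : R) : R[i] := (G x)%:C%C.
Let a (k : nat) : R := cabs (fourier_rearr u k%:Z).

(** [G] is tested against the square of the modulus of
    [\sum_(j <= n) e ^ (i j x)].  This Fejer kernel is nonnegative, of order
    [n ^ 2] for [`|x| < 1 / (n + 1)] because [cos 1 > 0], and only involves the
    coefficients of [G] of index at most [n]. *)
Lemma masses_le_mean_coef n :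
  masses G n <= 2 / (fnorm R * cos 1 ^+ 2) * ((\sum_(k < n.+1) a k) / n.+1%:R).
Proof.
set m := n.+1; pose E x : R[i] := \sum_(j < m) cexp ((j%:Z)%:~R * x).
have cE x : conjc (E x) = \sum_(l < m) cexp (- ((l%:Z)%:~R * x)).
  rewrite /E (big_morph _ (@conjD R) (@conjc0 R)); apply: eq_bigr => j _.
  exact: cexp_conj.
pose F x := rg x * (E x * conjc (E x)).
have ie k : cintegrable (fun x => rg x * cexp (k%:~R * x)).
  exact: (cintegrableM (square_integrable_rearr sg) (square_integrable_cexp _)).
have FE : F = (fun x => \sum_(j < m) \sum_(l < m)
    (rg x * cexp ((j%:Z - l%:Z)%:~R * x))).
  apply/funext => x; rewrite /F cE /E mulr_suml mulr_sumr; apply: eq_bigr => j _.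
  rewrite mulr_sumr mulr_sumr; apply: eq_bigr => l _.
  by rewrite -cexpD rmorphB/= mulrBl.
have iF : cintegrable F.
  by rewrite FE; apply: cintegrable_sum => j; apply: cintegrable_sum => l; exact: ie.
have coefF : (fnorm R)%:C%C * cint F
    = \sum_(j < m) \sum_(l < m) fourier_rearr u (j%:Z - l%:Z).
  rewrite FE cint_sum; last by move=> j; apply: cintegrable_sum => l; exact: ie.
  rewrite mulr_sumr; apply: eq_bigr => j _; rewrite cint_sum; last by move=> l; exact: ie.
  by rewrite mulr_sumr.
have FR x : Re (F x) = G x * cabs (E x) ^+ 2.
  by rewrite /F mul_conj_cabs ReM/= mul0r subr0.
have upper : fnorm R * Re (cint F) <= 2 * m%:R * \sum_(k < m) a k.
  have -> : fnorm R * Re (cint F) = Re ((fnorm R)%:C%C * cint F).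
    by rewrite ReM/= mul0r subr0.
  rewrite coefF; apply: le_trans (ler_norm _) _; apply: le_trans (normr_Re_le _) _.
  apply: le_trans (sum_toeplitz_le m (fun k => cabs_ge0 (fourier_rearr u k%:Z))).
  apply: le_trans (cabs_sum _ _) _; apply: ler_sum => j _.
  apply: le_trans (cabs_sum _ _) _; apply: ler_sum => l _.
  have sym k : cabs (fourier_rearr u (- k)) = cabs (fourier_rearr u k).
    exact: inv_fourier_real_conj.
  have [jl|jl] := leP 0 (j%:Z - l%:Z); first by rewrite gez0_abs.
  by rewrite -sym ltz0_abs.
pose k1 := cos 1 : R; have k10 : 0 < k1 by exact: cos1_gt0.
have m0 : 0 < m%:R :> R by rewrite ltr0n.
have Elow x : centered m%:R^-1 x -> (k1 * m%:R) ^+ 2 <= cabs (E x) ^+ 2.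
  move=> /in_centered xm; rewrite ler_sqr ?nnegrE ?cabs_ge0 ?mulr_ge0 ?(ltW k10)//.
  apply: le_trans (le_trans (ler_norm _) (normr_Re_le _)).
  rewrite /E Re_sum/= mulr_natr -[X in _ *+ X]card_ord -sumr_const.
  apply: ler_sum => j _; rewrite /k1 -[leRHS]cos_norm.
  have jx : `|(j%:Z)%:~R * x| <= 1.
    rewrite normrM ger0_norm ?ler0z//.
    apply: (@le_trans _ _ (m%:R * m%:R^-1)); last by rewrite divff ?gt_eqF.
    by apply: ler_pM => //; [rewrite ler_nat ltnW|exact: ltW].
  have p2 : 2 <= pi :> R := pi_ge2 R.
  have p1 : 1 <= pi :> R by apply: le_trans p2; rewrite ler1n.
  have h0 : `|(j%:Z)%:~R * x| \in `[0, pi] by rewrite in_itv/= normr_ge0 (le_trans jx).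
  have h1 : (1 : R) \in `[0, pi] by rewrite in_itv/= ler01.
  by rewrite leNgt ltr_cos// -leNgt.
have lower : (k1 * m%:R) ^+ 2 * masses G n <= Re (cint F).
  have mpi : m%:R^-1 <= pi :> R.
    by apply: (@le_trans _ _ 1); [rewrite invf_le1// ler1n|have := pi_ge2 R; lra].
  have mc := measurable_centered (m%:R^-1 : R).
  have mF : measurable_fun torus (fun x => (G x * cabs (E x) ^+ 2)%:E).
    case: iF => /(measurable_int mu) + _; apply: eq_measurable_fun => x _.
    by rewrite FR.
  have F0 x : torus x -> (0 <= (G x * cabs (E x) ^+ 2)%:E)%E.
    by rewrite lee_fin mulr_ge0 ?sqr_ge0.
  have mGc (t : R) : measurable_fun setT (fun x => t * G x) by exact: measurable_funM.
  have -> : Re (cint F) = \int[mu]_(x in torus) (G x * cabs (E x) ^+ 2).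
    by apply: eq_Rintegral => x _; rewrite FR.
  have fin : (\int[mu]_(x in torus) (G x * cabs (E x) ^+ 2)%:E)%E \is a fin_num.
    rewrite ge0_fin_numE; last exact: integral_ge0.
    case: iF => /integrableP[_ +] _; apply: le_lt_trans.
    rewrite le_eqVlt; apply/orP; left; apply/eqP; apply: eq_integral => x _.
    by rewrite FR /= ger0_norm// mulr_ge0// sqr_ge0.
  rewrite -lee_fin /Rintegral (fineK fin) EFinM -(massE mG G0 iG mpi).
  have sub := centered_torus mpi.
  apply: (@le_trans _ _ (\int[mu]_(x in centered m%:R^-1) (G x * cabs (E x) ^+ 2)%:E)%E).
    rewrite -ge0_integralZl//; last 3 first.
    - by apply: measurable_funTS; apply/measurable_EFinP.
    - by move=> x _; rewrite lee_fin.
    - by rewrite lee_fin sqr_ge0.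
    apply: ge0_le_integral => //.
    - by move=> x _; rewrite -EFinM lee_fin mulr_ge0// sqr_ge0.
    - by apply: measurable_funTS; apply/measurable_EFinP; exact: mGc.
    - exact: measurable_funS mF.
    - by move=> x xc; rewrite -EFinM lee_fin mulrC ler_wpM2l// Elow.
  exact: ge0_subset_integral.
have f0 := fnorm_gt0 R.
have kk : 0 < fnorm R * k1 ^+ 2 by rewrite mulr_gt0// exprn_gt0.
have := le_trans (ler_wpM2l (ltW f0) lower) upper.
rewrite -/k1 => H.
rewrite mulrA [2 / _ * _]mulrAC ler_pdivlMr// ler_pdivlMr// -(ler_pM2r m0); move: H.
have -> : fnorm R * ((k1 * m%:R) ^+ 2 * masses G n)
        = masses G n * m%:R * (fnorm R * k1 ^+ 2) * m%:R by ring.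
by rewrite [2 * (\sum_(k < m) a k) * _]mulrAC.
Qed.

End Fejer.

(** Hardy's inequality turns the previous bound by means into one by sums. *)
Lemma sum_masses_le (R : realType) (p : R) : 1 < p -> exists2 C : R, 0 <= C &
  forall u : int -> R[i], ell2 u -> forall N,
  \sum_(j < N) masses (sym_rearr (fourier u)) j `^ p
  <= C * \sum_(k < N) cabs (fourier_rearr u k%:Z) `^ p.
Proof.
move=> p1; have [C C0 HC] := hardy p1.
pose d : R := 2 / (fnorm R * cos 1 ^+ 2).
have d0 : 0 <= d.
  by rewrite divr_ge0// mulr_ge0 ?sqr_ge0// ltW// fnorm_gt0.
have p0 : 0 <= p by apply: le_trans (ltW p1).
exists (d `^ p * C); first by rewrite mulr_ge0// powR_ge0.
move=> u u2 N; rewrite -mulrA.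
have a0 k : 0 <= cabs (fourier_rearr u k%:Z) by exact: cabs_ge0.
apply: le_trans (ler_wpM2l (powR_ge0 d p) (HC _ N a0)).
rewrite mulr_sumr; apply: ler_sum => j _.
have M0 : 0 <= (\sum_(k < j.+1) cabs (fourier_rearr u k%:Z)) / j.+1%:R.
  by rewrite divr_ge0// sumr_ge0.
rewrite -powRM//; apply: ge0_ler_powR => //; last exact: masses_le_mean_coef.
- by rewrite nnegrE; apply: masses_ge0; exact: sym_rearr_ge0 (is_sym_rearr_cabs (is_fourier_square_integrable (fourierP u2))).
- by rewrite nnegrE mulr_ge0.
Qed.

(** * Comparing the norms of [u] and of its rearrangement *)

Section Comparison.
Variables (R : realType) (u : int -> R[i]).
Hypothesis u2 : ell2 u.

Let g := fourier u.
Let sg : square_integrable g := is_fourier_square_integrable (fourierP u2).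
Let phiG := is_sym_rearr_cabs sg.
Let mG := measurable_sym_rearr phiG.
Let G0 := sym_rearr_ge0 phiG.
Let Gdecr := sym_rearr_nonincreasing phiG.
Let iG := integrable_sym_rearr u2.
Let b := masses (sym_rearr g).
Let b0 m : 0 <= b m := masses_ge0 G0 m.
Let a (k : nat) := cabs (fourier_rearr u k%:Z).

(** The masses are square summable, by the bound on their sums for the exponent 2
    and Bessel's inequality. *)
Lemma masses_vanish (e : R) : 0 < e -> exists M, b M < e.
Proof.
move=> e0; have [C C0 HC] := @sum_masses_le R 2 (ltr1n R 2).
pose q := fine (sqnorm g).
have qE : sqnorm g = q%:E.
  by rewrite /q fineK// ge0_fin_numE ?sqnorm_ge0//; case: sg.
have aq N : \sum_(k < N) a k `^ 2 <= q.
  have uN : uniq [seq k%:Z | k <- iota 0 N].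
    by rewrite map_inj_uniq ?iota_uniq// => x y [].
  have := bessel (square_integrable_rearr sg) uN.
  rewrite (sqnorm_rearr sg) -/g qE lee_fin big_map -[N in iota 0 N]subn0 big_mkord.
  by apply: le_trans; apply: ler_sum => k _; rewrite powR_mulrn// cabs_ge0.
apply: contrapT => /forallNP small.
pose N := (Num.truncn (C * q / e ^+ 2)).+1.
have : N%:R * e ^+ 2 <= C * q.
  apply: le_trans (ler_wpM2l C0 (aq N)); apply: le_trans (HC u u2 N).
  rewrite mulr_natl -[X in _ *+ X]card_ord -sumr_const; apply: ler_sum => j _.
  rewrite powR_mulrn ?b0// ler_sqr ?nnegrE ?b0 ?(ltW e0)//.
  by rewrite leNgt; apply/negP; exact: small.
apply/negP; rewrite -ltNge -ltr_pdivrMr ?exprn_gt0//; exact: truncnS_gt.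
Qed.

(** Since the masses tend to [0], the bounds on the large entries of [u] reach all
    nonzero entries of a finite family. *)
Lemma sum_coef_powR_le (p : R) (s : seq int) : 2 < p -> uniq s -> exists M,
  \sum_(n <- s) cabs (u n) `^ p
  <= 12 * (2 * (8 * fnorm R)) `^ (p - 2) * \sum_(j < M) b j `^ p.
Proof.
move=> p2 us; set c := 8 * fnorm R.
have f0 : 0 < fnorm R := fnorm_gt0 R.
have c0 : 0 < c by rewrite mulr_gt0.
have bdecr m n : (m <= n)%N -> b n <= b m by exact: masses_le.
have [M HM] : exists M, forall n, n \in s -> cabs (u n) != 0 -> c * b M < cabs (u n).
  elim: s {us} => [|n s [M IH]]; first by exists 0%N.
  have [un0|un0] := eqVneq (cabs (u n)) 0.
    by exists M => k; rewrite in_cons => /predU1P[->|/IH//]; rewrite un0 eqxx.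
  have un : 0 < cabs (u n) / c by rewrite divr_gt0// lt_neqAle eq_sym un0 cabs_ge0.
  have [M' HM'] := masses_vanish un.
  exists (maxn M M') => k; rewrite in_cons => /predU1P[-> _|ks k0].
    rewrite mulrC -ltr_pdivlMr//; apply: le_lt_trans HM'.
    by apply: bdecr; exact: leq_maxr.
  apply: le_lt_trans (IH k ks k0); rewrite ler_wpM2l ?(ltW c0)//.
  by apply: bdecr; exact: leq_maxl.
exists M.+1.
have -> : \sum_(n <- s) cabs (u n) `^ p
    = \sum_(n <- s | c * b M < cabs (u n)) cabs (u n) `^ p.
  rewrite [RHS]big_mkcond big_seq [RHS]big_seq; apply: eq_bigr => n ns.
  case: ifPn => // cu; have [->|/(HM n ns)] := eqVneq (cabs (u n)) 0.
    by rewrite powR0// gt_eqF// (lt_trans _ p2).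
  by rewrite (negbTE cu).
apply: sum_powR_of_level_squares => //.
- exact: ltW.
- by move=> j; exact: bdecr.
- by move=> j; exact: masses_doubling.
- move=> n; rewrite cabs_ge0/=; have := cabs_fourier_coef_le u2 n.
  by rewrite mulrA [2 * _ * 4]mulrAC -natrM.
- by move=> m; exact: sum_large_coef_le.
Qed.

Lemma sum_rearr_powR_le_esum (p : R) N : 0 <= p ->
  ((\sum_(k < N) a k `^ p)%:E
   <= \esum_(n in [set: int]) (`|sym_decr_rearr u n| `^ p)%:E)%E.
Proof.
move=> p0; have dr := decr_rearr_fourier_rearr u2.
have uN : uniq [seq k%:Z | k <- iota 0 N].
  by rewrite map_inj_uniq ?iota_uniq// => x y [].
apply: le_trans (sum_seq_le_esum (fun n => (`|sym_decr_rearr u n| `^ p)%:E) uN).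
rewrite -[N in iota 0 N]subn0 big_map big_mkord sumEFin lee_fin.
have mono x y : 0 <= x -> x <= y -> x `^ p <= y `^ p.
  move=> x0 xy; apply: ge0_ler_powR => //; rewrite nnegrE ?(le_trans x0)//.
apply: le_trans (sum_le_decr_rearr N dr (fun k => cabs_ge0 _) mono) _.
apply: ler_sum => k _; by rewrite ger0_norm ?lexx//; exact: dr.1.
Qed.

End Comparison.

Theorem theorem4p1 (R : realType) :
  (forall p : R, 2 < p ->
     exists c : R, forall u : int -> R[i], ell2 u ->
       (\esum_(n in [set: int]) ((cabs (u n) `^ p)%R)%:E
        <= c%:E *
           \esum_(n in [set: int]) ((`|sym_decr_rearr u n| `^ p)%R)%:E)%E)
  /\
  (forall u : int -> R[i], ell2 u ->
     (\esum_(n in [set: int]) ((cabs (u n - u (n - 1)) ^+ 2)%R)%:E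
      >= \esum_(n in [set: int])
           ((`|sym_decr_rearr u n - sym_decr_rearr u (n - 1)| ^+ 2)%R)%:E)%E).
Proof.
split=> [p p2|u u2]; last exact: energy_sym_decr_rearr.
have [C C0 HC] := sum_masses_le (lt_trans (ltr1n R 2) p2).
pose K : R := 12 * (2 * (8 * fnorm R)) `^ (p - 2).
have K0 : 0 <= K by rewrite mulr_ge0 ?powR_ge0.
exists (K * C) => u u2; apply: esum_le_sum_seq => s us.
have [M HM] := sum_coef_powR_le u2 p2 us.
rewrite sumEFin; apply: (@le_trans _ _ (K * C * \sum_(k < M) cabs (fourier_rearr u k%:Z) `^ p)%:E).
  rewrite lee_fin -mulrA; apply: le_trans HM _.
  by rewrite ler_wpM2l//; exact: HC.
rewrite EFinM; apply: lee_wpmul2l; first by rewrite lee_fin mulr_ge0.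
by apply: sum_rearr_powR_le_esum => //; rewrite ltW// (lt_trans _ p2).
Qed.
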